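(* There is an ascending function $C : \mathbb{Z}_+ \times \mathbb{Z}_+ \times \mathbb{N} \to \mathbb{Z}_+$ with the following property: if $R = K[x_1,\ldots,x_N]$ is a polynomial ring over an arbitrary field $K$ (any $N$) and $M$ is the cokernel of an $m \times n$ matrix over $R$ whose entries are polynomials of degree at most $d$, then the projective dimension of $M$ over $R$ is at most $C(m,n,d)$.
   Context: A function $\mathbb{N}^h \to \mathbb{Z}$ (or defined on a product of subsets of $\mathbb{N}$) is ascending if it is nondecreasing in each argument when the others are fixed. *)

(* Defs.v *)
From HB Require Import structures.
From mathcomp Require Import all_boot all_order all_algebra.
From mathcomp Require Import mpoly.
Set Implicit Arguments. Unset Strict Implicit. Unset Printing Implicit Defensive.
Import Order.TTheory GRing.Theory.
Local Open Scope ring_scope.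

Definition projective (R : pzRingType) (P : lmodType R) : Prop :=
  forall (M Nm : lmodType R) (f : {linear M -> Nm}) (g : {linear P -> Nm}),
    (forall y : Nm, exists x : M, f x = y) ->
    exists h : {linear P -> M}, forall p : P, f (h p) = g p.

(* pd_le A k : the cokernel  R^m / (A R^n)  of the m x n matrix A (acting on
   column vectors) has a projective resolution of length <= k:
     0 -> P_k -> ... -> P_1 -> P_0 -> coker A -> 0,
   where P_0 -> coker A is  e  followed by the quotient map R^m -> coker A.
   Modules P_i with i > k are zero. *)
Definition pd_le (R : pzRingType) (m n : nat) (A : 'M[R]_(m, n)) (k : nat)
  : Prop :=
  exists (P : nat -> lmodType R)
         (d : forall i : nat, {linear P i.+1 -> P i})
         (e : {linear P 0%N -> 'cV[R]_m}),
    [/\ (forall i, (i <= k)%N -> projective (P i)),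
        (forall i, (k <= i)%N -> forall x : P i.+1, x = 0),
        (* P_0 -> coker A is surjective *)
        (forall y : 'cV[R]_m, exists (x : P 0%N) (z : 'cV[R]_n),
            y = e x + A *m z),
        (* exactness at P_0 : kernel of P_0 -> coker A is the image of d 0 *)
        (forall x : P 0%N,
            (exists z : 'cV[R]_n, e x = A *m z) <-> exists w, d 0%N w = x) &
        (forall i (x : P i.+1), d i x = 0 <-> exists w, d i.+1 w = x)].

Definition ascending3 (C : nat -> nat -> nat -> nat) : Prop :=
  forall m m' n n' d d', (0 < m)%N -> (0 < n)%N ->
    (m <= m')%N -> (n <= n')%N -> (d <= d')%N -> (C m n d <= C m' n' d')%N.

(* Main.v *)
(** The proof bounds the number of generators of a subalgebra over which the
whole polynomial ring is flat.  Let [S = K[x_1,..,x_N]].  A form is weak if it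
is a short sum of products of forms of smaller positive degree; a family of
forms is strong if no nontrivial combination of members of equal degree is
weak.  Replacing a weak member by the factors of its decomposition terminates
after a number of steps bounded independently of [K] and [N], so the
homogeneous components of the entries of the matrix lie in [K[E]] for a strong
family [E] of bounded size.

A sufficiently strong [E] over a perfect field satisfies no algebraic relation
of bounded degree: differentiating a relation lowers its degree once [E] is
enlarged by the (Hasse) derivatives of its members, and the top-degree part of
a minimal relation would make a combination of members of [E] weak.  Over an
infinite field, if [f_1,..,f_r] is regular but [f_r+1] is a zero divisor modulo
[I = (f_1,..,f_r)], then a minimal integral equation of [f_r+1] over linear
parameters of [S/I] has zero constant term, so some [h] of bounded degree
outside [I] satisfies [h * f_r+1] in [I]; enlarging [E] by [h] and its
cofactors turns this into a forbidden relation.  Hence [E] is a regular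
sequence, [S] is flat over [K[E]], and Hilbert's syzygy theorem over [K[E]]
bounds the length of a resolution by the size of [E].  The base field is first
replaced by the perfect closure of [K(t)]; the existence of a splitting is a
linear condition, which descends along field extensions. *)

Require Import Defs.
From HB Require Import structures.
From mathcomp Require Import all_boot all_order all_algebra.
From mathcomp Require Import mpoly.
From mathcomp Require Import polyXY fraction generic_quotient ring zify.
From Stdlib Require Import Classical ClassicalEpsilon.
Set Implicit Arguments. Unset Strict Implicit. Unset Printing Implicit Defensive.
Import Order.TTheory GRing.Theory.
Local Open Scope ring_scope.

(** * Split resolutions *)

(** Two obstacles shape the argument. The strength needed of a family depends on its size, while
    strengthening a family enlarges it. Refinement therefore takes the demanded strength as a
    function [kap] of the final size, and it works relative to a family [E] left untouched, because
    independence of [E] is tested inside extensions of [E] by derivatives or cofactors. Secondly, in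
    characteristic p derivatives do not see p-th powers, so the induction on the degree of relations
    carries a statement on polynomials all of whose derivatives vanish ([diff_faithful]).
    Perfectness turns a form with vanishing derivatives into a proper power, which is weak. An
    infinite field supplies points where a given polynomial does not vanish, needed to change linear
    parameters. Resolutions are handled as chains of matrices; modules enter only when the final
    chain is turned into [pd_le]. *)

Definition syz (R : comNzRingType) (m n q : nat) (A : 'M[R]_(m, n))
    (D : 'M[R]_(n, q)) : Prop :=
  A *m D = 0 /\ forall v : 'cV[R]_n, A *m v = 0 -> exists w, v = D *m w.

(** [A *m T *m A = A] makes [A *m T] an idempotent with the same image as [A], so this image is a
    direct summand and the cokernel is projective. [spl k A] asks this of some k-th syzygy matrix of
    [A]. *)
Fixpoint spl (R : comNzRingType) (k m n : nat) (A : 'M[R]_(m, n)) : Prop :=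
  match k with
  | 0 => exists T : 'M[R]_(n, m), A *m T *m A = A
  | k'.+1 => exists (q : nat) (D : 'M[R]_(n, q)), syz A D /\ spl k' D
  end.

Definition coherent (R : comNzRingType) : Prop :=
  forall m n (A : 'M[R]_(m, n)), exists (q : nat) (D : 'M[R]_(n, q)), syz A D.

Lemma colwise_image (R : comNzRingType) n q p (B : 'M[R]_(n, p))
    (D : 'M[R]_(n, q)) :
  (forall j, exists w : 'cV[R]_q, col j B = D *m w) -> exists W, B = D *m W.
Proof.
move=> /fin_all_exists[w hw]; exists (\matrix_(i, j) w j i 0).
apply/matrixP => i j; have /matrixP/(_ i 0) := hw j; rewrite !mxE => ->.
by apply: eq_bigr => k _; rewrite !mxE.
Qed.

Lemma syz_factor (R : comNzRingType) m n q p (A : 'M[R]_(m, n))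
    (D : 'M[R]_(n, q)) (B : 'M[R]_(n, p)) :
  syz A D -> A *m B = 0 -> exists W, B = D *m W.
Proof.
move=> [_ kerA] AB; apply: colwise_image => j; apply: kerA.
by rewrite colE mulmxA AB mul0mx.
Qed.

(** [1 - T A] projects onto the kernel of [A], so it factors as [D W]; then [D W D = D] because
    [A D = 0]. *)
Lemma spl_succ (R : comNzRingType) k m n (A : 'M[R]_(m, n)) :
  coherent R -> spl k A -> spl k.+1 A.
Proof.
move=> cohR; elim: k m n A => [|k IH] m n A; last first.
  by move=> [q [D [sD splD]]]; exists q, D; split=> //; apply: IH.
move=> [T ATA]; have [q [D sD]] := cohR _ _ A.
exists q, D; split=> //.
have [|W hW] := syz_factor (B := 1%:M - T *m A) sD.
  by rewrite mulmxBr mulmx1 mulmxA ATA subrr.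
by exists W; rewrite -hW mulmxBl mul1mx -mulmxA sD.1 mulmx0 subr0.
Qed.

Lemma spl_le (R : comNzRingType) k l m n (A : 'M[R]_(m, n)) :
  coherent R -> (k <= l)%N -> spl k A -> spl l A.
Proof.
move=> cohR /subnK <-; elim: (l - k)%N => // j IH sA.
by rewrite addSn; apply: spl_succ => //; apply: IH.
Qed.

(* [dominates A' A]: up to homotopy, [A] is a retract of [A'] as a two-term
   complex.  The relation passes to syzygies, which makes [spl] independent of
   the chosen resolution. *)
Definition dominates (R : comNzRingType) m n m' n' (A' : 'M[R]_(m', n'))
    (A : 'M[R]_(m, n)) : Prop :=
  exists (f0 : 'M[R]_(m', m)) (f1 : 'M[R]_(n', n)) (g0 : 'M[R]_(m, m'))
         (g1 : 'M[R]_(n, n')) (s : 'M[R]_(n, m)),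
    [/\ f0 *m A = A' *m f1, g0 *m A' = A *m g1 & A - g0 *m f0 *m A = A *m s *m A].

(** The homotopy identity says that the columns of [1 - g1 f1 - s A] lie in the kernel of [A]; the
    factor of this matrix through [D] is the next homotopy. *)
Lemma dominates_syz (R : comNzRingType) m n q m' n' q' (A : 'M[R]_(m, n))
    (D : 'M[R]_(n, q)) (A' : 'M[R]_(m', n')) (D' : 'M[R]_(n', q')) :
  syz A D -> syz A' D' -> dominates A' A -> dominates D' D.
Proof.
move=> sD sD' [f0 [f1 [g0 [g1 [s [fA gA hA]]]]]].
have [|f2 hf] := syz_factor (B := f1 *m D) sD'.
  by rewrite mulmxA -fA -mulmxA sD.1 mulmx0.
have [|g2 hg] := syz_factor (B := g1 *m D') sD.
  by rewrite mulmxA -gA -mulmxA sD'.1 mulmx0.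
have [|s' hs] := syz_factor (B := 1%:M - g1 *m f1 - s *m A) sD.
  by rewrite !mulmxBr mulmx1 !mulmxA -gA -!(mulmxA g0) -fA !mulmxA hA subrr.
exists f1, f2, g1, g2, s'; split=> //.
by rewrite -hs !mulmxBl mul1mx -(mulmxA s) sD.1 mulmx0 subr0.
Qed.

Lemma spl_dominates (R : comNzRingType) k m n m' n' (A : 'M[R]_(m, n))
    (A' : 'M[R]_(m', n')) :
  coherent R -> dominates A' A -> spl k A' -> spl k A.
Proof.
move=> cohR; elim: k m n m' n' A A' => [|k IH] m n m' n' A A' dom; last first.
  move=> [q' [D' [sD' splD']]]; have [q [D sD]] := cohR _ _ A.
  exists q, D; split=> //; apply: IH splD'; exact: dominates_syz dom.
move: dom => [f0 [f1 [g0 [g1 [s [fA gA hA]]]]]] [T hT].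
(* The splitting is transported through the retract: [A g1 T f0 A = g0 A' T A' f1 = g0 f0 A], and
   [s] supplies the missing [A - g0 f0 A]. *)
exists (g1 *m T *m f0 + s); rewrite mulmxDr mulmxDl -hA !mulmxA -gA.
rewrite -!(mulmxA _ f0) fA -!mulmxA (mulmxA A') (mulmxA (A' *m T)) hT.
by rewrite addrC subrK.
Qed.

Lemma spl_same_image (R : comNzRingType) k m n n' (A : 'M[R]_(m, n))
    (A' : 'M[R]_(m, n')) (X : 'M_(n', n)) (X' : 'M_(n, n')) :
  coherent R -> A = A' *m X -> A' = A *m X' -> spl k A' -> spl k A.
Proof.
move=> cohR hX hX'; apply: spl_dominates => //.
exists 1%:M, X, 1%:M, X', 0.
by split; rewrite ?mul1mx // mulmx0 mul0mx subrr.
Qed.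

(** Flatness in equational form: generating syzygies stay generating after base change. *)
Definition flat_hom (R R' : comNzRingType) (f : {rmorphism R -> R'}) : Prop :=
  forall m n q (A : 'M[R]_(m, n)) (D : 'M[R]_(n, q)),
    syz A D -> syz (map_mx f A) (map_mx f D).

Lemma spl_flat (R R' : comNzRingType) (f : {rmorphism R -> R'}) k m n
    (A : 'M[R]_(m, n)) :
  flat_hom f -> spl k A -> spl k (map_mx f A).
Proof.
move=> flatf; elim: k m n A => [|k IH] m n A.
  by move=> [T hT]; exists (map_mx f T); rewrite -!map_mxM hT.
move=> [q [D [sD splD]]]; exists q, (map_mx f D).
by split; [apply: flatf | apply: IH].
Qed.

(** * Projective resolutions from split resolutions *)

Lemma projective_cV (R : comNzRingType) (n : nat) : projective 'cV[R]_n.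
Proof.
move=> M Nm f g surj.
have [b hb] : exists b : 'I_n -> M, forall i, f (b i) = g (delta_mx i 0).
  have /fin_all_exists[b hb] : forall i, exists x, f x = g (delta_mx i 0).
    by move=> i; apply: surj.
  by exists b.
pose h (v : 'cV[R]_n) := \sum_i v i 0 *: b i.
have hlin : linear h.
  move=> c u v; rewrite /h scaler_sumr -big_split; apply: eq_bigr => i _.
  by rewrite !mxE scalerDl scalerA.
pose H := GRing.isLinear.Build _ _ _ _ _ hlin.
pose hL : {linear 'cV[R]_n -> M} := HB.pack h H.
exists hL => v; rewrite /hL /= /h linear_sum.
rewrite [in RHS](matrix_sum_delta v) linear_sum; apply: eq_bigr => i _.
by rewrite linear_sum big_ord1 !linearZ /= hb.
Qed.

Section KernelModule.
Variables (R : comNzRingType) (m n : nat) (A : 'M[R]_(m, n)).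

Definition in_ker : {pred 'cV[R]_n} := fun v => A *m v == 0.

Fact in_ker_submod : submod_closed in_ker.
Proof.
split=> [|c u v]; first by apply/eqP; rewrite mulmx0.
by move=> /eqP hu /eqP hv; apply/eqP; rewrite mulmxDr -scalemxAr hu hv scaler0 addr0.
Qed.

HB.instance Definition _ :=
  GRing.isSubmodClosed.Build R 'cV[R]_n in_ker in_ker_submod.

(** Two kernels are needed: that of an idempotent [A *m T], isomorphic to the cokernel of [A], and
    that of the 1 x 1 identity, which is the zero module. *)
Record ker_mod := KerMod { ker_val :> 'cV[R]_n; _ : ker_val \in in_ker }.
HB.instance Definition _ := [isSub for ker_val].
HB.instance Definition _ := [Choice of ker_mod by <:].
HB.instance Definition _ := [SubChoice_isSubLmodule of ker_mod by <:].

Fact ker_val_linear : linear ker_val. Proof. by []. Qed.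
HB.instance Definition _ :=
  GRing.isLinear.Build R ker_mod 'cV[R]_n _ ker_val ker_val_linear.

Lemma ker_valP (x : ker_mod) : A *m x = 0.
Proof. by case: x => x /= /eqP. Qed.

End KernelModule.

(** For [k = 0] the resolution is the kernel of the idempotent [A T] alone. In the step, the
    cokernel of [D] is isomorphic to the image of [A], so its resolution is prolonged by ['cV[R]_m]
    through [mulmx A \o e']. *)
Lemma spl_pd_le (R : comNzRingType) k m n (A : 'M[R]_(m, n)) :
  spl k A -> pd_le A k.
Proof.
elim: k m n A => [|k IH] m n A.
  move=> [T hT]; pose P0 : lmodType R := ker_mod (A *m T).
  pose Z : lmodType R := ker_mod (1%:M : 'M[R]_1).
  have Z0 (x : Z) : x = 0.
    by apply: val_inj => /=; have := ker_valP x; rewrite mul1mx.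
  pose P (i : nat) : lmodType R := if i is 0 then P0 else Z.
  pose d i : {linear P i.+1 -> P i} := \0.
  exists P, d.
  exists (@ker_val _ _ _ (A *m T) : {linear _ -> _}).
  have ker_proj (v : 'cV[R]_m) : v - A *m T *m v \in in_ker (A *m T).
    by apply/eqP; rewrite mulmxBr !mulmxA hT subrr.
  split=> //.
  - case=> // _ M Nm f g surj.
    pose pr (v : 'cV[R]_m) : P0 := KerMod (ker_proj v).
    have prlin : linear pr.
      move=> c u v; apply: val_inj => /=; rewrite mulmxDr -scalemxAr.
      by rewrite scalerBr opprD addrACA.
    pose H := GRing.isLinear.Build _ _ _ _ _ prlin.
    pose prL : {linear 'cV[R]_m -> P0} := HB.pack pr H.
    have [h hh] := projective_cV (g \o prL) surj.
    exists (h \o @ker_val _ _ _ (A *m T)) => p /=; rewrite hh /=; congr (g _).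
    by apply: val_inj => /=; rewrite ker_valP subr0.
  - move=> y; exists (KerMod (ker_proj y)), (T *m y) => /=.
    by rewrite mulmxA subrK.
  - move=> x; split=> [[z /= hz]|[w <-]]; last by exists 0; rewrite mulmx0.
    exists 0; apply/esym/val_inj => /=.
    by rewrite hz -hT -!mulmxA -hz mulmxA ker_valP.
  - by move=> i x; split=> // _; exists 0; rewrite [x]Z0; case: i {x}.
move=> [q [D [sD /IH[P' [d' [e' [pP zP sP e0P eP]]]]]]].
pose P (i : nat) : lmodType R := if i is j.+1 then P' j else 'cV[R]_m.
pose d i : {linear P i.+1 -> P i} :=
  match i return {linear P i.+1 -> P i} with
  | 0 => mulmx A \o e' | j.+1 => d' j end.
exists P, d, (idfun : {linear _ -> _}); split.
- by case=> [_|i ik]; [apply: projective_cV | apply: pP].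
- by case=> // i ik x; apply: zP.
- by move=> y; exists y, 0; rewrite mulmx0 addr0.
- move=> x /=; split=> [[z ->]|[w <-]]; last by exists (e' w).
  have [w [u ->]] := sP z; exists w.
  by rewrite mulmxDr mulmxA sD.1 mul0mx addr0.
- case=> [|i] x; last exact: eP.
  apply: iff_trans (e0P x); split=> [/sD.2|[z /= ->]] //.
  by rewrite mulmxA sD.1 mul0mx.
Qed.

(** * Dickson's lemma *)

Lemma exists_argmin_from (f : nat -> nat) k :
  exists j, (k <= j)%N /\ forall i, (k <= i)%N -> (f j <= f i)%N.
Proof.
have [j [kj fj]] : exists j, (k <= j)%N /\ f j = f k by exists k.
move: (f k) fj => v; elim/ltn_ind: v j kj => v IH j kj fj.
have [hex|hn] := classic (exists i, (k <= i)%N /\ (f i < f j)%N).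
  by have [i [ki fi]] := hex; apply: (IH (f i) _ i) => //; rewrite -fj.
exists j; split=> // i ki; rewrite leqNgt; apply/negP => fi.
by apply: hn; exists i.
Qed.

Lemma nondecreasing_subseq (f : nat -> nat) :
  exists g : nat -> nat, (forall i j, (i < j)%N -> (g i < g j)%N) /\
    forall i j, (i <= j)%N -> (f (g i) <= f (g j))%N.
Proof.
pose h k := sval (constructive_indefinite_description _ (exists_argmin_from f k)).
have hP k : (k <= h k)%N /\ forall i, (k <= i)%N -> (f (h k) <= f i)%N.
  by rewrite /h; case: constructive_indefinite_description.
pose g := fix g i := if i is j.+1 then h (g j).+1 else h 0.
have gS i : (g i < g i.+1)%N by have [] := hP (g i).+1.
have gmono i j : (i < j)%N -> (g i < g j)%N.
  elim: j => // j IH; rewrite ltnS leq_eqVlt => /orP[/eqP->//|/IH gij].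
  exact: ltn_trans gij (gS j).
exists g; split=> // i j; rewrite leq_eqVlt => /orP[/eqP->//|/gmono gij].
case: i gij => [|i] gij; first by apply: (hP 0%N).2.
by apply: (hP (g i).+1).2; apply: leq_trans (ltnW gij); apply: (gS i).
Qed.

Lemma nondecreasing_subseq_mnm n (s : seq 'I_n) (u : nat -> 'X_{1..n}) :
  exists g : nat -> nat, (forall i j, (i < j)%N -> (g i < g j)%N) /\
    forall i j, (i <= j)%N -> forall c, c \in s -> (u (g i) c <= u (g j) c)%N.
Proof.
elim: s => [|c s [g [gm gP]]]; first by exists id.
have [h [hm hP]] := nondecreasing_subseq (fun i => u (g i) c).
exists (g \o h); split=> [i j /hm/gm //|i j ij c'].
rewrite inE => /orP[/eqP->|]; first exact: hP.
apply: gP; move: ij; rewrite leq_eqVlt => /orP[/eqP->//|/hm/ltnW //].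
Qed.

(** Otherwise one could choose forever an element of [L] divisible by none of its predecessors; a
    subsequence nondecreasing in every coordinate contradicts this. *)
Lemma dickson n (L : 'X_{1..n} -> Prop) :
  exists l : seq 'X_{1..n}, (forall m, m \in l -> L m) /\
    forall m, L m -> exists2 m', m' \in l & (m' <= m)%MM.
Proof.
apply: NNPP => nofin.
have next (l : {l : seq 'X_{1..n} | forall m, m \in l -> L m}) :
    exists m, L m /\ forall m', m' \in sval l -> ~~ (m' <= m)%MM.
  apply: NNPP => hn; apply: nofin; exists (sval l); split; first exact: (svalP l).
  move=> m Lm; apply: NNPP => hm; apply: hn; exists m; split=> // m' m'l.
  by apply/negP => m'm; apply: hm; exists m'.
pose nx l := sval (constructive_indefinite_description _ (next l)).
have nxP l : L (nx l) /\ forall m', m' \in sval l -> ~~ (m' <= nx l)%MM.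
  by rewrite /nx; case: constructive_indefinite_description.
have extP (l : {l : seq 'X_{1..n} | forall m, m \in l -> L m}) :
    forall m, m \in nx l :: sval l -> L m.
  move=> m; rewrite inE => /orP[/eqP->|]; [exact: (nxP l).1 | exact: (svalP l)].
pose ls := fix ls i := if i is j.+1 then exist _ _ (extP (ls j))
  else exist (fun l : seq _ => forall m, m \in l -> L m) [::] (fun m h => False_ind _ (Bool.diff_false_true h)).
have lsP i j : (i < j)%N -> nx (ls i) \in sval (ls j).
  elim: j => // j IH; rewrite ltnS leq_eqVlt /= inE => /orP[/eqP->|/IH->].
    by rewrite eqxx.
  by rewrite orbT.
have [g [gm gP]] := nondecreasing_subseq_mnm (enum 'I_n) (fun i => nx (ls i)).
have /(nxP _).2/negP := lsP _ _ (gm 0%N 1%N isT); apply.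
by apply/mnm_lepP => c; apply: gP; rewrite ?mem_enum.
Qed.

(** * Leading terms in free modules *)

Definition term n r : Type := ('X_{1..n} * 'I_r)%type.

Definition tshift n r (k : 'X_{1..n}) (t : term n r) : term n r := ((t.1 + k)%MM, t.2).

Definition tcoef (K : fieldType) n r (v : 'cV[{mpoly K[n]}]_r) (t : term n r) : K :=
  (v t.2 0)@_(t.1).

Definition tdvd n r (t u : term n r) : Prop := t.2 = u.2 /\ (t.1 <= u.1)%MM.

Record term_order n r (lt : term n r -> term n r -> Prop) : Prop := TermOrder {
  to_irr : forall t, ~ lt t t;
  to_trans : forall t u v, lt t u -> lt u v -> lt t v;
  to_total : forall t u, t <> u -> lt t u \/ lt u t;
  to_wf : well_founded lt;
  to_shift : forall k t u, lt t u -> lt (tshift k t) (tshift k u) }.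

Definition bounded_by (K : fieldType) n r (lt : term n r -> term n r -> Prop)
    (v : 'cV[{mpoly K[n]}]_r) (b : term n r) : Prop :=
  forall u, tcoef v u != 0 -> lt u b.

Definition is_lead (K : fieldType) n r (lt : term n r -> term n r -> Prop)
    (v : 'cV[{mpoly K[n]}]_r) (t : term n r) : Prop :=
  tcoef v t != 0 /\ forall u, tcoef v u != 0 -> u = t \/ lt u t.

Lemma wf_lex (A B : Type) (ltB : B -> B -> Prop) (key : A -> B) (rho : A -> nat) :
  well_founded ltB ->
  well_founded (fun a a' => ltB (key a) (key a') \/
                            key a = key a' /\ (rho a < rho a')%N).
Proof.
move=> wfB a; move: {2}(key a) (erefl (key a)) => b.
elim/(well_founded_ind wfB): b a => b IH a.
elim/ltn_ind: {a}(rho a) {-2}a (erefl (rho a)) => k IHk a ra ka.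
constructor=> a' [lt_a'|[ea' ra']].
  by rewrite ka in lt_a'; apply: IH lt_a' _ _.
by rewrite ra in ra'; apply: IHk ra' _ _ _; rewrite // ea'.
Qed.

(** Covers both orders used below: the key is the monomial for the standard order and the leading
    term of the image for Schreyer's order. *)
Lemma lex_term_order n r (B : Type) (ltB : B -> B -> Prop)
    (key : term n r -> B) (rho : 'I_r -> nat) :
  (forall b, ~ ltB b b) -> (forall a b c, ltB a b -> ltB b c -> ltB a c) ->
  (forall a b, a <> b -> ltB a b \/ ltB b a) -> well_founded ltB ->
  (forall k t u, ltB (key t) (key u) -> ltB (key (tshift k t)) (key (tshift k u))) ->
  (forall k t u, key t = key u -> key (tshift k t) = key (tshift k u)) ->
  (forall t u, key t = key u -> rho t.2 = rho u.2 -> t = u) ->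
  term_order (fun t u => ltB (key t) (key u) \/
                         key t = key u /\ (rho t.2 < rho u.2)%N).
Proof.
move=> irr trans total wfB shl she inj; split.
- by move=> t [/irr//|[_]]; rewrite ltnn.
- move=> t u v [tu|[etu tu]] [uv|[euv uv]].
  + by left; apply: trans uv.
  + by left; rewrite -euv.
  + by left; rewrite etu.
  + by right; split; [rewrite etu | apply: ltn_trans uv].
- move=> t u ntu; have [e|ne] := classic (key t = key u); last first.
    by have [h|h] := total _ _ ne; [left; left | right; left].
  have: rho t.2 <> rho u.2 by move=> er; apply: ntu; apply: inj.
  move/eqP; rewrite neq_ltn => /orP[h|h]; [left|right]; right; by split.
- exact: (wf_lex key (fun t => rho t.2)).
- by move=> k t u [/shl h|[/she h h']]; [left | right].
Qed.

Definition std_lt n r (t u : term n r) : Prop :=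
  (t.1 < u.1)%O \/ t.1 = u.1 /\ (t.2 < u.2)%N.

Lemma std_term_order n r : term_order (@std_lt n r).
Proof.
apply: (@lex_term_order n r 'X_{1..n} (fun a b => (a < b)%O) fst (fun i : 'I_r => i : nat)).
- by move=> b; rewrite ltxx.
- by move=> a b c; apply: lt_trans.
- by move=> a b; case: ltgtP => //; [left | right].
- exact: ltom_wf.
- by move=> k t u /=; rewrite ltmc_add2l.
- by move=> k t u /= ->.
- by move=> [a i] [b j] /= -> /val_inj ->.
Qed.

Section Lead.
Variables (K : fieldType) (n r : nat) (lt : term n r -> term n r -> Prop).
Hypothesis tO : term_order lt.
Local Notation S := {mpoly K[n]}.
Implicit Types (v w : 'cV[S]_r) (t u b : term n r).

Lemma tcoefD v w t : tcoef (v + w) t = tcoef v t + tcoef w t.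
Proof. by rewrite /tcoef !mxE mcoeffD. Qed.

Lemma tcoefN v t : tcoef (- v) t = - tcoef v t.
Proof. by rewrite /tcoef !mxE mcoeffN. Qed.

Lemma tcoefB v w t : tcoef (v - w) t = tcoef v t - tcoef w t.
Proof. by rewrite tcoefD tcoefN. Qed.

Lemma tcoef_eq0 v : (forall t, tcoef v t = 0) -> v = 0.
Proof.
move=> h; apply/matrixP => i j; rewrite ord1 mxE; apply/mpolyP => m.
by rewrite mcoeff0; apply: (h (m, i)).
Qed.

Lemma tcoef_monoM (c : K) (d : 'X_{1..n}) v t :
  tcoef ((c *: 'X_[d]) *: v) (tshift d t) = c * tcoef v t.
Proof.
rewrite /tcoef mxE /= -scalerAl mcoeffZ mulrC -[_ * c]mulrC; congr (_ * _).
by rewrite mulrC addmC mcoeffMX.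
Qed.

Lemma tcoef_monoM_neq0 (c : K) (d : 'X_{1..n}) v u :
  tcoef ((c *: 'X_[d]) *: v) u != 0 ->
  exists2 t, u = tshift d t & tcoef v t != 0.
Proof.
rewrite /tcoef mxE -scalerAl mcoeffZ mulf_eq0 negb_or => /andP[_].
rewrite mulrC -mcoeff_msupp (perm_mem (msuppMX _ _)) => /mapP[m hm e].
exists (m, u.2); last by rewrite -mcoeff_msupp.
by case: u hm e => a i /= hm ->; rewrite /tshift /= addmC.
Qed.

Lemma exists_max (s : seq (term n r)) : s != [::] ->
  exists2 t, t \in s & forall u, u \in s -> u = t \/ lt u t.
Proof.
elim: s => // a [|b s] IH _; first by exists a => [|u]; rewrite inE // => /eqP; left.
have [t ts tm] := IH isT.
have [->|nat] := eqVneq a t.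
  exists t; first by rewrite inE eqxx.
  by move=> u; rewrite inE => /orP[/eqP|/tm]; [left|].
have [at_|ta] := to_total tO (elimN eqP nat).
  exists t; first by rewrite inE ts orbT.
  by move=> u; rewrite inE => /orP[/eqP->|/tm]; [right|].
exists a; first by rewrite inE eqxx.
move=> u; rewrite inE => /orP[/eqP|/tm[->|h]]; [by left|by right|right].
exact: to_trans ta.
Qed.

Lemma exists_lead v : v <> 0 -> exists t, is_lead lt v t.
Proof.
move=> nv; pose s := [seq (m, i) | i <- enum 'I_r, m <- msupp (v i 0)].
have sP u : (tcoef v u != 0) = (u \in s).
  apply/idP/allpairsPdep => [h|[i [m [_ hm ->]]]]; last by rewrite /tcoef -mcoeff_msupp.
  by exists u.2, u.1; split; rewrite ?mem_enum ?mcoeff_msupp //; case: u h.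
have [|t ts tm] := @exists_max s.
  apply/eqP => s0; apply: nv; apply: tcoef_eq0 => t; apply/eqP/negPn.
  by rewrite sP s0.
by exists t; split; rewrite ?sP // => u; rewrite sP; apply: tm.
Qed.

Lemma bounded_lead v t b : bounded_by lt v b -> is_lead lt v t -> lt t b.
Proof. by move=> h [ht _]; apply: h. Qed.

Lemma bounded_coef0 v b : bounded_by lt v b -> tcoef v b = 0.
Proof. by move=> h; apply/eqP/negPn/negP => /h/(to_irr tO). Qed.

(** Noetherian induction on the leading term. Smallness is phrased by [bounded_by], which also
    covers the zero vector, although it has no leading term. *)
Lemma bounded_ind (P : 'cV[S]_r -> Prop) :
  P 0 -> (forall v t, is_lead lt v t -> (forall w, bounded_by lt w t -> P w) -> P v) ->
  forall v, P v.
Proof.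
move=> P0 Pl; suff H t : forall w, bounded_by lt w t -> P w.
  move=> v; have [->//|/exists_lead[t lt_]] := classic (v = 0).
  by apply: (Pl v t) => // w; apply: H.
elim/(well_founded_ind (to_wf tO)): t => t IH w wt.
have [->//|/exists_lead[u lu]] := classic (w = 0).
by apply: (Pl w u) => //; apply: IH; apply: bounded_lead lu.
Qed.

Lemma cancel_lead v w t : is_lead lt v t -> is_lead lt w t -> tcoef v t = tcoef w t ->
  bounded_by lt (v - w) t.
Proof.
move=> [_ lv] [_ lw] e u; have [->|ut] := eqVneq u t; first by rewrite tcoefB e subrr eqxx.
rewrite tcoefB; have [ev|/lv[/eqP|//]] := eqVneq (tcoef v u) 0; last by rewrite (negPf ut).
by rewrite ev sub0r oppr_eq0 => /lw[/eqP|//]; rewrite (negPf ut).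
Qed.

Lemma lead_monoM (c : K) d v t : c != 0 -> is_lead lt v t ->
  is_lead lt ((c *: 'X_[d]) *: v) (tshift d t).
Proof.
move=> nc [nt hl]; split; first by rewrite tcoef_monoM mulf_neq0.
move=> u /tcoef_monoM_neq0[t' -> /hl[->|h]]; [by left | right].
exact: to_shift.
Qed.

End Lead.

Lemma tdvdP n r (t u : term n r) : tdvd t u -> u = tshift (u.1 - t.1)%MM t.
Proof.
case: t u => [a i] [b j] [/= -> ab]; rewrite /tshift /=; congr pair.
by rewrite addmC submK.
Qed.

(** * Groebner bases and Schreyer's theorem *)

Definition submodule (R : comNzRingType) r (U : 'cV[R]_r -> Prop) : Prop :=
  U 0 /\ forall a u v, U u -> U v -> U (a *: u + v).

Lemma submodB (R : comNzRingType) r (U : 'cV[R]_r -> Prop) a u v :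
  submodule U -> U u -> U v -> U (u - a *: v).
Proof. by move=> [_ hU] Uu Uv; rewrite addrC -scaleNr; apply: hU. Qed.

Lemma submod_image (R : comNzRingType) r q (A : 'M[R]_(r, q)) :
  submodule (fun v => exists w, v = A *m w).
Proof.
split=> [|a u v [x ->] [y ->]]; first by exists 0; rewrite mulmx0.
by exists (a *: x + y); rewrite mulmxDr -scalemxAr.
Qed.

Lemma submod_ker (R : comNzRingType) r q (A : 'M[R]_(r, q)) :
  submodule (fun v => A *m v = 0).
Proof.
split=> [|a u v hu hv]; first by rewrite mulmx0.
by rewrite mulmxDr -scalemxAr hu hv scaler0 addr0.
Qed.

Definition leads_of (K : fieldType) n r (lt : term n r -> term n r -> Prop)
    (U : 'cV[{mpoly K[n]}]_r -> Prop) (t : term n r) : Prop :=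
  exists2 v, U v & is_lead lt v t.

Definition groebner (K : fieldType) n r (lt : term n r -> term n r -> Prop)
    (U : 'cV[{mpoly K[n]}]_r -> Prop) q (G : 'M[{mpoly K[n]}]_(r, q))
    (l : 'I_q -> term n r) : Prop :=
  [/\ forall j, U (col j G), forall j, is_lead lt (col j G) (l j) &
      forall t, leads_of lt U t -> exists j, tdvd (l j) t].

(** The leading terms of [U] are generated by those free of the first [k] variables. Each passage to
    syzygies raises [k] by one; at [k = n] only basis vectors are left as generators. *)
Definition avoids (K : fieldType) n r (lt : term n r -> term n r -> Prop)
    (k : nat) (U : 'cV[{mpoly K[n]}]_r -> Prop) : Prop :=
  forall t, leads_of lt U t ->
    exists t', [/\ leads_of lt U t', tdvd t' t &
                   forall c : 'I_n, (c < k)%N -> t'.1 c = 0%N].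

Lemma exists_groebner (K : fieldType) n r (lt : term n r -> term n r -> Prop)
    (k : nat) (U : 'cV[{mpoly K[n]}]_r -> Prop) :
  avoids lt k U ->
  exists q (G : 'M[{mpoly K[n]}]_(r, q)) l, groebner lt U G l /\
    forall j (c : 'I_n), (c < k)%N -> (l j).1 c = 0%N.
Proof.
move=> av; pose L i m := leads_of lt U (m, i) /\ forall c : 'I_n, (c < k)%N -> m c = 0%N.
have /fin_all_exists[l hl] := fun i : 'I_r => dickson (L i).
pose s := [seq (m, i) | i <- enum 'I_r, m <- l i].
have sP t : t \in s -> leads_of lt U t /\ forall c : 'I_n, (c < k)%N -> t.1 c = 0%N.
  by move=> /allpairsPdep[i [m [_ /((hl i).1)[h1 h2] ->]]].
have sL (j : 'I_(size s)) : tnth (in_tuple s) j \in s by apply: mem_tnth.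
have wit (j : 'I_(size s)) : exists v, U v /\ is_lead lt v (tnth (in_tuple s) j).
  by have [[v Uv lv] _] := sP _ (sL j); exists v.
have /fin_all_exists[g hg] := wit.
exists (size s), (\matrix_(i, j) g j i 0), (fun j => tnth (in_tuple s) j).
have colg j : col j (\matrix_(i, j) g j i 0) = g j.
  by apply/matrixP => i j'; rewrite !mxE ord1.
split; last by move=> j; have [] := sP _ (sL j).
split=> [j|j|t /av[t' [lt' [d2 d1] a0]]]; first by rewrite colg; have [] := hg j.
  by rewrite colg; have [] := hg j.
have [m hm mt'] : exists2 m, m \in l t'.2 & (m <= t'.1)%MM.
  by apply: (hl t'.2).2; split=> //; case: t' lt' {d1 d2 a0}.
have ms : (m, t'.2) \in s by apply/allpairsPdep; exists t'.2, m; rewrite mem_enum.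
have jl : (index (m, t'.2) s < size s)%N by rewrite index_mem.
exists (Ordinal jl); rewrite (tnth_nth (m, t'.2)) /= nth_index //; split=> //=.
exact: lepm_trans d1.
Qed.

Section Schreyer.
Variables (K : fieldType) (n r : nat) (lt : term n r -> term n r -> Prop).
Hypothesis tO : term_order lt.
Local Notation S := {mpoly K[n]}.
Variables (U : 'cV[S]_r -> Prop) (q : nat) (G : 'M[S]_(r, q)) (l : 'I_q -> term n r).
Hypothesis sU : submodule U.
Hypothesis gb : groebner lt U G l.

(** The leading term of the image under [G] of a term of the source; Schreyer's order compares these
    before breaking ties. *)
Definition gkey (t : term n q) : term n r := tshift t.1 (l t.2).

Let lc j := tcoef (col j G) (l j).
Let lc_neq0 j : lc j != 0. Proof. by have [_ h _] := gb; case: (h j). Qed.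

Lemma mulmx_delta_mono (c : K) d j :
  G *m ((c *: 'X_[d]) *: delta_mx j 0) = (c *: 'X_[d]) *: col j G.
Proof. by rewrite -scalemxAr colE. Qed.

Lemma tcoef_delta_mono (c : K) d j (t : term n q) :
  tcoef ((c *: 'X_[d]) *: delta_mx j 0) t = c *+ (t == (d, j)).
Proof.
case: t => m i; rewrite /tcoef !mxE /= andbT xpair_eqE.
case: eqVneq => [_|_]; last by rewrite mulr0 mcoeff0 andbF.
by rewrite mulr1 mcoeffZ mcoeffX andbT eq_sym mulr_natr.
Qed.

(** The second clause is the standard-representation property: no term of the quotient contributes
    beyond the leading term of [v], stated as a transfer of strict bounds. *)
Lemma groebner_div v : U v ->
  exists h : 'cV[S]_q, v = G *m h /\
    forall b, bounded_by lt v b -> forall t, tcoef h t != 0 -> lt (gkey t) b.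
Proof.
move: v; apply: (bounded_ind tO) => [_|v t lv IH Uv].
  by exists 0; split=> [|b _ t]; rewrite ?mulmx0 // /tcoef mxE mcoeff0 eqxx.
have [hU hl hd] := gb; have [j dj] := hd t (ex_intro2 _ _ v Uv lv).
pose d := (t.1 - (l j).1)%MM; have et : t = tshift d (l j) by apply: tdvdP.
pose c := tcoef v t / lc j; have nc : c != 0.
  by rewrite mulf_neq0 ?invr_eq0 //; case: lv.
have lw : is_lead lt ((c *: 'X_[d]) *: col j G) t by rewrite et; apply: lead_monoM.
have bw : bounded_by lt (v - (c *: 'X_[d]) *: col j G) t.
  apply: cancel_lead => //.
  by rewrite [in RHS]et tcoef_monoM divfK.
have [|h [hv hb]] := IH _ bw; first exact: submodB.
exists ((c *: 'X_[d]) *: delta_mx j 0 + h); split.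
  by rewrite mulmxDr mulmx_delta_mono -hv addrC subrK.
move=> b vb u; rewrite tcoefD tcoef_delta_mono.
have span_bound : lt t b by apply: vb; case: lv.
have [-> _|_] := eqVneq u (d, j); first by rewrite /gkey /= -et.
by rewrite mulr0n add0r; apply: hb => w /bw wt; apply: to_trans span_bound.
Qed.

Lemma groebner_gens v : U v -> exists h : 'cV[S]_q, v = G *m h.
Proof. by move=> /groebner_div[h [hv _]]; exists h. Qed.

Lemma bounded_image (y : 'cV[S]_q) b :
  (forall t, tcoef y t != 0 -> lt (gkey t) b) -> bounded_by lt (G *m y) b.
Proof.
have [_ hl _] := gb; move=> hy [m i]; rewrite /tcoef mxE /= => nz.
have [j nj] : exists j, (G i j * y j 0)@_m != 0.
  apply: NNPP => hn; case/negP: nz; rewrite raddf_sum big1 //= => j _.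
  by apply/eqP/negPn/negP => h; apply: hn; exists j.
move: nj; rewrite -mcoeff_msupp => /msuppM_le/allpairsP[[m1 m2] /= [h1 h2 ->]].
rewrite mcoeff_msupp in h2; have := hy (m2, j) h2; rewrite /gkey /=.
have [//|e|h] := (hl j).2 (m1, i); first by rewrite /tcoef mxE /= -mcoeff_msupp.
  by rewrite -e.
by apply: (to_trans tO); apply: (to_shift tO m2 h).
Qed.

(* The tie-break by the exponent of the next variable is what removes that
   variable from the leading terms of the syzygies. *)
Definition tie (k : 'I_n) (j : 'I_q) : nat := ((l j).1 k * q + j)%N.

Definition schreyer (k : 'I_n) (t u : term n q) : Prop :=
  lt (gkey t) (gkey u) \/ gkey t = gkey u /\ (tie k t.2 < tie k u.2)%N.

Lemma tie_inj k : injective (tie k).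
Proof.
move=> i j /(congr1 (modn^~ q)).
by rewrite /tie !modnMDl !modn_small //; apply: val_inj.
Qed.

Lemma tie_le k i j : (tie k i < tie k j)%N -> ((l i).1 k <= (l j).1 k)%N.
Proof.
rewrite /tie leqNgt => h; rewrite leqNgt; apply/negP => h'; case/negP: h.
have := ltn_ord j; have : ((l j).1 k * q + q <= (l i).1 k * q)%N.
  by rewrite -mulSnr leq_mul2r h' orbT.
by set x := (_ * q)%N; set y := (_ * q)%N; lia.
Qed.

Lemma gkey_tshift d t : gkey (tshift d t) = tshift d (gkey t).
Proof. by rewrite /gkey /tshift /= addmA. Qed.

Lemma schreyer_order k : term_order (schreyer k).
Proof.
apply: (@lex_term_order n q (term n r) lt gkey (tie k)); try by case: tO.
- by move=> d t u; rewrite !gkey_tshift; apply: to_shift.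
- by move=> d t u; rewrite !gkey_tshift => ->.
- move=> [a i] [b j] /= e /tie_inj eij; move: e; rewrite eij /gkey /tshift /=.
  by move/(congr1 fst) => /= e; rewrite (addmI e).
Qed.

(** Let [(nu, i)] lead a syzygy. Its image must cancel against a term on some [j] with the same
    [gkey] and a smaller tie-break. The syzygy from the S-pair of [i] and [j] leads on [i] with
    exponent [lcm(m_i, m_j) / m_i], which divides [nu]. The tie-break makes the [k]-exponent of
    [m_j] at most that of [m_i], so this quotient is free of variable [k]. *)
Lemma syzygy_avoids (k : 'I_n) :
  (forall j (c : 'I_n), (c < k)%N -> (l j).1 c = 0%N) ->
  avoids (schreyer k) k.+1 (fun y => G *m y = 0).
Proof.
move=> av [nu i] [y Gy [ny ly]]; have [hU hl _] := gb.
pose t0 := gkey (nu, i); pose a := tcoef y (nu, i).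
have [u nu_ [eu tu]] : exists2 u, tcoef y u != 0 & gkey u = t0 /\ (tie k u.2 < tie k i)%N.
  apply: NNPP => hn.
  pose y' := y - (a *: 'X_[nu]) *: delta_mx i 0.
  have by' : bounded_by lt (G *m y') t0.
    apply: bounded_image => t; rewrite /y' tcoefB tcoef_delta_mono.
    have [->|nt] := eqVneq t (nu, i); first by rewrite subrr eqxx.
    rewrite subr0 => nt'; have [/eqP|[//|h]] := ly t nt'; first by rewrite (negPf nt).
    by case: hn; exists t.
  have := bounded_coef0 tO by'; rewrite /y' mulmxBr Gy mulmx_delta_mono tcoefB.
  rewrite /t0 /gkey tcoef_monoM {1}/tcoef mxE mcoeff0 sub0r => /eqP.
  by rewrite oppr_eq0 mulf_eq0 (negPf ny) (negPf (lc_neq0 i)).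
case: u eu tu {nu_} => nu' j /= eu tu.
have eq2 : (l j).2 = (l i).2 by have := congr1 snd eu.
have eq1 : ((l j).1 + nu' = (l i).1 + nu)%MM by have := congr1 fst eu.
have nij : j != i by apply: contraTneq tu => ->; rewrite ltnn.
pose mi := (l i).1; pose mj := (l j).1.
(* Subtraction of exponents is truncated, so [t1] is the least common multiple of the two leading
   terms. *)
pose t1 := gkey ((mj - mi)%MM, i).
have et1 : gkey ((mi - mj)%MM, j) = t1.
  rewrite /t1 /gkey /tshift /= eq2; congr pair.
  by apply/mnmP => c; rewrite !mnmDE !mnmBE -/mi -/mj; lia.
pose vi := (lc j *: 'X_[mj - mi]) *: col i G.
pose vj := (lc i *: 'X_[mi - mj]) *: col j G.
have bsp : bounded_by lt (vi - vj) t1.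
  apply: cancel_lead; first exact: lead_monoM.
    by rewrite -et1; apply: lead_monoM.
  by rewrite -[t1 in RHS]et1 /t1 /vi /vj /gkey /= !tcoef_monoM mulrC.
have [|h [hsp hb]] := @groebner_div (vi - vj).
  apply: (submodB _ sU _ (hU j)); rewrite -[vi]addr0.
  exact: (sU.2 _ _ _ (hU i) sU.1).
pose z := (lc j *: 'X_[mj - mi]) *: delta_mx i 0
          - (lc i *: 'X_[mi - mj]) *: delta_mx j 0 - h.
have hb1 t : tcoef h t != 0 -> lt (gkey t) t1 by apply: hb.
exists ((mj - mi)%MM, i); split=> /=; last 1 first.
- move=> c; rewrite ltnS leq_eqVlt => /orP[/eqP/val_inj->|ck]; last first.
    by rewrite mnmBE /mj av.
  by rewrite mnmBE; apply/eqP; rewrite subn_eq0; apply: tie_le.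
- exists z; first by rewrite /z !mulmxBr !mulmx_delta_mono -hsp subrr.
  have h0 : tcoef h ((mj - mi)%MM, i) = 0.
    by apply/eqP/negPn/negP => /hb1/(to_irr tO).
  have tcz t : tcoef z t = lc j *+ (t == ((mj - mi)%MM, i))
      - lc i *+ (t == ((mi - mj)%MM, j)) - tcoef h t.
    by rewrite /z !tcoefB !tcoef_delta_mono.
  split.
    by rewrite tcz eqxx h0 xpair_eqE (eq_sym i) (negPf nij) andbF !subr0 lc_neq0.
  move=> t; rewrite tcz; have [->|_] := eqVneq t ((mj - mi)%MM, i); first by left.
  have [->|_] := eqVneq t ((mi - mj)%MM, j); first by right; right.
  by rewrite subr0 sub0r oppr_eq0 => /hb1 ht; right; left.
- split=> //=; apply/mnm_lepP => c; move/mnmP/(_ c): eq1.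
  by rewrite mnmBE !mnmDE -/mi -/mj; lia.
Qed.

End Schreyer.

(** * Hilbert's syzygy theorem *)

Lemma avoids0 (K : fieldType) n r (lt : term n r -> term n r -> Prop)
    (U : 'cV[{mpoly K[n]}]_r -> Prop) : avoids lt 0 U.
Proof. by move=> t ht; exists t; split=> //; split=> //; apply: lepm_refl. Qed.

Lemma mpoly_coherent (K : fieldType) n : coherent {mpoly K[n]}.
Proof.
move=> m q A; have tO := @std_term_order n q.
have [p [D [l [gb _]]]] := exists_groebner (@avoids0 K n q (@std_lt n q) (fun v => A *m v = 0)).
have sU := submod_ker A.
exists p, D; split; last by move=> v; apply: (groebner_gens tO sU gb).
apply/matrixP => i j; have [hU _ _] := gb; have /matrixP/(_ i 0) := hU j.
by rewrite colE mulmxA -colE !mxE.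
Qed.

(** All leads are multiples of basis vectors [e_c] with [c] in [C], so any vector can be reduced
    modulo [U] until its [C]-coordinates vanish. Reducing the basis vectors defines [T]; the columns
    of [A - A T A] lie in [U] and have zero [C]-coordinates, so they admit no lead. *)
Lemma spl_unit_leads (K : fieldType) n r q (A : 'M[{mpoly K[n]}]_(r, q))
    (lt : term n r -> term n r -> Prop) :
  term_order lt -> avoids lt n (fun v => exists w, v = A *m w) -> spl 0 A.
Proof.
move=> tO av; pose U (v : 'cV[{mpoly K[n]}]_r) := exists w, v = A *m w.
have sU : submodule U := submod_image A.
pose C (c : 'I_r) := leads_of lt U (0%MM, c).
have leadC t : leads_of lt U t -> C t.2.
  move=> /av[[m i] [lt' [/= <- _] m0]]; rewrite /C.
  suff -> : 0%MM = m by [].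
  by apply/mnmP => c; rewrite mnm0E; apply/esym/m0.
have red v : exists u, U u /\ forall c, C c -> (v - u) c 0 = 0.
  move: v; apply: (bounded_ind tO) => [|v t lv IH].
    by exists 0; split; [exact: sU.1 | move=> c _; rewrite subrr mxE].
  have [[g Ug lg]|nC] := classic (C t.2).
    pose c := tcoef v t / tcoef g (0%MM, t.2).
    have ng : tcoef g (0%MM, t.2) != 0 by case: lg.
    have nc : c != 0 by rewrite mulf_neq0 ?invr_eq0 //; case: lv.
    have et : t = tshift t.1 (0%MM, t.2) by rewrite /tshift /= add0m; case: t {lv IH lg c ng nc}.
    have := lead_monoM tO t.1 nc lg; rewrite -et => lw.
    have [|u [Uu hu]] := IH (v - (c *: 'X_[t.1]) *: g).
      apply: (cancel_lead lv lw); have := tcoef_monoM c t.1 g (0%MM, t.2).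
      by rewrite -et => ->; rewrite divfK.
    exists ((c *: 'X_[t.1]) *: g + u); split; first exact: sU.2.
    by move=> c' /hu; rewrite opprD addrA.
  pose w : 'cV[{mpoly K[n]}]_r := (tcoef v t *: 'X_[t.1]) *: delta_mx t.2 0.
  have tw u : tcoef w u = tcoef v t *+ (u == t).
    by rewrite tcoef_delta_mono; congr (_ *+ (_ == _)); case: (t).
  have nv : tcoef v t != 0 by case: lv.
  have [|u [Uu hu]] := IH (v - w).
    apply: (cancel_lead lv); last by rewrite tw eqxx.
    split=> [|u]; first by rewrite tw eqxx.
    by rewrite tw; case: (u =P t) => [->|_]; [left | rewrite eqxx].
  exists u; split=> // c Cc; rewrite -[RHS](hu c Cc) !mxE.
  have /negPf-> : c != t.2 by apply/eqP => ec; apply: nC; rewrite -ec.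
  by rewrite mulr0 subr0.
have /fin_all_exists[T hT] : forall i : 'I_r, exists w : 'cV[{mpoly K[n]}]_q,
    forall c, C c -> (delta_mx i 0 - A *m w) c 0 = 0.
  by move=> i; have [u [[w ->] h]] := red (delta_mx i 0); exists w.
pose TT : 'M[{mpoly K[n]}]_(q, r) := \matrix_(a, b) T b a 0.
exists TT; apply/eqP; rewrite -subr_eq0 -oppr_eq0 opprB; apply/eqP/matrixP => i j.
pose B := A - A *m TT *m A; rewrite -/B.
suff /matrixP/(_ i 0) : col j B = 0 by rewrite !mxE.
apply: NNPP => /(exists_lead tO)[t lt_].
have Ct : C t.2.
  apply: leadC; exists (col j B) => //; exists (col j (1%:M - TT *m A)).
  by rewrite !colE mulmxA mulmxBr mulmx1 mulmxA.
case: lt_ => /eqP nz _; apply: nz; rewrite /tcoef mxE.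
suff -> : B t.2 j = 0 by rewrite mcoeff0.
have row0 b : (1%:M - A *m TT) t.2 b = 0.
  rewrite -[RHS](hT b _ Ct) !mxE andbT; congr (_ - _).
  by apply: eq_bigr => a _; rewrite !mxE.
by rewrite /B -{1}[A]mul1mx -mulmxBl mxE big1 // => b _; rewrite row0 mul0r.
Qed.

(** [A] is replaced by a Groebner basis of its image, whose syzygies for Schreyer's order have leads
    avoiding one more variable; after [j] steps none is left. *)
Lemma spl_avoids (K : fieldType) n j r q (A : 'M[{mpoly K[n]}]_(r, q))
    (lt : term n r -> term n r -> Prop) :
  (j <= n)%N -> term_order lt ->
  avoids lt (n - j) (fun v => exists w, v = A *m w) -> spl j A.
Proof.
elim: j r q A lt => [|j IH] r q A lt jn tO av.
  by rewrite subn0 in av; apply: spl_unit_leads av.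
have kn : (n - j.+1 < n)%N by lia.
have [q' [G [l [gb l0]]]] := exists_groebner av.
have sU := submod_image A; have [hU _ _] := gb.
have [X eX] : exists X, G = A *m X by apply: colwise_image.
have [X' eX'] : exists X', A = G *m X'.
  apply: colwise_image => i; apply: (groebner_gens tO sU gb).
  by exists (delta_mx i 0); rewrite colE.
apply: (spl_same_image (@mpoly_coherent K n) eX' eX).
have [p [D sD]] := mpoly_coherent G; exists p, D; split=> //.
apply: (IH _ _ _ (schreyer lt l (Ordinal kn))); first exact: ltnW.
  exact: schreyer_order.
have := @syzygy_avoids K n r lt tO _ q' G l sU gb (Ordinal kn) l0.
rewrite /= -subSn // subSS => av' t [v [w hw] lv].
have [|t' [[v' Gv' lv'] d' a']] := av' t.
  by exists v => //; rewrite hw mulmxA sD.1 mul0mx.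
by exists t'; split=> //; exists v' => //; apply: sD.2.
Qed.

Theorem hilbert_syzygy (K : fieldType) n r q (A : 'M[{mpoly K[n]}]_(r, q)) : spl n A.
Proof.
apply: (@spl_avoids K n n r q A (@std_lt n r) (leqnn n) (@std_term_order n r)).
by rewrite subnn; apply: avoids0.
Qed.

(** * Extension of the base field *)

Section FieldExtension.
Variables (K L : fieldType) (iota : {rmorphism K -> L}) (n : nat).

Definition lin_indep (q : nat) (e : nat -> L) : Prop :=
  forall c : nat -> K, \sum_(i < q) e i * iota (c i) = 0 ->
    forall i, (i < q)%N -> c i = 0.

Lemma finite_expansion (s : seq L) :
  exists q e, lin_indep q e /\
    forall x, x \in s -> exists c : nat -> K, x = \sum_(i < q) e i * iota (c i).
Proof.
elim: s => [|x s [q [e [ind ex]]]].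
  by exists 0%N, (fun=> 0); split=> // c _ i.
have [xs|nx] := classic (exists c : nat -> K, x = \sum_(i < q) e i * iota (c i)).
  by exists q, e; split=> // y; rewrite inE => /orP[/eqP->|/ex].
pose e' i := if (i < q)%N then e i else x.
have sumE (c : nat -> K) : \sum_(i < q.+1) e' i * iota (c i) =
    \sum_(i < q) e i * iota (c i) + x * iota (c q).
  rewrite big_ord_recr /= {2}/e' ltnn; congr (_ + _).
  by apply: eq_bigr => i _; rewrite /e' ltn_ord.
exists q.+1, e'; split=> [c|y].
  rewrite sumE => h; have cq : c q = 0.
    apply/eqP/negPn/negP => ncq; apply: nx; exists (fun i => - (c i / c q)).
    have nz : iota (c q) != 0 by rewrite fmorph_eq0.
    apply: (mulIf nz); rewrite mulr_suml.
    have /eqP := h; rewrite addrC addr_eq0 => /eqP->; rewrite -sumrN.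
    apply: eq_bigr => i _.
    by rewrite rmorphN fmorph_div mulrN mulNr -mulrA divfK.
  move: h; rewrite cq rmorph0 mulr0 addr0 => /ind hi i.
  by rewrite ltnS leq_eqVlt => /orP[/eqP->|/hi].
rewrite inE => /orP[/eqP->|/ex[c hc]].
  exists (fun i => (i == q)%:R); rewrite (sumE (fun i => (i == q)%:R)) eqxx rmorph1 mulr1 big1 ?add0r //.
  by move=> i _; rewrite ltn_eqF // rmorph0 mulr0.
exists (fun i => if (i < q)%N then c i else 0).
rewrite (sumE (fun i => if (i < q)%N then c i else 0)) ltnn rmorph0 mulr0 addr0 hc.
by apply: eq_bigr => i _; rewrite ltn_ord.
Qed.

Local Notation up := (map_mpoly (n := n) iota).

Lemma mpoly_indep q e (p : nat -> {mpoly K[n]}) : lin_indep q e ->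
  \sum_(i < q) (e i)%:MP * up (p i) = 0 -> forall i, (i < q)%N -> p i = 0.
Proof.
move=> ind h i iq; apply/mpolyP => m; rewrite mcoeff0.
apply: (ind (fun i => (p i)@_m)) => //; move/mpolyP/(_ m): h.
rewrite mcoeff0 raddf_sum /= => h; rewrite -[RHS]h; apply: eq_bigr => j _.
by rewrite mcoeffCM mcoeff_map_mpoly.
Qed.

(** Finitely many coefficients occur, so one finite [K]-independent family suffices. The spare
    scalar [x] allows [1] to be expanded in the same family as a splitting. *)
Lemma mx_expansion a b (v : 'M[{mpoly L[n]}]_(a, b)) (x : L) :
  exists q e (w : nat -> 'M[{mpoly K[n]}]_(a, b)) (c : nat -> K),
  [/\ lin_indep q e, v = \sum_(i < q) (e i)%:MP *: map_mx up (w i) &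
      x = \sum_(i < q) e i * iota (c i)].
Proof.
pose cs := x :: [seq (v ij.1 ij.2)@_m | ij <- enum {: 'I_a * 'I_b},
                                        m <- msupp (v ij.1 ij.2)].
have [q [e [ind ex]]] := finite_expansion cs.
have [c hc] : exists c : L -> nat -> K, forall y, y \in cs -> y = \sum_(i < q) e i * iota (c y i).
  have ex' y : exists c : nat -> K, y \in cs -> y = \sum_(i < q) e i * iota (c i).
    by have [/ex[c hc]|_] := boolP (y \in cs); [exists c | exists (fun=> 0)].
  exists (fun y => sval (constructive_indefinite_description _ (ex' y))) => y.
  by case: constructive_indefinite_description.
pose w k : 'M[{mpoly K[n]}]_(a, b) :=
  \matrix_(i, j) \sum_(m <- msupp (v i j)) c (v i j)@_m k *: 'X_[m].
exists q, e, w, (c x); split=> //; last by apply: hc; rewrite inE eqxx.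
apply/matrixP => i j; rewrite summxE [LHS]mpolyE.
under [RHS]eq_bigr => k _ do rewrite !mxE raddf_sum mulr_sumr.
rewrite exchange_big /= !big_seq; apply: eq_bigr => m hm.
rewrite [in LHS](hc (v i j)@_m); last first.
  rewrite inE; apply/orP; right.
  by apply/allpairsPdep; exists (i, j), m; rewrite mem_enum.
rewrite scaler_suml; apply: eq_bigr => k _.
by rewrite map_mpolyZ map_mpolyX mul_mpolyC scalerA.
Qed.

Lemma map_mx_scale_sum a b d q (e : nat -> L) (A : 'M[{mpoly K[n]}]_(a, b))
    (w : nat -> 'M[{mpoly K[n]}]_(b, d)) :
  map_mx up A *m (\sum_(i < q) (e i)%:MP *: map_mx up (w i)) =
  \sum_(i < q) (e i)%:MP *: map_mx up (A *m w i).
Proof.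
rewrite mulmx_sumr; apply: eq_bigr => i _.
by rewrite -scalemxAr map_mxM.
Qed.

Lemma mx_indep a b q e (w : nat -> 'M[{mpoly K[n]}]_(a, b)) : lin_indep q e ->
  \sum_(i < q) (e i)%:MP *: map_mx up (w i) = 0 -> forall i, (i < q)%N -> w i = 0.
Proof.
move=> ind h k kq; apply/matrixP => i j; rewrite mxE.
apply: (mpoly_indep (p := fun k => w k i j) ind) => //.
move/matrixP/(_ i j): h; rewrite summxE mxE => h; rewrite -[RHS]h.
by apply: eq_bigr => l _; rewrite !mxE.
Qed.

Lemma flat_map_mpoly : flat_hom up.
Proof.
move=> m r p A D [AD kerA]; split; first by rewrite -map_mxM AD map_mx0.
move=> v Av; have [q [e [w [_ [ind ev _]]]]] := mx_expansion v 0.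
have Aw i : (i < q)%N -> A *m w i = 0.
  apply: (mx_indep (w := fun i => A *m w i) ind).
  by rewrite -map_mx_scale_sum -ev.
have ex i : exists z, (i < q)%N -> w i = D *m z.
  have [/Aw/kerA[z hz]|_] := boolP (i < q)%N; first by exists z.
  by exists 0.
pose z i := sval (constructive_indefinite_description _ (ex i)).
have zP i : (i < q)%N -> w i = D *m z i.
  by rewrite /z; case: constructive_indefinite_description.
exists (\sum_(i < q) (e i)%:MP *: map_mx up (z i)).
by rewrite map_mx_scale_sum ev; apply: eq_bigr => i _; rewrite zP.
Qed.

(** Expanding [T] and [1] in one independent family and comparing coefficients gives
    [A w_i A = c_i A], with some [c_i] non-zero. For larger [k], syzygies computed over [K] still
    generate over [L], hence have the same image as the given ones. *)
Lemma spl_descent k m r (A : 'M[{mpoly K[n]}]_(m, r)) :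
  spl k (map_mx up A) -> spl k A.
Proof.
elim: k m r A => [|k IH] m r A.
  move=> [T hT]; have [q [e [w [c [ind eT e1]]]]] := mx_expansion T 1.
  have hi i : (i < q)%N -> A *m w i *m A - (c i)%:MP *: A = 0.
    apply: (mx_indep (w := fun i => A *m w i *m A - (c i)%:MP *: A) ind).
    under eq_bigr => i' _ do rewrite raddfB /= scalerBr.
    rewrite sumrB; apply/eqP; rewrite subr_eq0; apply/eqP.
    rewrite [RHS](_ : _ = map_mx up A).
      rewrite -[RHS]hT eT map_mx_scale_sum mulmx_suml.
      by apply: eq_bigr => i' _; rewrite map_mxM scalemxAl.
    rewrite -[RHS]scale1r -[1 in RHS](rmorph1 (@mpolyC n L)) e1 rmorph_sum scaler_suml.
    apply: eq_bigr => i' _.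
    by rewrite map_mxZ /= map_mpolyC ?rmorph0 // scalerA -rmorphM.
  have [i iq ci] : exists2 i, (i < q)%N & c i != 0.
    apply: NNPP => hn; have /eqP := oner_neq0 L; apply; rewrite e1 big1 // => i _.
    have -> : c i = 0; last by rewrite rmorph0 mulr0.
    by apply/eqP/negPn/negP => h; apply: hn; exists (i : nat).
  exists ((c i)^-1%:MP *: w i); rewrite -scalemxAr -scalemxAl.
  move/eqP: (hi i iq); rewrite subr_eq0 => /eqP->.
  by rewrite scalerA -rmorphM mulVf // rmorph1 scale1r.
move=> [p [D' [[AD' kerA'] splD']]]; have [q [D sD]] := mpoly_coherent A.
exists q, D; split=> //; apply: IH.
have sD'' := flat_map_mpoly sD.
have [X eX] := syz_factor (conj AD' kerA') sD''.1.
have [X' eX'] := syz_factor sD'' AD'.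
exact: (spl_same_image (@mpoly_coherent L n) eX eX').
Qed.

End FieldExtension.

(** * Ideals and regular sequences *)

(** Sequences are read from the end: the head is the latest element and the tail generates the ideal
    preceding it, the shape on which [reg] recurses. *)
Fixpoint idl (R : comNzRingType) (l : seq R) (v : R) : Prop :=
  if l is x :: l' then exists c, idl l' (v - c * x) else v = 0.

Section Ideals.
Variable R : comNzRingType.
Implicit Types (l : seq R) (u v x : R).

Lemma idl0 l : idl l 0.
Proof. by elim: l => //= x l IH; exists 0; rewrite mul0r subr0. Qed.

Lemma idlD l u v : idl l u -> idl l v -> idl l (u + v).
Proof.
elim: l u v => /= [u v -> ->|x l IH u v [a ha] [b hb]]; first by rewrite addr0.
by exists (a + b); rewrite mulrDl opprD addrACA; apply: IH.
Qed.

Lemma idlM l a v : idl l v -> idl l (a * v).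
Proof.
elim: l v => /= [v ->|x l IH v [c hc]]; first by rewrite mulr0.
by exists (a * c); rewrite -mulrA -mulrBr; apply: IH.
Qed.

Lemma idlN l v : idl l v -> idl l (- v).
Proof. by rewrite -mulN1r; apply: idlM. Qed.

Lemma idlB l u v : idl l u -> idl l v -> idl l (u - v).
Proof. by move=> hu hv; apply/idlD/idlN. Qed.

Lemma idl_sum (I : Type) (r : seq I) (P : pred I) (F : I -> R) l :
  (forall i, P i -> idl l (F i)) -> idl l (\sum_(i <- r | P i) F i).
Proof. by move=> h; apply: big_ind => //; [apply: idl0 | apply: idlD]. Qed.

Lemma idl_cons x l v : idl l v -> idl (x :: l) v.
Proof. by exists 0; rewrite mul0r subr0. Qed.

Lemma idl_mem x l : x \in l -> idl l x.
Proof.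
elim: l => // y l IH; rewrite inE => /orP[/eqP->|/IH]; last exact: idl_cons.
by exists 1; rewrite mul1r subrr; apply: idl0.
Qed.

Lemma idl_trans l l' v : (forall x, x \in l -> idl l' x) -> idl l v -> idl l' v.
Proof.
elim: l v => /= [v _ ->|x l IH v hl [c hc]]; first exact: idl0.
rewrite -[v](subrK (c * x)); apply: idlD.
  by apply: IH hc => y yl; apply: hl; rewrite inE yl orbT.
by apply/idlM/hl; rewrite inE eqxx.
Qed.

Lemma idl_sub l l' v : {subset l <= l'} -> idl l v -> idl l' v.
Proof. by move=> h; apply: idl_trans => x /h; apply: idl_mem. Qed.

End Ideals.

(** * Homogeneous components with respect to a weight *)

Section Filter.
Variables (K : comNzRingType) (n : nat) (mf : measure n).
Implicit Types (p q c : {mpoly K[n]}) (P : pred nat).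

Definition mfilter (Q : pred 'X_{1..n}) p : {mpoly K[n]} :=
  \sum_(m <- msupp p | Q m) p@_m *: 'X_[m].

Definition dfilter P p : {mpoly K[n]} := mfilter (fun m => P (mf m)) p.

Lemma mcoeff_mfilter (Q : pred 'X_{1..n}) p m :
  (mfilter Q p)@_m = if Q m then p@_m else 0.
Proof.
rewrite /mfilter raddf_sum /= big_mkcond /=.
rewrite (eq_bigr (fun m' => (if Q m' then p@_m' else 0) * (m' == m)%:R)).
  2: by move=> m' _; case: ifP => _; rewrite ?mul0r // mcoeffZ mcoeffX.
have [hm|hm] := boolP (m \in msupp p).
  rewrite (bigD1_seq m) ?msupp_uniq //= eqxx mulr1 big1 ?addr0 //.
  by move=> m' /negPf->; rewrite mulr0.
rewrite big1_seq; first by rewrite memN_msupp_eq0 //; case: ifP.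
move=> m' /andP[_ hm']; have /negPf-> : m' != m by apply: contraNneq hm => <-.
by rewrite mulr0.
Qed.

Lemma mcoeff_dfilter P p m : (dfilter P p)@_m = if P (mf m) then p@_m else 0.
Proof. exact: mcoeff_mfilter. Qed.

Lemma dfilterD P p q : dfilter P (p + q) = dfilter P p + dfilter P q.
Proof.
apply/mpolyP => m; rewrite mcoeffD !mcoeff_dfilter mcoeffD.
by case: ifP => _ //; rewrite addr0.
Qed.

Lemma dfilter0 P : dfilter P 0 = 0.
Proof. by apply/mpolyP => m; rewrite mcoeff_dfilter mcoeff0 if_same. Qed.

Lemma dfilterZ P a p : dfilter P (a *: p) = a *: dfilter P p.
Proof.
apply/mpolyP => m; rewrite mcoeffZ !mcoeff_dfilter mcoeffZ.
by case: ifP; rewrite ?mulr0.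
Qed.

Lemma dfilterN P p : dfilter P (- p) = - dfilter P p.
Proof. by rewrite -scaleN1r dfilterZ scaleN1r. Qed.

Lemma dfilterB P p q : dfilter P (p - q) = dfilter P p - dfilter P q.
Proof. by rewrite dfilterD dfilterN. Qed.

Lemma dfilter_sum (I : Type) (r : seq I) Q P (F : I -> {mpoly K[n]}) :
  dfilter P (\sum_(i <- r | Q i) F i) = \sum_(i <- r | Q i) dfilter P (F i).
Proof. exact: (big_morph _ (dfilterD P) (dfilter0 P)). Qed.

Lemma dfilter_id P p : (forall m, m \in msupp p -> P (mf m)) -> dfilter P p = p.
Proof.
move=> h; apply/mpolyP => m; rewrite mcoeff_dfilter; case: ifP => // hP.
by rewrite memN_msupp_eq0 //; apply: contraFN hP => /h.
Qed.

Lemma dfilter_eq0 P p : (forall m, m \in msupp p -> ~~ P (mf m)) -> dfilter P p = 0.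
Proof.
move=> h; apply/mpolyP => m; rewrite mcoeff_dfilter mcoeff0; case: ifP => // hP.
by rewrite memN_msupp_eq0 //; apply: contraTN hP => /h.
Qed.

Lemma msupp_dfilter P p m : m \in msupp (dfilter P p) -> (m \in msupp p) && P (mf m).
Proof.
by rewrite !mcoeff_msupp mcoeff_dfilter; case: ifP => _; rewrite ?eqxx ?andbT.
Qed.

(** A form of degree [d] shifts degrees by [d], so filtering a product amounts to filtering the
    other factor. *)
Lemma dfilterM P d c p : p \is d.-homog for mf ->
  dfilter P (c * p) = dfilter (fun k => P (k + d)%N) c * p.
Proof.
move=> hp; rewrite [c in LHS]mpolyE mulr_suml dfilter_sum.
rewrite [in RHS]/dfilter /mfilter mulr_suml [in RHS]big_mkcond /=; apply: eq_bigr => m _.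
rewrite -scalerAl dfilterZ.
have hmp : 'X_[m] * p \is (mf m + d).-homog for mf.
  by apply: dhomogM => //; rewrite dhomogX.
case: ifP => hP.
  by rewrite dfilter_id ?scalerAl // => m' /(dhomogP _ _ _ hmp)->.
by rewrite dfilter_eq0 ?scaler0 // => m' /(dhomogP _ _ _ hmp)->; rewrite hP.
Qed.

Lemma dfilter_homog k p : dfilter (pred1 k) p \is k.-homog for mf.
Proof. by apply/dhomogP => m /msupp_dfilter/andP[_ /eqP]. Qed.

Lemma dfilter_shift_homog k d p : dfilter (fun j => (j + d)%N == k) p \is (k - d).-homog for mf.
Proof. by apply/dhomogP => m /msupp_dfilter/andP[_ /eqP <-]; rewrite addnK. Qed.

Lemma eq_dfilter P Q p : P =1 Q -> dfilter P p = dfilter Q p.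
Proof. by move=> e; apply/mpolyP => m; rewrite !mcoeff_dfilter e. Qed.

Lemma sum_dfilter b p : (forall m, m \in msupp p -> (mf m < b)%N) ->
  p = \sum_(k < b) dfilter (pred1 (k : nat)) p.
Proof.
move=> h; apply/mpolyP => m; rewrite raddf_sum /=.
under eq_bigr => k _ do rewrite mcoeff_dfilter /=.
have [hm|hm] := boolP (m \in msupp p).
  rewrite (bigD1 (Ordinal (h _ hm))) //= eqxx big1 ?addr0 // => k nk.
  case: ifP => // /eqP e; case/eqP: nk; apply: val_inj; exact/esym.
by rewrite memN_msupp_eq0 // big1 // => k _; rewrite if_same.
Qed.

End Filter.

(** * Ideals generated by forms of positive degree *)

Definition posform (K : comNzRingType) n (x : {mpoly K[n]}) : Prop :=
  exists2 d, (0 < d)%N & x \is d.-homog.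

Definition posforms (K : comNzRingType) n (l : seq {mpoly K[n]}) : Prop :=
  forall x, x \in l -> posform x.

Lemma posforms_cons (K : comNzRingType) n (x : {mpoly K[n]}) l :
  posforms (x :: l) <-> posform x /\ posforms l.
Proof.
split=> [h|[hx hl] y]; last by rewrite inE => /orP[/eqP->|/hl].
by split=> [|y yl]; apply: h; rewrite inE ?eqxx ?yl ?orbT.
Qed.

Lemma posforms_sub (K : comNzRingType) n (l l' : seq {mpoly K[n]}) :
  {subset l <= l'} -> posforms l' -> posforms l.
Proof. by move=> h hl x /h; apply: hl. Qed.

Lemma idl_dfilter (K : comNzRingType) n (l : seq {mpoly K[n]}) P v :
  posforms l -> idl l v -> idl l (dfilter mdeg P v).
Proof.
elim: l P v => /= [P v _ ->|x l IH P v /posforms_cons[[d d0 hx] hl] [c hc]].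
  by rewrite dfilter0.
exists (dfilter mdeg (fun k => P (k + d)%N) c).
by rewrite -(dfilterM P c hx) -dfilterB; apply: IH.
Qed.

Lemma idl_components (K : comNzRingType) n (l : seq {mpoly K[n]}) v :
  (forall k, idl l (dfilter mdeg (pred1 k) v)) -> idl l v.
Proof.
move=> h; rewrite (@sum_dfilter _ _ mdeg (msize v) v); first by apply: idl_sum.
by move=> m; apply: msize_mdeg_lt.
Qed.

Lemma idl_bounded (K : comNzRingType) n (l : seq {mpoly K[n]}) v b :
  posforms l -> idl l v -> (msize v <= b.+1)%N ->
  exists c : nat -> {mpoly K[n]}, v = \sum_(i < size l) c i * l`_i /\
    forall i, (msize (c i) <= b)%N.
Proof.
elim: l v => /= [v _ -> _|x l IH v /posforms_cons[[d d0 hx] hl] [c hc] vb].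
  by exists (fun=> 0); split=> [|i]; rewrite ?big_ord0 ?msize0.
pose c0 := dfilter mdeg (fun k => (k + d < b.+1)%N) c.
have hv : dfilter mdeg (fun k => (k < b.+1)%N) v = v.
  by apply: dfilter_id => m /msize_mdeg_lt h; apply: leq_trans vb.
have e0 : dfilter mdeg (fun k => (k < b.+1)%N) (c * x) = c0 * x.
  exact: (dfilterM (fun k => (k < b.+1)%N) c hx).
have c0b : (msize c0 <= b)%N.
  rewrite /c0 msizeE; apply/bigmax_leqP_seq => m /msupp_dfilter/andP[_ /= h] _; lia.
have rb : (msize (v - c0 * x) <= b.+1)%N.
  rewrite -hv -e0 -dfilterB msizeE.
  by apply/bigmax_leqP_seq => m /msupp_dfilter/andP[_ /= h].
have [|e [he eb]] := IH (v - c0 * x) hl _ rb.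
  by rewrite -hv -e0 -dfilterB; apply: idl_dfilter.
exists (fun i => if i is j.+1 then e j else c0); split; last by case.
by rewrite big_ord_recl /= -he addrC subrK.
Qed.

Fixpoint reg (R : comNzRingType) (l : seq R) : Prop :=
  if l is x :: l' then reg l' /\ forall v, idl l' (x * v) -> idl l' v else True.

Lemma reg_drop (R : comNzRingType) k (l : seq R) : reg l -> reg (drop k l).
Proof. by elim: l k => [|x l IH] [|k] //= [/IH]. Qed.

Section Regular.
Variables (K : comNzRingType) (n : nat).
Local Notation S := {mpoly K[n]}.
Implicit Types (l : seq S) (x y v : S).

(* [v = c y] modulo [l] with [c] of smaller degree and again killed by [x]. *)
Lemma nzd_swap x y l : posforms (y :: l) ->
  (forall v, idl l (y * v) -> idl l v) ->
  (forall v, idl (y :: l) (x * v) -> idl (y :: l) v) ->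
  posform x -> forall v, idl l (x * v) -> idl l v.
Proof.
move=> /posforms_cons[[e e0 hy] hl] ny nx [d d0 hx] v hv.
apply: idl_components => k.
have {hv} : idl l (x * dfilter mdeg (pred1 k) v).
  rewrite mulrC -(@eq_dfilter _ _ mdeg (fun j => j + d == k + d)%N); last first.
    by move=> j /=; rewrite eqn_add2r.
  rewrite -(dfilterM (pred1 (k + d)%N) v hx) [v * x]mulrC; exact: idl_dfilter.
have : dfilter mdeg (pred1 k) v \is k.-homog by apply: dfilter_homog.
elim/ltn_ind: k (dfilter mdeg (pred1 k) v) => k IH {}v hk hv.
have [c hc] := nx v (idl_cons y hv).
have vk : dfilter mdeg (pred1 k) v = v.
  by apply: dfilter_id => m /(dhomogP _ _ _ hk) /= ->.
pose c0 := dfilter mdeg (fun j => pred1 k (j + e)%N) c.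
have hc0 : idl l (v - c0 * y).
  by rewrite -[v]vk -(dfilterM (pred1 k) c hy) -dfilterB; apply: idl_dfilter.
have [ke|ek] := ltnP k e.
  suff -> : v = v - c0 * y by [].
  rewrite /c0 dfilter_eq0 ?mul0r ?subr0 // => m _ /=; lia.
suff h0 : idl l c0 by rewrite -[v](subrK (c0 * y)); apply: idlD; rewrite // mulrC; apply: idlM.
apply: (IH (k - e)%N); first by lia.
  exact: dfilter_shift_homog.
apply: ny; rewrite mulrCA -[y * c0]mulrC -[_ * _](subKr (x * v)).
by apply: idlB => //; rewrite -mulrBr; apply: idlM.
Qed.

(** Regular sequences are not permutable in general; the grading enters through [nzd_swap], and the
    other condition is formal. *)
Lemma reg_swap x y l : posforms (x :: y :: l) ->
  reg (x :: y :: l) -> reg (y :: x :: l).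
Proof.
move=> /posforms_cons[px /[dup]/posforms_cons[py pl] pyl] [[rl ny] nx].
have nx' := nzd_swap pyl ny nx px.
split=> [|v [c hc]]; first by split.
have [|w hw] := nx c.
  by exists v; rewrite -opprB [x * c]mulrC [v * y]mulrC; apply: idlN.
exists w; apply: ny.
have -> : y * (v - w * x) = (y * v - c * x) + x * (c - w * y) by ring.
by apply: idlD => //; apply: idlM.
Qed.

Lemma reg_move l1 x l2 : posforms (x :: l1 ++ l2) ->
  reg (l1 ++ x :: l2) <-> reg (x :: l1 ++ l2).
Proof.
elim: l1 => //= y l1 IH pf.
have pf' : posforms (x :: l1 ++ l2).
  by apply: posforms_sub pf => z; rewrite !inE => /orP[->|->]; rewrite ?orbT.
have IH' := IH pf'.
have e v : idl (l1 ++ x :: l2) v <-> idl (x :: l1 ++ l2) v.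
  by split; apply: idl_sub => z; rewrite !(mem_cat, inE); case: (z \in l1); case: (z == x).
split=> [[/IH' h1 h2]|h].
  by apply: (@reg_swap y x); [apply: posforms_sub pf => z; rewrite !inE orbCA
    | split=> // v /e/h2/e].
have [/IH' h1 h2] : reg (y :: x :: l1 ++ l2) by apply: reg_swap.
by split=> // v /e/h2/e.
Qed.

End Regular.

(** * Flatness over the subalgebra generated by a regular sequence *)

Lemma mpoly_divX (R : comNzRingType) s (k : 'I_s) (p : {mpoly R[s]}) :
  (forall m, m \in msupp p -> m k != 0%N) ->
  exists2 p1, p = 'X_k * p1 & forall m, p1@_m = p@_(U_(k) + m).
Proof.
move=> h; pose p1 := \sum_(m <- msupp p) p@_m *: 'X_[R, m - U_(k)].
have e : p = 'X_k * p1.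
  rewrite [LHS]mpolyE mulr_sumr !big_seq; apply: eq_bigr => m hm.
  by rewrite -scalerAr -mpolyXD addmC submK // lep1mP h.
by exists p1 => // m; rewrite [in RHS]e mulrC mcoeffMX.
Qed.

(** Write [p = p0 + x_k p1] with [p0] free of [x_k]. The value of [p0] lies in the ideal of
    [drop k fs], so [p0] vanishes by induction on the number of variables; then [fs_k] cancels
    modulo [drop k.+1 fs], leaving [p1] of smaller size. *)
Lemma reg_eval_inj (R : comNzRingType) (fs : seq R) (H : R -> Prop) :
  reg fs -> (forall h, H h -> idl fs h -> h = 0) ->
  forall k, (k <= size fs)%N -> forall p : {mpoly R[size fs]},
  (forall m, H p@_m) -> H 0 ->
  (forall m, m \in msupp p -> forall i : 'I_(size fs), (k <= i)%N -> m i = 0%N) ->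
  idl (drop k fs) p.@[fun i => fs`_i] -> p = 0.
Proof.
move=> rfs Hfs k; elim: k => [|k IH] kn p Hp H0 pk.
  have -> : p = (p@_0)%:MP.
    apply/mpolyP => m; rewrite mcoeffC; have [->|m0] := eqVneq m 0%MM.
      by rewrite mulr1.
    rewrite mulr0; apply: memN_msupp_eq0; apply: contra m0 => /pk pm.
    by apply/eqP/mnmP => i; rewrite mnm0E pm.
  by rewrite drop0 mevalC => /Hfs -> //; rewrite mpolyC0.
pose ok := Ordinal kn.
have kn' := ltnW kn.
elim: {p}(msize p) {-2}p (leqnn (msize p)) Hp pk => [|b IHb] p pb Hp pk hp.
  by apply/eqP; rewrite -msize_poly_eq0 -leqn0.
pose mk := (fun m : 'X_{1..size fs} => m ok).
have mk0 : mk 0%MM = 0%N by rewrite /mk mnm0E.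
have mkD : {morph mk : m1 m2 / (m1 + m2)%MM >-> (m1 + m2)%N}.
  by move=> m1 m2; rewrite /mk mnmDE.
pose MK : measure (size fs) := HB.pack mk (isMeasure.Build _ mk mk0 mkD).
pose p0 := dfilter MK (pred1 0%N) p.
have p0c m : p0@_m = if m ok == 0%N then p@_m else 0 by rewrite mcoeff_dfilter.
have [m|p1 ep1 p1c] := @mpoly_divX R _ ok (p - p0).
  rewrite mcoeff_msupp mcoeffB p0c; apply: contraNneq => ->.
  by rewrite eqxx subrr.
have ep : p = p0 + 'X_ok * p1 by rewrite -ep1 addrC subrK.
have ev : p.@[fun i => fs`_i] = p0.@[fun i => fs`_i] + fs`_k * p1.@[fun i => fs`_i].
  by rewrite [in LHS]ep mevalD mevalM mevalXU.
have dk : drop k fs = fs`_k :: drop k.+1 fs by rewrite -drop_nth.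
have p00 : p0 = 0.
  apply: (IH kn') => //.
  - by move=> m; rewrite p0c; case: ifP.
  - move=> m /msupp_dfilter/andP[hm /= hm0] i.
    rewrite leq_eqVlt => /orP[/eqP e|ki]; last exact: pk hm i ki.
    by rewrite -[i](_ : ok = i) //; [apply/eqP | apply: val_inj].
  - rewrite dk /=; exists (- p1.@[fun i => fs`_i]).
    by rewrite mulNr opprK mulrC -ev.
have p10 : p1 = 0.
  have hc m : p1@_m = p@_(U_(ok) + m) by rewrite p1c p00 subr0.
  apply: IHb.
  - rewrite msizeE; apply/bigmax_leqP_seq => m hm _.
    have : (U_(ok) + m)%MM \in msupp p by rewrite mcoeff_msupp -hc -mcoeff_msupp.
    by move/msize_mdeg_lt; rewrite mdegD mdeg1; lia.
  - by move=> m; rewrite hc.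
  - move=> m hm i ki.
    have /pk/(_ i ki) : (U_(ok) + m)%MM \in msupp p by rewrite mcoeff_msupp -hc -mcoeff_msupp.
    by rewrite mnmDE; lia.
  - have := reg_drop k rfs; rewrite dk => -[_]; apply.
    by move: hp; rewrite ev p00 meval0 add0r.
by rewrite ep p00 p10 mulr0 addr0.
Qed.

Definition ev (K : fieldType) (N : nat) (fs : seq {mpoly K[N]}) :
    {mpoly K[size fs]} -> {mpoly K[N]} :=
  mmap (@mpolyC N K) (fun i : 'I_(size fs) => fs`_i).

Arguments ev {K N} fs _.

HB.instance Definition _ K N fs :=
  GRing.RMorphism.copy (@ev K N fs) (mmap (@mpolyC N K) (fun i : 'I_(size fs) => fs`_i)).

Section Flat.
Variables (K : fieldType) (N : nat).
Local Notation S := {mpoly K[N]}.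
Variable fs : seq S.
Hypothesis rfs : reg fs.
Hypothesis pfs : posforms fs.
Local Notation s := (size fs).
Local Notation ev := (@ev K N fs).

(** [H] is spanned by the standard monomials, those that lead no element of the ideal, and is a
    linear complement of the ideal. These monomials form a basis of [S] over [K[fs]]: [gen] is the
    existence and [reg_eval_inj] the uniqueness of coordinates. *)
Let leadI (m : 'X_{1..N}) : Prop := exists g, [/\ idl fs g, g <> 0 & mlead g = m].
Let H (v : S) : Prop := forall m, m \in msupp v -> ~ leadI m.

Let H0 : H 0. Proof. by move=> m; rewrite msupp0. Qed.

Let HD u v : H u -> H v -> H (u + v).
Proof. by move=> hu hv m /msuppD_le; rewrite mem_cat => /orP[/hu|/hv]. Qed.

Let HZ a v : H v -> H (a *: v).
Proof. by move=> hv m /msuppZ_le/hv. Qed.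

Let Hidl v : H v -> idl fs v -> v = 0.
Proof.
move=> hv iv; apply: NNPP => /eqP nv.
by apply: (hv (mlead v)); [apply: mlead_supp | exists v; split=> //; apply/eqP].
Qed.

Let drop_lead (a b : S) : mlead a = mlead b -> mleadc a = mleadc b ->
  a - b <> 0 -> (mlead (a - b) < mlead a)%O.
Proof.
move=> e ec /eqP nab; rewrite lt_neqAle; apply/andP; split.
  apply/eqP => el; have := nab; rewrite -mleadc_eq0 el mcoeffB ec e subrr.
  by rewrite eqxx.
by apply: le_trans (mleadB_le _ _) _; rewrite -e joinxx.
Qed.

Let reduce v : exists h, [/\ H h, idl fs (v - h) & (msize h <= msize v)%N].
Proof.
suff : exists h, [/\ H h, idl fs (v - h) & forall m, m \in msupp h -> (m <= mlead v)%O].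
  move=> [h [Hh ih hm]]; have [v0|nv] := eqVneq v 0.
    by exists 0; split=> //; rewrite ?v0 ?subr0 ?msize0 //; apply: idl0.
  (* The monomial order refines the degree, so reduction does not raise the degree. *)
  exists h; split=> //; rewrite -(mlead_deg nv) msizeE.
  by apply/bigmax_leqP_seq => m /hm /lemc_mdeg.
move: {2}(mlead v) (erefl (mlead v)) => m; elim/(well_founded_ind (@ltom_wf N)): m v.
move=> m IH v em; have [v0|nv] := eqVneq v 0.
  by exists 0; rewrite v0 subr0; split; [exact: H0 | exact: idl0 | by move=> m'; rewrite msupp0].
have step w : mlead w = m -> mleadc w = mleadc v ->
    exists h, [/\ H h, idl fs (v - w - h) & forall m', m' \in msupp h -> (m' <= m)%O].
  move=> ew ecw; have [e0|/eqP ne] := eqVneq (v - w) 0.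
    by exists 0; rewrite e0 subr0; split; [exact: H0 | exact: idl0 | by move=> m'; rewrite msupp0].
  have lt_ : (mlead (v - w) < m)%O.
    by rewrite -em; apply: drop_lead => //; rewrite ew em.
  have [h [Hh ih hm]] := IH _ lt_ _ (erefl _).
  by exists h; split=> // m' /hm h'; apply: le_trans h' (ltW lt_).
have [[g [ig /eqP ng lg]]|nl] := classic (leadI m).
  pose c := mleadc v / mleadc g.
  have nc : c != 0 by rewrite mulf_neq0 ?invr_eq0 ?mleadc_eq0.
  have [||h [Hh ih hm]] := step (c *: g).
  - by rewrite mleadZ.
  - by rewrite mleadZ // mcoeffZ divfK ?mleadc_eq0.
  exists h; split=> //; last by rewrite em.
  rewrite -[v](subrK (c *: g)) addrAC; apply: idlD => //.
  by rewrite -mul_mpolyC; apply: idlM.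
have [||h [Hh ih hm]] := step (mleadc v *: 'X_[m]).
- by rewrite mleadZ ?mleadc_eq0 // mleadXm.
- by rewrite mleadZ ?mleadc_eq0 // mleadXm mcoeffZ mcoeffX eqxx mulr1.
exists (mleadc v *: 'X_[m] + h); split.
- apply: HD => // m' /msuppZ_le; rewrite msuppX inE => /eqP->; exact: nl.
- by rewrite opprD addrA.
- move=> m' /msuppD_le; rewrite mem_cat em => /orP[/msuppZ_le|/hm//].
  by rewrite msuppX inE => /eqP->.
Qed.

Let gen v : exists q : {mpoly S[s]}, (forall m, H q@_m) /\ v = q.@[fun i => fs`_i].
Proof.
move: {2}(msize v) (leqnn (msize v)) => b; elim: b v => [|b IH] v vb.
  exists 0; split=> [m|]; first by rewrite mcoeff0.
  by rewrite meval0; apply/eqP; rewrite -msize_poly_eq0 -leqn0.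
have [h [Hh ih hb]] := reduce v.
have [|c [ec cb]] := idl_bounded (b := b) pfs ih.
  by apply: leq_trans (msizeD_le _ _) _; rewrite msizeN geq_max vb (leq_trans hb vb).
have /fin_all_exists[q hq] := fun i : 'I_s => IH (c i) (cb i).
exists (h%:MP + \sum_(i < s) 'X_i * q i); split.
  move=> m; rewrite mcoeffD; apply: HD.
    rewrite mcoeffC; case: eqP => _; rewrite ?mulr1 ?mulr0 //; exact: H0.
  rewrite raddf_sum /=; apply: big_ind; [exact: H0 | exact: HD | move=> i _].
  have [im|] := boolP (U_(i) <= m)%MM.
    by rewrite -(submK im) addmC mulrC mcoeffMX; apply: (hq i).1.
  move=> him; rewrite mulrC memN_msupp_eq0 // (perm_mem (msuppMX _ _)).
  by apply/negP => /mapP[m' _ em]; case/negP: him; rewrite em lem_addr.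
rewrite mevalD mevalC raddf_sum /= addrC -[LHS](subrK h) ec; congr (_ + _).
by apply: eq_bigr => i _; rewrite mevalM mevalXU mulrC -(hq i).2.
Qed.

Local Notation cst := (map_mpoly (n := s) (@mpolyC N K)).
Local Notation ext := (fun mu => map_mpoly (n := s) (@mcoeff N K mu)).

Let evE a : ev a = (cst a).@[fun i => fs`_i].
Proof.
transitivity (\sum_(m <- msupp a) (cst (a@_m *: 'X_[m])).@[fun i => fs`_i]).
  by apply: eq_bigr => m _; rewrite map_mpolyZ map_mpolyX mevalZ mevalX.
by rewrite -raddf_sum -raddf_sum -mpolyE.
Qed.

Let HcstM a q : (forall m, H q@_m) -> forall m, H (cst a * q)@_m.
Proof.
move=> Hq m; rewrite mcoeffM; apply: big_ind; [exact: H0 | exact: HD | move=> i _].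
by rewrite mcoeff_map_mpoly mul_mpolyC; apply: HZ.
Qed.

Let ext_cstM mu a q : ext mu (cst a * q) = a * ext mu q.
Proof.
apply/mpolyP => m; rewrite mcoeff_map_mpoly /= !mcoeffM raddf_sum /=.
by apply: eq_bigr => i _; rewrite !mcoeff_map_mpoly mcoeffCM.
Qed.

Let ext_expand (q : {mpoly S[s]}) b : (forall m, (msize q@_m <= b)%N) ->
  q.@[fun i => fs`_i] = \sum_(mu : 'X_{1..N < b}) 'X_[mu] * ev (ext mu q).
Proof.
move=> qb; under eq_bigr => mu _ do rewrite evE.
rewrite mevalE; pose c := (fun i : 'I_s => fs`_i).
have e (mu : 'X_{1..N < b}) : (cst (ext mu q)).@[c] =
    \sum_(m <- msupp q) ((q@_m)@_mu)%:MP * \prod_i c i ^+ m i.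
  transitivity (\sum_(m <- msupp q) (cst (ext mu (q@_m *: 'X_[m]))).@[c]).
    by rewrite -raddf_sum -raddf_sum -raddf_sum -mpolyE.
  apply: eq_bigr => m _.
  have -> : cst (ext mu (q@_m *: 'X_[m])) = ((q@_m)@_mu)%:MP *: 'X_[m].
    apply/mpolyP => m'; rewrite !mcoeff_map_mpoly /= !mcoeffZ !mcoeffX.
    by case: (m == m'); rewrite ?mulr1 // !mulr0 mcoeff0 mpolyC0.
  by rewrite mevalZ mevalX.
under [RHS]eq_bigr => mu _ do rewrite e mulr_sumr.
rewrite exchange_big /=; apply: eq_bigr => m _.
rewrite [q@_m in LHS](mpolywE (qb m)) mulr_suml; apply: eq_bigr => mu _.
by rewrite mulrA; congr (_ * _); rewrite mulrC mul_mpolyC.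
Qed.

(** The entries of [v] are lifted to polynomials [q] in [fs] with coefficients in [H]. By uniqueness
    the relation holds already among the [q]; extracting the coefficient of each monomial [mu] of
    [S] gives a relation over the source polynomial ring, solved there and reassembled. *)
Lemma flat_ev : flat_hom ev.
Proof.
move=> m n p A D [AD kerA]; split; first by rewrite -map_mxM AD map_mx0.
move=> v Av; have /fin_all_exists[q hq] := fun i : 'I_n => gen (v i 0).
pose c := (fun i : 'I_s => fs`_i).
have Aq k : \sum_i cst (A k i) * q i = 0.
  apply: (@reg_eval_inj _ fs H rfs Hidl s (leqnn _)) => //.
  - move=> m'; rewrite raddf_sum /=; apply: big_ind; [exact: H0|exact: HD|move=> i _].
    by apply: HcstM; apply: (hq i).1.
  - by move=> m' _ i; rewrite leqNgt ltn_ord.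
  - rewrite drop_size /= raddf_sum /=; move/matrixP/(_ k 0): Av.
    rewrite !mxE => e; rewrite -[RHS]e; apply: eq_bigr => i _.
    by rewrite mevalM mxE /= -evE (hq i).2.
have wit mu : exists w : 'cV_p, \col_i ext mu (q i) = D *m w.
  apply: kerA; apply/matrixP => k j; rewrite !mxE.
  rewrite -[RHS](_ : ext mu (\sum_i cst (A k i) * q i) = 0); last first.
    by rewrite Aq; apply: raddf0.
  rewrite raddf_sum; apply: eq_bigr => i _.
  by rewrite !mxE /= ext_cstM.
pose w mu := sval (constructive_indefinite_description _ (wit mu)).
have wP mu : \col_i ext mu (q i) = D *m w mu.
  by rewrite /w; case: constructive_indefinite_description.
pose b := \max_i \max_(m' <- msupp (q i)) msize (q i)@_m'.
have qb i m' : (msize (q i)@_m' <= b)%N.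
  have [hm|hm] := boolP (m' \in msupp (q i)); last by rewrite memN_msupp_eq0 ?msize0.
  apply: leq_trans (leq_bigmax i).
  by rewrite (big_rem m') //= leq_max leqnn.
exists (\sum_(mu : 'X_{1..N < b}) 'X_[mu] *: map_mx ev (w mu)).
apply/matrixP => i j; rewrite ord1 (hq i).2 (ext_expand (qb i)) mulmx_sumr summxE.
apply: eq_bigr => mu _; rewrite -scalemxAr mxE -map_mxM -wP.
by rewrite !mxE.
Qed.

End Flat.

(** * Subalgebras and strength *)

Definition inalg (K : fieldType) N (l : seq {mpoly K[N]}) (v : {mpoly K[N]}) : Prop :=
  exists a, ev l a = v.

Section Inalg.
Variables (K : fieldType) (N : nat).
Local Notation S := {mpoly K[N]}.
Implicit Types (l : seq S) (u v x : S).

Lemma inalgD l u v : inalg l u -> inalg l v -> inalg l (u + v).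
Proof. by move=> [a <-] [b <-]; exists (a + b); rewrite rmorphD. Qed.

Lemma inalgM l u v : inalg l u -> inalg l v -> inalg l (u * v).
Proof. by move=> [a <-] [b <-]; exists (a * b); rewrite rmorphM. Qed.

Lemma evC l (c : K) : ev l c%:MP = c%:MP.
Proof. exact: mmapC. Qed.

Lemma evX l (i : 'I_(size l)) : ev l 'X_i = l`_i.
Proof. by rewrite /ev mmapX mmap1U. Qed.

Lemma inalgC l (c : K) : inalg l c%:MP.
Proof. by exists c%:MP; rewrite evC. Qed.

Lemma inalgZ l (c : K) v : inalg l v -> inalg l (c *: v).
Proof. by rewrite -mul_mpolyC => h; apply: inalgM => //; apply: inalgC. Qed.

Lemma inalg0 l : inalg l 0.
Proof. by rewrite -mpolyC0; apply: inalgC. Qed.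

Lemma inalgN l v : inalg l v -> inalg l (- v).
Proof. by rewrite -scaleN1r; apply: inalgZ. Qed.

Lemma inalg_sum (I : Type) (r : seq I) (P : pred I) (F : I -> S) l :
  (forall i, P i -> inalg l (F i)) -> inalg l (\sum_(i <- r | P i) F i).
Proof. by move=> h; apply: big_ind => //; [apply: inalg0 | apply: inalgD]. Qed.

Lemma inalgXn l v k : inalg l v -> inalg l (v ^+ k).
Proof.
move=> hv; elim: k => [|k IH]; last by rewrite exprS; apply: inalgM.
by rewrite expr0 -(rmorph1 (@mpolyC N K)); apply: inalgC.
Qed.

Lemma inalg_mem l x : x \in l -> inalg l x.
Proof.
move=> xl; have il : (index x l < size l)%N by rewrite index_mem.
by exists 'X_(Ordinal il); rewrite evX nth_index.
Qed.

Lemma inalg_trans l l' v : (forall x, x \in l -> inalg l' x) -> inalg l v -> inalg l' v.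
Proof.
move=> h [a <-]; rewrite /ev /mmap; apply: inalg_sum => m _.
apply: inalgM; first exact: inalgC.
apply: big_ind => [||i _].
- by rewrite -(rmorph1 (@mpolyC N K)); apply: inalgC.
- exact: inalgM.
- by apply: inalgXn; apply: h; apply: mem_nth.
Qed.

Lemma inalg_sub l l' v : {subset l <= l'} -> inalg l v -> inalg l' v.
Proof. by move=> h; apply: inalg_trans => x /h; apply: inalg_mem. Qed.

End Inalg.

(* A family of forms carries the degrees explicitly, so that the zero form
   has a degree as well. *)
Definition fam (K : fieldType) N (D : nat) (E : seq (nat * {mpoly K[N]})) : Prop :=
  forall p, p \in E -> (0 < p.1 <= D)%N /\ p.2 \is p.1.-homog.

Definition gens (K : fieldType) N (E : seq (nat * {mpoly K[N]})) : seq {mpoly K[N]} :=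
  [seq p.2 | p <- E].

Definition weak (K : fieldType) N (k d : nat) (g : {mpoly K[N]}) : Prop :=
  exists ab : seq ((nat * {mpoly K[N]}) * (nat * {mpoly K[N]})),
    [/\ (size ab <= k)%N, fam d ([seq p.1 | p <- ab] ++ [seq p.2 | p <- ab]),
        (forall p, p \in ab -> (p.1.1 + p.2.1)%N = d) &
        g = \sum_(p <- ab) p.1.2 * p.2.2].

Definition lincomb (K : fieldType) N (c : nat -> K) (l : seq {mpoly K[N]}) : {mpoly K[N]} :=
  \sum_(i < size l) c i *: l`_i.

(** Zero is weak, so strength includes linear independence of the members of each degree. *)
Definition strong (K : fieldType) N (k : nat) (E : seq (nat * {mpoly K[N]})) : Prop :=
  forall d (c : nat -> K),
    (forall i, (i < size E)%N -> c i != 0 -> (nth (0%N, 0) E i).1 = d) ->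
    weak k d (lincomb c (gens E)) -> forall i, (i < size E)%N -> c i = 0.

Section Strength.
Variables (K : fieldType) (N : nat).
Local Notation S := {mpoly K[N]}.
Implicit Types (E X : seq (nat * S)).

Lemma size_gens E : size (gens E) = size E.
Proof. exact: size_map. Qed.

Lemma gens_cat E X : gens (E ++ X) = gens E ++ gens X.
Proof. exact: map_cat. Qed.

Lemma nth_gens E i : (gens E)`_i = (nth (0%N, 0) E i).2.
Proof.
have [h|h] := ltnP i (size E); first by rewrite (nth_map (0%N, 0)).
by rewrite !nth_default ?size_gens.
Qed.

Lemma fam_cat D E X : fam D (E ++ X) <-> fam D E /\ fam D X.
Proof.
split=> [h|[h1 h2] p]; last by rewrite mem_cat => /orP[/h1|/h2].
by split=> p hp; apply: h; rewrite mem_cat hp ?orbT.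
Qed.

Lemma fam_le D D' E : (D <= D')%N -> fam D E -> fam D' E.
Proof. by move=> hD h p /h[/andP[-> hp] ->]; rewrite (leq_trans hp). Qed.

Lemma fam_sub D E X : {subset E <= X} -> fam D X -> fam D E.
Proof. by move=> h hX p /h/hX. Qed.

Lemma weak_le k k' d (g : S) : (k <= k')%N -> weak k d g -> weak k' d g.
Proof. by move=> hk [ab [h1 h2 h3 h4]]; exists ab; split=> //; apply: leq_trans hk. Qed.

Lemma strong_le k k' E : (k <= k')%N -> strong k' E -> strong k E.
Proof. by move=> hk h d c hc /(weak_le hk); apply: h. Qed.

Lemma lincomb_cat (c : nat -> K) (l1 l2 : seq S) :
  lincomb c (l1 ++ l2) = lincomb c l1 + lincomb (fun i => c (size l1 + i)%N) l2.
Proof.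
rewrite /lincomb size_cat big_split_ord; congr (_ + _); apply: eq_bigr => i _ /=.
  by rewrite nth_cat ltn_ord.
by rewrite nth_cat ltnNge leq_addr /= addKn.
Qed.

Lemma inalg_lincomb (c : nat -> K) (l l' : seq S) :
  (forall x, x \in l -> inalg l' x) -> inalg l' (lincomb c l).
Proof.
by move=> h; apply: inalg_sum => i _; apply/inalgZ/h; apply: mem_nth.
Qed.

Lemma lincomb0 (c : nat -> K) (l : seq S) :
  (forall i, (i < size l)%N -> c i = 0) -> lincomb c l = 0.
Proof. by move=> h; apply: big1 => i _; rewrite h ?scale0r. Qed.

End Strength.

(** [B] is at once the size bound for [X'] and the strength demanded of the fixed family [E]. It is
    uniform in [K], in [N] and in the degrees of [E], of which only the number of members counts. *)
Definition refines_to_strong (D s n : nat) (kap : nat -> nat) (B : nat) : Prop :=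
  forall (K : fieldType) N D0 (E X : seq (nat * {mpoly K[N]})),
    fam D0 E -> fam D X -> (size E <= s)%N -> (size X <= n)%N -> strong B E ->
    exists X', [/\ fam D X', (size X' <= B)%N,
      forall p, p \in X -> inalg (gens (E ++ X')) p.2 &
      strong (kap (size (E ++ X'))) (E ++ X')].

(** A monotone majorant: the functions [kap] result from choices and need not be monotone. *)
Definition nmax (kap : nat -> nat) (b : nat) : nat := \max_(i < b.+1) kap i.

Lemma leq_nmax kap b i : (i <= b)%N -> (kap i <= nmax kap b)%N.
Proof.
by rewrite -ltnS => h; rewrite /nmax; apply: (leq_bigmax (Ordinal h)).
Qed.

(** Induction on the number [c] of members of degree [D.+1]. Once the lower part is refined, a
    failure of strength must involve a top member, or it would contradict the strength of [E ++ X1].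
    That member is a combination of the others and of products of lower forms, so the factors of
    these products replace it. *)
Lemma refine_top_degree D : (forall s n kap, exists B, refines_to_strong D s n kap B) ->
  forall c s n kap, exists B,
  forall (K : fieldType) N D0 (E Xt Xl : seq (nat * {mpoly K[N]})),
    fam D0 E -> fam D.+1 Xt -> (forall p, p \in Xt -> p.1 = D.+1) -> fam D Xl ->
    (size E <= s)%N -> (size Xt <= c)%N -> (size Xl <= n)%N -> strong B E ->
    exists X', [/\ fam D.+1 X', (size X' <= B)%N,
      forall p, p \in Xt ++ Xl -> inalg (gens (E ++ X')) p.2 &
      strong (kap (size (E ++ X'))) (E ++ X')].
Proof.
move=> rwD; elim=> [|c IH] s n kap.
  have [B hB] := rwD s n kap; exists B => K N D0 E Xt Xl fE _ _ fX sE.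
  rewrite leqn0 size_eq0 => /eqP-> sX stE.
  have [X' [h1 h2 h3 h4]] := hB K N D0 E Xl fE fX sE sX stE.
  by exists X'; split=> //; apply: fam_le h1.
(* The lower part must be strong enough for the size reached when the top members are put back. *)
pose kap' m := nmax kap (m + c.+1).
have [B1 hB1] := rwD s n kap'.
pose K2 := nmax kap (s + B1 + c.+1).
(* [K2] bounds the number of products in the weak decomposition; each product brings two factors. *)
have [B2 hB2] := IH s (B1 + (K2 + K2))%N kap.
exists (maxn (B1 + c.+1) B2) => K N D0 E Xt Xl fE fXt dXt fXl sE sXt sXl stE.
have [|X1 [f1 s1 a1 st1]] := hB1 K N D0 E Xl fE fXl sE sXl.
  by apply: strong_le stE; rewrite leq_max leq_addr.
pose F := (E ++ X1) ++ Xt.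
have sF : (size F <= s + B1 + c.+1)%N by rewrite !size_cat; lia.
have [stF|nst] := classic (strong (kap (size F)) F).
  exists (X1 ++ Xt); rewrite catA; split=> //.
  - by apply/fam_cat; split=> //; apply: fam_le f1.
  - by rewrite size_cat leq_max; apply/orP; left; lia.
  - move=> p; rewrite mem_cat => /orP[hp|/a1].
      by apply: inalg_mem; apply: map_f; rewrite mem_cat hp orbT.
    by apply: inalg_sub => x xg; rewrite gens_cat mem_cat xg.
have [d [c0 [hc [wk [i [iF ci]]]]]] : exists d (c0 : nat -> K),
    (forall i, (i < size F)%N -> c0 i != 0 -> (nth (0%N, 0) F i).1 = d) /\
    (weak (kap (size F)) d (lincomb c0 (gens F)) /\
    exists i, (i < size F)%N /\ c0 i != 0).
  apply: NNPP => hn; apply: nst => d c0 hc wk i iF; apply/eqP/negPn/negP => ci.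
  by apply: hn; exists d, c0; split=> //; split=> //; exists i.
pose g1 := size (E ++ X1).
have [j [jt cj]] : exists j, (j < size Xt)%N /\ c0 (g1 + j)%N != 0.
  apply: NNPP => hn.
  have c0t j : (j < size Xt)%N -> c0 (g1 + j)%N = 0.
    by move=> jt; apply/eqP/negPn/negP => h; apply: hn; exists j.
  have c0l : forall i, (i < g1)%N -> c0 i = 0.
    apply: (st1 d c0).
      move=> i' i'l ci'; rewrite -(hc i') //; last by rewrite size_cat; lia.
      by rewrite [in RHS]nth_cat i'l.
    apply: (@weak_le _ _ (kap (size F))).
      by apply: leq_nmax; rewrite /F [size (_ ++ Xt)]size_cat; lia.
    move: wk; rewrite /F gens_cat lincomb_cat [X in _ + X]lincomb0 ?addr0 //.
    by move=> j; rewrite size_gens => /c0t; rewrite size_gens.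
  case/negP: ci; have [/c0l->//|hi] := ltnP i g1.
  rewrite -(subnKC hi) c0t //; move: iF; rewrite /F size_cat -/g1; lia.
have dD : d = D.+1.
  rewrite -(hc (g1 + j)%N) //; last by rewrite /F size_cat -/g1 ltn_add2l.
  rewrite nth_cat -/g1 ltnNge leq_addr /= addKn; apply: dXt; exact: mem_nth.
have [ab [sab fab dab eab]] := wk; rewrite dD in fab dab.
pose Xn := [seq p.1 | p <- ab] ++ [seq p.2 | p <- ab].
have fXn : fam D Xn.
  move=> p hp; have [/andP[p0 pD] hh] := fab p hp; split=> //; rewrite p0 /=.
  move: hp; rewrite mem_cat => /orP[] /mapP[q qab e].
    have [/andP[q0 _] _] : (0 < q.2.1 <= D.+1)%N /\ q.2.2 \is q.2.1.-homog.
      by apply: fab; rewrite mem_cat (map_f snd qab) orbT.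
    by rewrite -ltnS -(dab q qab) e -[X in (X < _)%N]addn0 ltn_add2l.
  have [/andP[q0 _] _] : (0 < q.1.1 <= D.+1)%N /\ q.1.2 \is q.1.1.-homog.
    by apply: fab; rewrite mem_cat (map_f fst qab).
  by rewrite -ltnS -(dab q qab) e -[X in (X < _)%N]add0n ltn_add2r.
pose x := nth (0%N, 0) Xt j.
pose t1 := take j Xt; pose t2 := drop j.+1 Xt.
have eXt : Xt = t1 ++ x :: t2 by rewrite /t1 /t2 -drop_nth // cat_take_drop.
have t12 : {subset t1 ++ t2 <= Xt}.
  by move=> p; rewrite eXt !mem_cat inE => /orP[->|->]; rewrite ?orbT.
have kF : (kap (size F) <= K2)%N by apply: leq_nmax.
have [|||||||X2 [f2 s2 a2 st2]] := hB2 K N D0 E (t1 ++ t2) (X1 ++ Xn) fE.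
- exact: fam_sub fXt.
- by move=> p /t12/dXt.
- exact/fam_cat.
- exact: sE.
- by have := congr1 size eXt; rewrite !size_cat /=; lia.
- by rewrite !size_cat !size_map; lia.
- by apply: strong_le stE; rewrite leq_max leqnn orbT.
exists X2; split=> //; first by rewrite leq_max s2 orbT.
have aE p : p \in E -> inalg (gens (E ++ X2)) p.2.
  by move=> pE; apply: inalg_mem; apply: map_f; rewrite mem_cat pE.
have aX1 p : p \in X1 -> inalg (gens (E ++ X2)) p.2.
  by move=> pX; apply: a2; rewrite !mem_cat pX orbT.
have at12 p : p \in t1 ++ t2 -> inalg (gens (E ++ X2)) p.2.
  by move=> pX; apply: a2; rewrite mem_cat pX.
have ax : inalg (gens (E ++ X2)) x.2.
  pose cj0 := c0 (g1 + j)%N.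
  have ej : size t1 = j by rewrite size_takel // ltnW.
  have eF : lincomb c0 (gens F) = lincomb c0 (gens (E ++ X1)) +
      (lincomb (fun i => c0 (g1 + i)%N) (gens t1) +
       (cj0 *: x.2 + lincomb (fun i => c0 (g1 + (j + (1 + i)))%N) (gens t2))).
    rewrite /F gens_cat lincomb_cat eXt (gens_cat t1) (lincomb_cat _ (gens t1)).
    rewrite !size_gens -/g1 ej.
    congr (_ + (_ + _)).
    rewrite (_ : gens (x :: t2) = [:: x.2] ++ gens t2) // lincomb_cat /=; congr (_ + _).
    by rewrite /lincomb big_ord1 /= addn0.
  have -> : x.2 = cj0^-1 *: (lincomb c0 (gens F) - (lincomb c0 (gens (E ++ X1)) +
      (lincomb (fun i => c0 (g1 + i)%N) (gens t1) +
       lincomb (fun i => c0 (g1 + (j + (1 + i)))%N) (gens t2)))).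
    rewrite eF; set A := lincomb _ _; set A' := lincomb _ _; set A'' := lincomb _ _.
    have -> : A + (A' + (cj0 *: x.2 + A'')) - (A + (A' + A'')) = cj0 *: x.2 by ring.
    by rewrite scalerA mulVf // scale1r.
  apply: inalgZ; apply: inalgD; last first.
    apply: inalgN; apply: inalgD.
      apply: inalg_lincomb => y /mapP[p hp ->]; move: hp.
      by rewrite mem_cat => /orP[/aE|/aX1].
    apply: inalgD; apply: inalg_lincomb => y /mapP[p hp ->]; apply: at12;
    by rewrite mem_cat hp ?orbT.
  rewrite eab big_seq; apply: inalg_sum => p pab.
  apply: inalgM; apply: a2; rewrite !mem_cat.
    by rewrite (map_f fst pab) !orbT.
  by rewrite (map_f snd pab) !orbT.
move=> p; rewrite mem_cat eXt mem_cat inE -orbA => /or3P[pt|/orP[/eqP->//|pt]|/a1].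
- by apply: at12; rewrite mem_cat pt.
- by apply: at12; rewrite mem_cat pt orbT.
apply: inalg_trans => y /mapP[q hq ->]; move: hq.
by rewrite mem_cat => /orP[/aE|/aX1].
Qed.

Lemma refine_to_strong D s n kap : exists B, refines_to_strong D s n kap B.
Proof.
elim: D s n kap => [|D IH] s n kap.
  exists (nmax kap s) => K N D0 E X fE fX sE sX stE.
  exists [::]; rewrite cats0; split=> //.
    by move=> p /fX[]; lia.
  by apply: strong_le stE; apply: leq_nmax.
have [B hB] := refine_top_degree IH n s n kap; exists B => K N D0 E X fE fX sE sX stE.
pose P := fun p : nat * {mpoly K[N]} => p.1 == D.+1.
have sub Q : {subset filter Q X <= X} by move=> p; rewrite mem_filter => /andP[].
have [|||||||X' [h1 h2 h3 h4]] := hB K N D0 E (filter P X) (filter (predC P) X) fE.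
- exact: fam_sub fX.
- by move=> p; rewrite mem_filter => /andP[/eqP].
- move=> p; rewrite mem_filter => /andP[/= hP /fX[/andP[-> pD] ->]].
  by split=> //; rewrite -ltnS ltn_neqAle pD andbT.
- exact: sE.
- by rewrite size_filter; apply: leq_trans (count_size _ _) sX.
- by rewrite size_filter; apply: leq_trans (count_size _ _) sX.
- exact: stE.
exists X'; split=> // p pX; apply: h3.
by rewrite mem_cat !mem_filter pX !andbT /= orbN.
Qed.

(** * Hasse derivatives *)

Section Taylor.
Variables (K : fieldType) (n : nat).
Local Notation S := {mpoly K[n]}.
Implicit Types (p : S) (m : 'X_{1..n}) (i j : 'I_n).

(** The substitution of [x_j + T] for [x_j]. Its coefficients are divided derivatives, which make
    sense in every characteristic and, unlike iterated derivatives, detect p-th powers. *)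
Definition taylor j : S -> {poly S} :=
  mmap (@polyC S \o @mpolyC n K) (fun l => ('X_l)%:P + 'X *+ (l == j)).

HB.instance Definition _ j := GRing.RMorphism.copy (taylor j)
  (mmap (@polyC S \o @mpolyC n K) (fun l => ('X_l)%:P + 'X *+ (l == j))).

Definition hasse j k p : S := (taylor j p)`_k.

Lemma taylorC j (c : K) : taylor j c%:MP = (c%:MP)%:P.
Proof. exact: mmapC. Qed.

Lemma taylorXU j l : taylor j 'X_l = ('X_l)%:P + 'X *+ (l == j).
Proof. by rewrite /taylor mmapX mmap1U. Qed.

Lemma taylorX j m : taylor j 'X_[m] = \prod_l (('X_l)%:P + 'X *+ (l == j)) ^+ m l.
Proof. by rewrite /taylor mmapX. Qed.

Lemma taylor_mono j m : taylor j 'X_[m] =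
  ('X_[m - U_(j) *+ m j])%:P * (('X_j)%:P + 'X) ^+ m j.
Proof.
rewrite taylorX (bigD1 j) //= eqxx mulr1n mulrC; congr (_ * _).
rewrite [in RHS]mpolyXE_id [in RHS](bigD1 j) //= mnmBE mulmnE mnm1E eqxx mul1n subnn expr0 mul1r.
rewrite rmorph_prod; apply: eq_bigr => l nl; rewrite (negPf nl) addr0 rmorphXn.
by rewrite mnmBE mulmnE mnm1E eq_sym (negPf nl) mul0n subn0.
Qed.

Lemma hasseX j k m : hasse j k 'X_[m] = 'X_[m - U_(j) *+ k] *+ 'C(m j, k).
Proof.
rewrite /hasse taylor_mono coefCM exprDn coef_sum.
have term (i : nat) : ((('X_j)%:P ^+ (m j - i) * 'X^i *+ 'C(m j, i)) : {poly S})`_k =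
    'X_j ^+ (m j - i) *+ (k == i) *+ 'C(m j, i).
  by rewrite coefMn -rmorphXn coefCM coefXn mulr_natr.
under eq_bigr => i _ do rewrite term.
have [km|km] := ltnP (m j) k.
  rewrite bin_small // mulr0n big1 ?mulr0 // => i _.
  by rewrite gtn_eqF ?mulr0n ?mul0rn // (leq_ltn_trans _ km) // -ltnS ltn_ord.
rewrite (bigD1 (Ordinal (km : (k < (m j).+1)%N)) isT) big1; last first.
  by move=> i; rewrite eq_sym -val_eqE => /negPf /= ->; rewrite mulr0n mul0rn.
rewrite [nat_of_ord _]/= eqxx mulr1n.
rewrite /= addr0 mulrnAr; congr (_ *+ _); rewrite mpolyXn -mpolyXD; congr 'X_[_].
apply/mnmP => l; rewrite mnmDE !mnmBE !mulmnE mnm1E; case: (eqVneq j l) => [<-|_].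
  by rewrite !mul1n subnn add0n.
by rewrite !mul0n !subn0 addn0.
Qed.

Lemma hasse_sum j k (I : Type) (r : seq I) (P : pred I) (F : I -> S) :
  hasse j k (\sum_(i <- r | P i) F i) = \sum_(i <- r | P i) hasse j k (F i).
Proof. by rewrite /hasse raddf_sum coef_sum. Qed.

Lemma hasseZ j k c p : hasse j k (c *: p) = c *: hasse j k p.
Proof. by rewrite /hasse -mul_mpolyC rmorphM /= taylorC coefCM mul_mpolyC. Qed.

Lemma mcoeff_hasse j k p m :
  (hasse j k p)@_m = p@_(m + U_(j) *+ k) *+ 'C(m j + k, k).
Proof.
rewrite {1}[p]mpolyE hasse_sum raddf_sum /=.
set m1 := (m + U_(j) *+ k)%MM.
have m1j : m1 j = (m j + k)%N by rewrite mnmDE mulmnE mnm1E eqxx mul1n.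
have term m' : (hasse j k (p@_m' *: 'X_[m']))@_m = p@_m' *+ 'C(m' j, k) *+ (m' == m1).
  rewrite hasseZ hasseX mcoeffZ mcoeffMn mcoeffX.
  have [km|km] := ltnP (m' j) k; first by rewrite bin_small // !mulr0n mulr0 mul0rn.
  have -> : ((m' - U_(j) *+ k)%MM == m) = (m' == m1).
    apply/eqP/eqP => [e|->]; last by rewrite addmK.
    rewrite /m1 -e submK //; apply/mnm_lepP => l; rewrite mulmnE mnm1E.
    by case: eqP => [<-|_]; rewrite ?mul1n ?mul0n.
  by case: (m' == m1); rewrite ?mulr0n ?mul0rn ?mulr0 // mulr1n mulr_natr.
under eq_bigr => m' _ do rewrite term.
have [h|h] := boolP (m1 \in msupp p).
  rewrite (bigD1_seq m1) ?msupp_uniq //= eqxx m1j big1 ?addr0 // => m' /negPf->.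
  by rewrite mulr0n.
rewrite big1_seq; first by rewrite memN_msupp_eq0 // mul0rn.
move=> m' /andP[_ hm']; have /negPf-> : m' != m1 by apply: contraNneq h => <-.
by rewrite mulr0n.
Qed.

Lemma msupp_hasse j k p m : m \in msupp (hasse j k p) -> (m + U_(j) *+ k)%MM \in msupp p.
Proof. by rewrite !mcoeff_msupp mcoeff_hasse; apply: contraNneq => ->; rewrite mul0rn. Qed.

Lemma hasse0 j p : hasse j 0 p = p.
Proof. by apply/mpolyP => m; rewrite mcoeff_hasse bin0 mulm0n addm0. Qed.

Lemma hasse1 j p : hasse j 1 p = p^`M(j).
Proof. by apply/mpolyP => m; rewrite mcoeff_hasse bin1 mulm1n mcoeff_deriv addn1. Qed.

Lemma hasse_homog j k d p : p \is d.-homog -> hasse j k p \is (d - k).-homog.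
Proof.
move=> /dhomogP hp; apply/dhomogP => m /msupp_hasse/hp /=.
by rewrite mdegD mdegMn mdeg1 mul1n => <-; rewrite addnK.
Qed.

Lemma hasse_homog_gt j k d p : p \is d.-homog -> (d < k)%N -> hasse j k p = 0.
Proof.
move=> /dhomogP hp dk; apply/eqP; rewrite -msupp_eq0; apply/eqP.
case e : (msupp _) => [//|m s]; have : m \in msupp (hasse j k p) by rewrite e inE eqxx.
by move=> /msupp_hasse/hp /=; rewrite mdegD mdegMn mdeg1; lia.
Qed.

(** Differentiating to the full exponent gives the binomial coefficient [1], whatever the
    characteristic. *)
Lemma msupp_hasse_top j p m : m \in msupp p ->
  (hasse j (m j) p)@_(m - U_(j) *+ m j) = p@_m.
Proof.
move=> hm; rewrite mcoeff_hasse mnmBE mulmnE mnm1E eqxx mul1n subnn add0n binn.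
rewrite submK //; apply/mnm_lepP => l; rewrite mulmnE mnm1E.
by case: eqP => [<-|_]; rewrite ?mul1n ?mul0n.
Qed.

Lemma hasse_const p : (forall j k, (0 < k)%N -> hasse j k p = 0) -> p = (p@_0)%:MP.
Proof.
move=> h; apply/mpolyP => m; rewrite mcoeffC; have [->|m0] := eqVneq m 0%MM.
  by rewrite mulr1.
rewrite mulr0; apply: memN_msupp_eq0; apply: contra m0 => hm.
apply/eqP/mnmP => j; rewrite mnm0E; apply/eqP; rewrite -leqn0 leqNgt.
apply/negP => mj; have := msupp_hasse_top j hm; rewrite h // mcoeff0.
by move/esym/eqP; rewrite mcoeff_eq0 hm.
Qed.

Lemma taylor_free j p : (forall m, m \in msupp p -> m j = 0%N) -> taylor j p = p%:P.
Proof.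
move=> h; apply/polyP => k; rewrite coefC -[LHS]/(hasse j k p).
case: eqP => [->|/eqP k0]; first exact: hasse0.
apply/mpolyP => m; rewrite mcoeff_hasse mcoeff0 memN_msupp_eq0 ?mul0rn //.
by apply/negP => /h; rewrite mnmDE mulmnE mnm1E eqxx; lia.
Qed.

(* In characteristic zero [goodm m] means [m = 0]; in characteristic [p] it
   means that [p] divides all exponents. *)
Definition goodm m : bool := [forall j, (m j)%:R == 0 :> K].

Definition inT p : Prop := forall m, m \in msupp p -> goodm m.

Lemma goodmP m j : goodm m -> (m j)%:R = 0 :> K.
Proof. by move=> /forallP/(_ j)/eqP. Qed.

Lemma inT_deriv p : inT p <-> forall j, p^`M(j) = 0.
Proof.
split=> [h j|h m hm].
  apply/mpolyP => m; rewrite mcoeff_deriv mcoeff0.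
  have [hm|hm] := boolP ((m + U_(j))%MM \in msupp p); last first.
    by rewrite memN_msupp_eq0 // mul0rn.
  have /(goodmP j) := h _ hm; rewrite mnmDE mnm1E eqxx addn1 => e.
  by rewrite -mulr_natr e mulr0.
apply/forallP => j; have [->//|mj] := eqVneq (m j) 0%N.
have := congr1 (mcoeff (m - U_(j))%MM) (h j).
rewrite mcoeff_deriv mcoeff0 submK ?lep1mP // mnmBE mnm1E eqxx subn1 prednK ?lt0n //.
move/eqP; rewrite -(mulr_natr p@_m) mulf_eq0 => /orP[h0|//].
by rewrite mcoeff_eq0 hm in h0.
Qed.

Lemma inT0 : inT 0. Proof. by move=> m; rewrite msupp0. Qed.

(** In [m * 'C(m+k, k) = (m+k) * 'C(m+k-1, k)], if [m+k] is zero in [K] and the binomial on the left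
    is not, then [m] is zero in [K]. *)
Lemma inT_hasse j k p : inT p -> inT (hasse j k p).
Proof.
move=> h m; rewrite mcoeff_msupp mcoeff_hasse -mulr_natr mulf_eq0 negb_or.
rewrite -mcoeff_msupp => /andP[/h gm nb]; apply/forallP => l.
have := goodmP l gm; rewrite mnmDE mulmnE mnm1E; case: eqP => [<-|_]; last first.
  by rewrite mul0n addn0 => ->.
rewrite mul1n => e; have := congr1 (fun x : nat => x%:R : K) (mul_bin_down (m j + k) k).
rewrite addnK !natrM e mul0r => /esym/eqP.
by rewrite mulf_eq0 (negPf nb) orbF.
Qed.

Lemma inT_hasse0 j k p : k%:R != 0 :> K -> inT p -> hasse j k p = 0.
Proof.
move=> nk h; apply/mpolyP => m; rewrite mcoeff_hasse mcoeff0 -mulr_natr.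
have [hm|hm] := boolP ((m + U_(j) *+ k)%MM \in msupp p); last first.
  by rewrite memN_msupp_eq0 // mul0r.
have := goodmP j (h _ hm); rewrite mnmDE mulmnE mnm1E eqxx mul1n => e.
case: k nk hm e => [|k] nk hm e; first by rewrite eqxx in nk.
have := congr1 (fun x : nat => x%:R : K) (mul_bin_diag (m j + k.+1) k).
rewrite !natrM e mul0r => /esym/eqP; rewrite mulf_eq0 (negPf nk) /= => /eqP->.
by rewrite mulr0.
Qed.

End Taylor.

Lemma mderivXn (K : fieldType) n (j : 'I_n) (p : {mpoly K[n]}) k :
  (p ^+ k)^`M(j) = k%:R *: (p ^+ k.-1 * p^`M(j)).
Proof.
elim: k => [|k IH].
  by rewrite scale0r expr0 -(rmorph1 (@mpolyC n K)) mderivC.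
rewrite exprS mderivM IH -scalerAr mulrA -addn1 natrD scalerDl scale1r addrC.
rewrite addn1 /= [p^`M(j) * _]mulrC; congr (_ + _).
by case: k {IH} => [|k]; rewrite ?scale0r //= -exprS.
Qed.

Lemma inT_prod (K : fieldType) n (I : Type) (r : seq I) (F : I -> {mpoly K[n]}) :
  (forall i, inT (F i)) -> inT (\prod_(i <- r) F i).
Proof.
move=> h; apply: (big_ind (@inT K n)) => //.
  apply/inT_deriv => j; by rewrite -(rmorph1 (@mpolyC n K)) mderivC.
move=> p q /inT_deriv hp /inT_deriv hq; apply/inT_deriv => j.
by rewrite mderivM hp hq mul0r mulr0 addr0.
Qed.

Lemma inT_ev (K : fieldType) N (l : seq {mpoly K[N]}) (a : {mpoly K[size l]}) :
  inT a -> inT (ev l a).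
Proof.
move=> h; apply/inT_deriv => j; rewrite /ev /mmap raddf_sum /= big_seq big1 // => m hm.
rewrite mul_mpolyC mderivZ.
suff /inT_deriv-> : inT (mmap1 (fun i : 'I_(size l) => l`_i) m) by rewrite scaler0.
apply: inT_prod => i; apply/inT_deriv => j'.
by rewrite mderivXn (goodmP i (h m hm)) scale0r.
Qed.

Lemma inTB (K : fieldType) n (p q : {mpoly K[n]}) : inT p -> inT q -> inT (p - q).
Proof.
move=> hp hq m /msuppB_le; rewrite mem_cat => /orP[/hp|/hq] //.
Qed.

Lemma coefCDX (R : nzRingType) (a : R) (b : bool) k :
  (a%:P + 'X *+ b)`_k = (if k == 0%N then a else 0) + ((k == 1%N) && b)%:R.
Proof. by rewrite coefD coefC coefMn coefX; case: (k == 1%N); case: b. Qed.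

(** * Hasse derivatives and substitution *)

Section TaylorCommute.
Variables (K : fieldType) (n n' : nat) (theta : 'I_n -> {poly {mpoly K[n']}}).

Definition subst : {mpoly K[n]} -> {poly {mpoly K[n']}} :=
  mmap (@polyC _ \o @mpolyC n' K) theta.

HB.instance Definition _ := GRing.RMorphism.copy subst
  (mmap (@polyC _ \o @mpolyC n' K) theta).

Lemma substC (c : K) : subst c%:MP = (c%:MP)%:P.
Proof. exact: mmapC. Qed.

Lemma substXU l : subst 'X_l = theta l.
Proof. by rewrite /subst mmapX mmap1U. Qed.

(** A chain rule. By hypothesis, among the [theta l] that matter, the target variable [j'] occurs
    only as a summand of the constant coefficient of [theta j]. Shifting the variable then commutes
    with substituting, an identity in two auxiliary variables whose roles [swapXY] exchanges. *)
Lemma subst_hasse (j : 'I_n) (j' : 'I_n') (b : {mpoly K[n]}) :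
  (forall m, m \in msupp b -> forall l, m l != 0%N -> forall k,
     taylor j' (theta l)`_k = ((theta l)`_k)%:P + 'X *+ ((l == j) && (k == 0%N))) ->
  forall k t, (subst (hasse j k b))`_t = hasse j' k (subst b)`_t.
Proof.
move=> h.
pose P1 p := map_poly subst (taylor j p).
pose P2 p := swapXY (map_poly (taylor j') (subst p)).
suff e : P1 b = P2 b.
  move=> k t; move/(congr1 (fun u : {poly {poly {mpoly K[n']}}} => u`_k`_t)): e.
  by rewrite /P1 /P2 coef_map coef_swapXY coef_map.
have e1 : taylor j b = \sum_(m <- msupp b) ((b@_m)%:MP)%:P *
    \prod_l (('X_l)%:P + 'X *+ (l == j)) ^+ m l by [].
have e2 : subst b = \sum_(m <- msupp b) ((b@_m)%:MP)%:P * \prod_l theta l ^+ m l by [].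
rewrite /P1 /P2 e1 e2 !raddf_sum /= ?raddf_sum /= big_seq [RHS]big_seq.
apply: eq_bigr => m hm; rewrite !rmorphM /= !map_polyC /= taylorC substC.
rewrite swapXY_polyC map_polyC /=; congr (_ * _).
rewrite !rmorph_prod /= ?rmorph_prod; apply: eq_bigr => l _.
have [->|ml] := eqVneq (m l) 0%N; first by rewrite !expr0 !rmorph1.
rewrite !rmorphXn /=; congr (_ ^+ _).
rewrite rmorphD /= map_polyC /= substXU rmorphMn /= map_polyX.
apply/polyP => k; apply/polyP => t.
rewrite coef_swapXY coef_map /= (h m hm l ml) !coefCDX coefD.
case: k => [|[|k]] /=.
- by rewrite coef0.
- rewrite coef0 !add0r; case: (l == j) => /=; last exact: coef0.
  exact: coef1.
- by rewrite coef0.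
Qed.

End TaylorCommute.

(** * Weights *)

Definition wmeas n (w : 'I_n -> nat) (m : 'X_{1..n}) : nat := (\sum_i m i * w i)%N.

Fact wmeas0 n (w : 'I_n -> nat) : wmeas w 0%MM = 0%N.
Proof. by rewrite /wmeas big1 // => i _; rewrite mnm0E. Qed.

Fact wmeasD n (w : 'I_n -> nat) : {morph wmeas w : m1 m2 / (m1 + m2)%MM >-> (m1 + m2)%N}.
Proof.
by move=> m1 m2; rewrite /wmeas -big_split; apply: eq_bigr => i _; rewrite mnmDE mulnDl.
Qed.

HB.instance Definition _ n (w : 'I_n -> nat) :=
  isMeasure.Build n (wmeas w) (wmeas0 w) (wmeasD w).

Lemma wmeas_ge n (w : 'I_n -> nat) (m : 'X_{1..n}) i : (m i * w i <= wmeas w m)%N.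
Proof. by rewrite /wmeas (bigD1 i) //= leq_addr. Qed.

Lemma wmeasU n (w : 'I_n -> nat) i : wmeas w U_(i) = w i.
Proof.
rewrite /wmeas (bigD1 i) //= mnm1E eqxx mul1n big1 ?addn0 // => j /negPf nj.
by rewrite mnm1E eq_sym nj.
Qed.

Lemma wmeasMn n (w : 'I_n -> nat) (m : 'X_{1..n}) k : wmeas w (m *+ k)%MM = (wmeas w m * k)%N.
Proof.
rewrite /wmeas big_distrl; apply: eq_bigr => i _.
by rewrite mulmnE /= mulnAC.
Qed.

Section Family.
Variables (K : fieldType) (N : nat).
Implicit Types (E X : seq (nat * {mpoly K[N]})).

Definition fdeg E (i : 'I_(size (gens E))) : nat := (nth (0%N, 0) E i).1.

Definition fwt E : measure (size (gens E)) := wmeas (@fdeg E).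

Lemma fam_nth D E : fam D E -> forall i, (i < size E)%N ->
  (0 < (nth (0%N, 0%R) E i).1 <= D)%N /\ (gens E)`_i \is ((nth (0%N, 0) E i).1).-homog.
Proof. by move=> h i iE; rewrite nth_gens; apply: h; apply: mem_nth. Qed.

Lemma fdegP D E : fam D E -> forall i : 'I_(size (gens E)),
  (0 < fdeg i <= D)%N /\ (gens E)`_i \is (fdeg i).-homog.
Proof. by move=> h i; apply: (fam_nth h); rewrite -(size_gens E). Qed.

Lemma fwt_eq0 D E m : fam D E -> fwt E m = 0%N -> m = 0%MM.
Proof.
move=> h e; apply/mnmP => i; rewrite mnm0E.
have [/andP[d0 _] _] := fdegP h i; have := wmeas_ge (@fdeg E) m i.
rewrite [wmeas _ _]e; case: (m i) => // k; rewrite mulSn; lia.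
Qed.

Lemma ev_mono_homog D E m : fam D E -> ev (gens E) 'X_[m] \is (fwt E m).-homog.
Proof.
move=> h; rewrite /ev mmapX /mmap1 /fwt /= /wmeas.
apply: (big_rec2 (fun p (d : nat) => (p : {mpoly K[N]}) \is d.-homog)).
  exact: dhomog1.
move=> i p d _ hp; rewrite addnC [(d + _)%N]addnC; apply: dhomogM => //.
by rewrite mulnC; apply: dhomogMn; have [] := fdegP h i.
Qed.

Lemma ev_dfilter D E P a : fam D E ->
  dfilter mdeg P (ev (gens E) a) = ev (gens E) (dfilter (fwt E) P a).
Proof.
move=> h; rewrite [a in LHS]mpolyE raddf_sum dfilter_sum /dfilter /mfilter raddf_sum /=.
rewrite [RHS]big_mkcond /=; apply: eq_bigr => m _.
have evZ (c : K) p : ev (gens E) (c *: p) = c *: ev (gens E) p.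
  by rewrite -!mul_mpolyC rmorphM /= evC.
rewrite !evZ -/(mfilter _ _) -/(dfilter _ _ _) dfilterZ.
have /dhomogP hm := ev_mono_homog m h.
case: ifP => hP; first by rewrite dfilter_id // => m' /hm /= ->.
by rewrite dfilter_eq0 ?scaler0 // => m' /hm /= ->; rewrite hP.
Qed.

End Family.

(** Perfectness in the form used: vanishing derivatives force a constant or a proper power. The
    support clause controls the weights of the root [r] by those of [p]. *)
Definition perfect_field (K : fieldType) : Prop :=
  forall n (p : {mpoly K[n]}), inT p ->
    p = (p@_0)%:MP \/
    exists q r, [/\ (1 < q)%N, p = r ^+ q &
                    forall m, m \in msupp r -> (m *+ q)%MM \in msupp p].

(** * Criteria for weakness *)

Section Weak.
Variables (K : fieldType) (N : nat).
Local Notation S := {mpoly K[N]}.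

Lemma weak0 k d : weak k d (0 : S).
Proof. by exists [::]; split=> //; rewrite big_nil. Qed.

Lemma weakD k k' d (g g' : S) : weak k d g -> weak k' d g' -> weak (k + k') d (g + g').
Proof.
move=> [ab [s1 f1 d1 ->]] [ab' [s2 f2 d2 ->]]; exists (ab ++ ab'); split.
- by rewrite size_cat leq_add.
- move/fam_cat: f1 => [h1 h2]; move/fam_cat: f2 => [h3 h4]; rewrite !map_cat.
  by apply/fam_cat; split; apply/fam_cat.
- by move=> p; rewrite mem_cat => /orP[/d1|/d2].
- by rewrite big_cat.
Qed.

Lemma weakM d i j (u v : S) : (0 < i)%N -> (0 < j)%N -> (i + j)%N = d ->
  u \is i.-homog -> v \is j.-homog -> weak 1 d (u * v).
Proof.
move=> i0 j0 ij hu hv; exists [:: ((i, u), (j, v))]; split=> //=.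
- by move=> p; rewrite !inE => /orP[/eqP->|/eqP->] /=; split=> //; lia.
- by move=> p; rewrite inE => /eqP->.
- by rewrite big_seq1.
Qed.

Lemma weak_sum d (I : eqType) (r : seq I) (F : I -> S) :
  (forall i, i \in r -> weak 1 d (F i)) -> weak (size r) d (\sum_(i <- r) F i).
Proof.
elim: r => [|i r IH] h; first by rewrite big_nil; apply: weak0.
rewrite big_cons -[size _]/(1 + size r)%N; apply: weakD; first by apply: h; rewrite inE eqxx.
by apply: IH => l lr; apply: h; rewrite inE lr orbT.
Qed.

(** Such a form is a proper power, and [r ^+ q = r * r ^+ q.-1] is a single product of forms of
    positive degree. *)
Lemma weak_inT d (g : S) : perfect_field K -> (0 < d)%N -> g \is d.-homog ->
  inT g -> weak 1 d g.
Proof.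
move=> perf d0 hg Tg; have [e|[q [r [q1 e hr]]]] := perf _ _ Tg.
  suff -> : g = 0 by apply: weak0.
  rewrite e (dhomog_nemf_coeff hg) ?mpolyC0 //= mdeg0; lia.
have [r0|nr] := eqVneq r 0.
  by rewrite e r0 expr0n; case: q q1 {e hr} => // q _; apply: weak0.
have hd m : m \in msupp r -> (mdeg m * q)%N = d.
  by move=> /hr/(dhomogP _ _ _ hg) /=; rewrite mdegMn.
pose i := mdeg (mlead r); have id_ : (i * q)%N = d by apply: hd; apply: mlead_supp.
have hri : r \is i.-homog.
  apply/dhomogP => m /hd e'; apply/eqP; rewrite -(@eqn_pmul2r q) ?e' ?id_ //; lia.
have i0 : (0 < i)%N by move: id_; case: (i) => //; rewrite mul0n; lia.
rewrite e -(prednK (ltnW q1)) exprS; apply: (@weakM d i (i * q.-1)%N) => //.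
- by rewrite muln_gt0 i0; lia.
- by rewrite -mulnS prednK ?id_ //; lia.
- exact: dhomogMn.
Qed.

End Weak.

(** Monomials are grouped by the first variable they contain. Each group is a member of [E] times a
    form of complementary degree, positive because the variables involved have degree below [d]. *)
Lemma weak_decomposable (K : fieldType) N D (E : seq (nat * {mpoly K[N]})) d
    (b : {mpoly K[size (gens E)]}) :
  fam D E -> (0 < d)%N -> (forall m, m \in msupp b -> fwt E m = d) ->
  (forall m, m \in msupp b -> forall i, m i != 0%N -> (fdeg i < d)%N) ->
  weak (size E) d (ev (gens E) b).
Proof.
move=> fE d0 wb lb; set n := size (gens E).
pose first (m : 'X_{1..n}) := [pick i | m i != 0%N].
pose bl (i : 'I_n) : {mpoly K[n]} :=
  \sum_(m <- msupp b | first m == Some i) b@_m *: 'X_[m - U_(i)].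
have firstP m i : first m == Some i -> m i != 0%N.
  by rewrite /first; case: pickP => // j hj /eqP[<-].
have eb : b = \sum_i 'X_i * bl i.
  rewrite [LHS]mpolyE; under [RHS]eq_bigr => i _ do rewrite mulr_sumr big_mkcond.
  rewrite exchange_big /= !big_seq; apply: eq_bigr => m hm.
  have [i hi] : exists i, first m = Some i.
    rewrite /first; case: pickP => [i _|h0]; first by exists i.
    have m0 : m = 0%MM by apply/mnmP => i; rewrite mnm0E; apply/eqP/negPn; rewrite h0.
    by have := wb m hm; rewrite m0 mf0 => e; rewrite -e in d0.
  rewrite (bigD1 i) //= hi eqxx big1 ?addr0; last first.
    by move=> j nj; case: eqP => // -[e]; rewrite e eqxx in nj.
  rewrite -scalerAr -mpolyXD addmC submK // lep1mP.
  by apply: firstP; rewrite hi.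
have blP i m : m \in msupp (bl i) -> (m + U_(i))%MM \in msupp b.
  move=> /msupp_sum_le/flattenP[s /mapP[m' ]].
  rewrite mem_filter => /andP[fi hm'] -> /msuppZ_le; rewrite msuppX inE => /eqP->.
  by rewrite submK // lep1mP; apply: firstP.
rewrite eb raddf_sum /= -big_enum /=.
apply: (@weak_le _ _ (size (enum 'I_n))); first by rewrite size_enum_ord /n size_gens.
apply: weak_sum => i _; rewrite rmorphM /= evX.
have [bl0|nb] := eqVneq (bl i) 0; first by rewrite bl0 rmorph0 mulr0; apply: weak0.
have hi : (fdeg i < d)%N.
  apply: (lb _ (blP _ _ (mlead_supp nb))).
  by rewrite mnmDE mnm1E eqxx addn1.
have [/andP[i0 _] hgi] := fdegP fE i.
apply: (@weakM _ _ d (fdeg i) (d - fdeg i)%N) => //; first by rewrite subn_gt0.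
  by rewrite subnKC // ltnW.
have -> : bl i = dfilter (fwt E) (pred1 (d - fdeg i)%N) (bl i).
  rewrite dfilter_id // => m /blP/wb /=; rewrite mfD /= wmeasU => <-.
  by rewrite addnK.
by rewrite -(ev_dfilter _ _ fE); apply: dfilter_homog.
Qed.

(** * Strong families have few algebraic relations *)

(** Independence up to weight [e] modulo polynomials with vanishing derivatives. The induction on
    [e] carries this rather than the absence of relations, since the derivatives of a relation may
    vanish identically. *)
Definition diff_faithful (K : fieldType) N (E : seq (nat * {mpoly K[N]})) (e : nat) : Prop :=
  forall a, (forall m, m \in msupp a -> (fwt E m <= e)%N) ->
    inT (ev (gens E) a) -> inT a.

Lemma diff_faithful_le (K : fieldType) N (E : seq (nat * {mpoly K[N]})) e e' :
  (e' <= e)%N -> diff_faithful E e -> diff_faithful E e'.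
Proof. by move=> h u a ha; apply: u => m /ha h'; apply: leq_trans h. Qed.

Lemma mpoly_const_supp (K : fieldType) n (a : {mpoly K[n]}) :
  (forall m, m \in msupp a -> m = 0%MM) -> a = (a@_0)%:MP.
Proof.
move=> h; apply: msize1_polyC; rewrite msizeE.
by apply/bigmax_leqP_seq => m /h-> _; rewrite mdeg0.
Qed.

(** A non-constant relation has vanishing derivatives, so it is a power [r ^+ q]; as polynomials
    form a domain, [r] is again a relation, of smaller weight. *)
Lemma diff_faithful_indep (K : fieldType) N D (E : seq (nat * {mpoly K[N]})) e :
  perfect_field K -> fam D E -> diff_faithful E e ->
  forall a, (forall m, m \in msupp a -> (fwt E m <= e)%N) -> ev (gens E) a = 0 -> a = 0.
Proof.
move=> perf fE; elim/ltn_ind: e => e IH u a ha ea.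
have constP : a = (a@_0)%:MP -> a = 0.
  move=> ec; move: ea; rewrite ec evC => /eqP.
  by rewrite mpolyC_eq0 => /eqP->; rewrite mpolyC0.
have [e0|e0] := posnP e.
  apply/constP/mpoly_const_supp => m /ha; rewrite e0 leqn0 => /eqP.
  exact: (fwt_eq0 fE).
have [|/constP//|[q [r [q1 er hr]]]] := perf _ a.
  by apply: u => //; rewrite ea; apply: inT0.
have wr m : m \in msupp r -> (fwt E m < e)%N.
  move=> /hr/ha; rewrite /fwt /= wmeasMn; set x := wmeas _ _ => h.
  by case: x h => [//|x] h; nia.
suff r0 : r = 0 by rewrite er r0 expr0n; case: q q1 {er hr}.
apply: (IH e.-1); first by rewrite prednK.
- by apply: diff_faithful_le u; apply: leq_pred.
- by move=> m /wr; rewrite -{1}(prednK e0) ltnS.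
- by move: ea; rewrite er rmorphXn => /eqP; rewrite expf_eq0 => /andP[_ /eqP].
Qed.

Section PolyWeight.
Variables (K : fieldType) (n : nat) (mf : measure n).
Local Notation S := {mpoly K[n]}.

(** The auxiliary variable counts with weight one, matching the drop of degree under a Hasse
    derivative. *)
Definition pweight_le (e : nat) (P : {poly S}) : Prop :=
  forall k m, m \in msupp P`_k -> (mf m + k <= e)%N.

Lemma pweight_le_trans e e' P : (e <= e')%N -> pweight_le e P -> pweight_le e' P.
Proof. by move=> h hP k m /hP h'; apply: leq_trans h. Qed.

Lemma pweight_leC e (c : K) : pweight_le e (c%:MP)%:P.
Proof.
move=> k m; rewrite coefC; case: eqP => [->|_]; last by rewrite msupp0.
by rewrite msuppC; case: ifP => // _; rewrite inE => /eqP->; rewrite mf0.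
Qed.

Lemma pweight_leD e P Q : pweight_le e P -> pweight_le e Q -> pweight_le e (P + Q).
Proof.
by move=> hP hQ k m; rewrite coefD => /msuppD_le; rewrite mem_cat => /orP[/hP|/hQ].
Qed.

Lemma pweight_leM e e' P Q : pweight_le e P -> pweight_le e' Q -> pweight_le (e + e') (P * Q).
Proof.
move=> hP hQ k m; rewrite coefM => /msupp_sum_le/flattenP[s /mapP[i _ ->]].
move=> /msuppM_le/allpairsP[[m1 m2] /= [/hP h1 /hQ h2 ->]].
by rewrite mfD; have := ltn_ord i; lia.
Qed.

Lemma pweight_leXn e P k : pweight_le e P -> pweight_le (k * e) (P ^+ k).
Proof.
move=> hP; elim: k => [|k IH]; last by rewrite exprS mulSn; apply: pweight_leM.
by rewrite expr0 -(rmorph1 (@polyC S)) -(rmorph1 (@mpolyC n K)); apply: pweight_leC.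
Qed.

Lemma pweight_le_subst n0 (theta : 'I_n0 -> {poly S}) (w : 'I_n0 -> nat) e (b : {mpoly K[n0]}) :
  (forall l, pweight_le (w l) (theta l)) -> (forall m, m \in msupp b -> (wmeas w m <= e)%N) ->
  pweight_le e (subst theta b).
Proof.
move=> ht hb; rewrite /subst /mmap big_seq; apply: (big_ind (pweight_le e)).
- by move=> k m; rewrite coef0 msupp0.
- exact: pweight_leD.
move=> m hm; apply: (pweight_le_trans (hb m hm)); rewrite -[wmeas w m]add0n.
apply: pweight_leM; first exact: pweight_leC.
rewrite /mmap1 /wmeas; apply: (big_rec2 (fun P d => pweight_le d P)).
  by rewrite -(rmorph1 (@polyC S)) -(rmorph1 (@mpolyC n K)); apply: pweight_leC.
by move=> i d P _ hP; apply: pweight_leM => //; apply: pweight_leXn.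
Qed.

End PolyWeight.

Section Lift.
Variables (K : fieldType) (N D : nat) (E X : seq (nat * {mpoly K[N]})).
Local Notation E' := (E ++ X).
Hypothesis fE' : fam D E'.
Let fE : fam D E. Proof. by have [] := (fam_cat D E X).1 fE'. Qed.

Fact femb_subproof (l : 'I_(size (gens E))) : (l < size (gens E'))%N.
Proof. by rewrite gens_cat size_cat ltn_addr. Qed.

Definition femb (l : 'I_(size (gens E))) : 'I_(size (gens E')) :=
  Ordinal (femb_subproof l).

Lemma fdeg_femb l : fdeg (femb l) = fdeg l.
Proof. by rewrite /fdeg /= nth_cat -[size E](size_gens E) ltn_ord. Qed.

Lemma gens_femb l : (gens E')`_(femb l) = (gens E)`_l.
Proof. by rewrite /= gens_cat nth_cat ltn_ord. Qed.

Lemma femb_eq l l' : (femb l == femb l') = (l == l').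
Proof. by rewrite -!val_eqE. Qed.

Variable x : 'I_N.
Hypothesis derivs : forall l : 'I_(size (gens E)), forall k, (0 < k < fdeg l)%N ->
  inalg (gens E') (hasse x k (gens E)`_l).

(** Taylor coefficients of intermediate order are polynomials in the enlarged family by hypothesis,
    the one of order zero is the member itself, and the one of order [fdeg l] is a constant.
    Filtering by weight keeps the lift within [fdeg l]. *)
Lemma lift_taylor : exists theta : 'I_(size (gens E)) -> {poly {mpoly K[size (gens E')]}},
  forall l, [/\ map_poly (ev (gens E')) (theta l) = taylor x (gens E)`_l,
                (theta l)`_0 = 'X_(femb l) & pweight_le (fwt E') (fdeg l) (theta l)].
Proof.
have lift1 (l : 'I_(size (gens E))) (k : nat) : exists q : {mpoly K[size (gens E')]},
    [/\ ev (gens E') q = hasse x k (gens E)`_l, k = 0%N -> q = 'X_(femb l) &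
        forall m, m \in msupp q -> (fwt E' m + k <= fdeg l)%N].
  have [/andP[d0 dD] hl] := fdegP fE l.
  have [->|k0] := posnP k.
    exists 'X_(femb l); split=> //; first by rewrite evX gens_femb hasse0.
    by move=> m; rewrite msuppX inE => /eqP->; rewrite /fwt /= wmeasU fdeg_femb addn0.
  have [kd|dk] := ltnP k (fdeg l).
    have [|q hq] := @derivs l k; first by rewrite k0.
    exists (dfilter (fwt E') (pred1 (fdeg l - k)%N) q); split.
    - rewrite -(ev_dfilter _ _ fE') hq dfilter_id // => m /(dhomogP _ _ _ (hasse_homog x k hl)) /= ->.
      exact: eqxx.
    - by move=> e; rewrite e in k0.
    - by move=> m /msupp_dfilter/andP[_ /eqP->]; rewrite subnK // ltnW.
  have kc : hasse x k (gens E)`_l = ((hasse x k (gens E)`_l)@_0)%:MP.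
    apply: mpoly_const_supp => m /(dhomogP _ _ _ (hasse_homog x k hl)) /= /eqP.
    by rewrite (eqP (dk : (fdeg l - k)%N == 0%N)) mdeg_eq0 => /eqP.
  exists ((hasse x k (gens E)`_l)@_0)%:MP; split.
  - by rewrite evC -kc.
  - by move=> e; rewrite e in k0.
  move: dk; rewrite leq_eqVlt => /orP[/eqP<-|dk] m.
    by rewrite msuppC; case: ifP => // _; rewrite inE => /eqP->; rewrite mf0.
  by rewrite (hasse_homog_gt _ hl dk) mcoeff0 mpolyC0 msupp0.
pose Q l k := sval (constructive_indefinite_description _ (lift1 l k)).
have QP l k := svalP (constructive_indefinite_description _ (lift1 l k)).
exists (fun l => \poly_(k < (fdeg l).+1) Q l k) => l; have [/andP[d0 dD] hl] := fdegP fE l.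
split.
- apply/polyP => k; rewrite coef_map coef_poly /=.
  case: ltnP => kd; first by have [-> _ _] := QP l k.
  by rewrite rmorph0 -[RHS]/(hasse x k _) (hasse_homog_gt _ hl kd).
- by rewrite coef_poly /=; have [_ h _] := QP l 0%N; apply: h.
- move=> k m; rewrite coef_poly; case: ltnP => _; last by rewrite msupp0.
  by have [_ _] := QP l k; apply.
Qed.

End Lift.

Section Core.
Variables (K : fieldType) (N D e : nat) (E : seq (nat * {mpoly K[N]})).
Hypothesis perf : perfect_field K.
Hypothesis fE : fam D E.
Hypothesis uuE : diff_faithful E e.
Hypothesis enlarge : forall x : 'I_N, exists X, [/\ fam D (E ++ X), diff_faithful (E ++ X) e &
  forall l : 'I_(size (gens E)), forall k, (0 < k < fdeg l)%N ->
    inalg (gens (E ++ X)) (hasse x k (gens E)`_l)].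
Local Notation n := (size (gens E)).
Local Notation evE := (ev (gens E)).
Variable a : {mpoly K[n]}.
Hypothesis wa : forall m, m \in msupp a -> (fwt E m <= e.+1)%N.
Hypothesis Ta : inT (evE a).
Variable j : 'I_n.
Hypothesis topj : forall m, m \in msupp a -> forall l, m l != 0%N -> (fdeg l <= fdeg j)%N.

(** The Taylor expansion of [evE a] in direction [x] is lifted to the enlarged family. Its
    coefficients of positive order have weight at most [e], so by [diff_faithful] they have
    vanishing derivatives, and the one of order one is zero. Since [j] has top degree, weight
    excludes its variable from the higher Taylor coefficients of the generators, so [hasse j k]
    commutes with the lift. *)
Lemma hasse_of_hasse x k t : (0 < t)%N ->
  (k%:R != 0 :> K \/ t = 1%N) -> hasse x t (evE (hasse j k a)) = 0.
Proof.
move=> t0 kt; have [X [fE' uuE' der]] := enlarge x.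
have [theta ht] := lift_taylor fE' der.
pose sb := subst theta.
have evsb b : map_poly (ev (gens (E ++ X))) (sb b) = taylor x (evE b).
  have e1 : sb b = \sum_(m <- msupp b) ((b@_m)%:MP)%:P * \prod_l theta l ^+ m l by [].
  have e2 : evE b = \sum_(m <- msupp b) (b@_m)%:MP * \prod_(l < n) (gens E)`_l ^+ m l by [].
  rewrite e1 e2 !raddf_sum /=; apply: eq_bigr => m _.
  rewrite !rmorphM /= map_polyC /= evC taylorC !rmorph_prod; congr (_ * _).
  by apply: eq_bigr => l _; rewrite !rmorphXn /=; have [-> _ _] := ht l.
have evsbc b i : ev (gens (E ++ X)) (sb b)`_i = hasse x i (evE b).
  by rewrite /hasse -evsb coef_map.
have wsb : pweight_le (fwt (E ++ X)) e.+1 (sb a).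
  by apply: pweight_le_subst wa => l; have [] := ht l.
have wsbt i : (0 < i)%N -> forall m, m \in msupp (sb a)`_i -> (fwt (E ++ X) m <= e)%N.
  by move=> i0 m /wsb; lia.
have Tsb i : (0 < i)%N -> inT (sb a)`_i.
  by move=> i0; apply: uuE'; [apply: wsbt | rewrite evsbc; apply: inT_hasse].
have sb1 : (sb a)`_1 = 0.
  apply: (diff_faithful_indep perf fE' uuE'); first exact: wsbt.
  by rewrite evsbc hasse1; move/inT_deriv: Ta; apply.
rewrite -evsbc (@subst_hasse _ _ _ theta j (femb X j)).
  case: kt => [nk|->]; first by rewrite inT_hasse0 ?rmorph0 //; apply: Tsb.
  rewrite -[subst _ _]/(sb a) sb1 /hasse [taylor _ _]rmorph0 coef0; exact: rmorph0.
move=> m hm l ml i; have [_ h0 hw] := ht l.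
have [->|i0] := posnP i.
  by rewrite h0 taylorXU femb_eq andbT.
rewrite andbF addr0; apply: taylor_free => m' /hw h.
have := topj hm ml; have := wmeas_ge (@fdeg _ _ (E ++ X)) m' (femb X j).
rewrite fdeg_femb => h1 h2; move: h; rewrite /fwt /= => h3.
have [/andP[dj _] _] := fdegP fE j.
by case: (m' (femb X j)) h1 => // q; rewrite mulSn; lia.
Qed.

Lemma wt_hasse k m : (0 < k)%N -> m \in msupp (hasse j k a) -> (fwt E m <= e)%N.
Proof.
move=> k0 /msupp_hasse/wa; rewrite mfD /fwt /= wmeasMn wmeasU.
have [/andP[dj _] _] := fdegP fE j.
by case: k k0 => // k _; rewrite mulnS; lia.
Qed.

Lemma hasse_inT k : (0 < k)%N -> inT (hasse j k a).
Proof.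
move=> k0; apply: uuE; first by move=> m; apply: wt_hasse.
by apply/inT_deriv => x; rewrite -hasse1 hasse_of_hasse //; right.
Qed.

Lemma hasse_bad k : k%:R != 0 :> K -> exists c : K, hasse j k a = c%:MP.
Proof.
move=> nk; have k0 : (0 < k)%N by case: k nk => //; rewrite eqxx.
set g := hasse j k a.
have evc : evE g = ((evE g)@_0)%:MP.
  by apply: hasse_const => x t t0; apply: hasse_of_hasse => //; left.
exists (evE g)@_0; apply/eqP; rewrite -subr_eq0; apply/eqP.
apply: (diff_faithful_indep perf fE uuE); last by rewrite rmorphB /= evC -evc subrr.
move=> m /msuppB_le; rewrite mem_cat => /orP[|]; first exact: wt_hasse.
by rewrite msuppC; case: ifP => // _; rewrite inE => /eqP->; rewrite mf0.
Qed.

(** Let [k = m j]. The rest of [m] survives in [hasse j k a], whose exponents are zero in [K]. As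
    [m] is bad, [k] is non-zero in [K], so this derivative is constant and [m] is a power of the
    variable [j]. If [k > 1], the derivative of order [k - 1] contains that variable linearly,
    against [hasse_inT]. *)
Lemma top_monomial m : m \in msupp a -> ~~ goodm K m -> m j != 0%N -> m = U_(j)%MM.
Proof.
move=> hm bad mj; have mj0 : (0 < m j)%N by rewrite lt0n.
have top : (m - U_(j) *+ m j)%MM \in msupp (hasse j (m j) a).
  by rewrite mcoeff_msupp msupp_hasse_top // -mcoeff_msupp.
have nk : (m j)%:R != 0 :> K.
  apply: contra bad => /eqP k0; apply/forallP => l.
  have [<-|nl] := eqVneq j l; first by rewrite k0.
  have := goodmP l (hasse_inT mj0 top); rewrite mnmBE mulmnE mnm1E (negPf nl).
  by rewrite mul0n subn0 => ->.
have em : m = (U_(j) *+ m j)%MM.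
  have [c hc] := hasse_bad nk; move: top; rewrite hc msuppC; case: ifP => // _.
  rewrite inE => /eqP e0; have : (U_(j) *+ m j <= m)%MM.
    apply/mnm_lepP => l; rewrite mulmnE mnm1E.
    by case: eqP => [<-|_]; rewrite ?mul1n ?mul0n.
  by move/submK; rewrite e0 add0m.
have [mj1|mj1] := leqP (m j) 1.
  have e1 : m j = 1%N by apply/eqP; rewrite eqn_leq mj1.
  by rewrite em e1 mulm1n.
have k1 : (0 < (m j).-1)%N by lia.
have : U_(j)%MM \in msupp (hasse j (m j).-1 a).
  rewrite mcoeff_msupp mcoeff_hasse -mulmS prednK // -em mnm1E eqxx add1n prednK //.
  rewrite -[X in 'C(X, _)](prednK mj0) binSn prednK // -mulr_natr mulf_eq0 negb_or nk.
  by rewrite -mcoeff_msupp hm.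
move=> /(hasse_inT k1)/(goodmP j); rewrite mnm1E eqxx => /eqP.
by rewrite oner_eq0.
Qed.

End Core.

(** Let [d] be the largest degree of a variable of [a]. Variables of degree [d] occur only as linear
    monomials, by [top_monomial]. In degree [d] the value of this linear part is a form with
    vanishing derivatives, weak with one product, plus a form in variables of lower degree, weak
    with [size E] products; hence the strength [1 + size E]. *)
Lemma relation_trivial (K : fieldType) N D e (E : seq (nat * {mpoly K[N]})) :
  perfect_field K -> fam D E -> diff_faithful E e ->
  (forall x : 'I_N, exists X, [/\ fam D (E ++ X), diff_faithful (E ++ X) e &
    forall l : 'I_(size (gens E)), forall k, (0 < k < fdeg l)%N ->
      inalg (gens (E ++ X)) (hasse x k (gens E)`_l)]) ->
  strong (1 + size E) E ->
  forall a, (forall m, m \in msupp a -> (fwt E m <= e.+1)%N) ->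
  (forall m, m \in msupp a -> ~~ goodm K m) -> inT (ev (gens E) a) -> a = 0.
Proof.
move=> perf fE uuE enl st a wa bad Ta; apply/eqP/negPn/negP => na.
set n := size (gens E) in a wa bad Ta na *.
pose P (l : 'I_n) := has (fun m : 'X_{1..n} => m l != 0%N) (msupp a).
have [l0 Pl0] : exists l, P l.
  have hm := mlead_supp na; have := bad _ hm; rewrite negb_forall => /existsP[l hl].
  exists l; apply/hasP; exists (mlead a) => //.
  by apply: contraNneq hl => ->.
pose j := [arg max_(l > l0 | P l) fdeg l].
have [Pj jmax] : P j /\ forall l, P l -> (fdeg l <= fdeg j)%N.
  by rewrite /j; case: arg_maxnP.
set d := fdeg j in jmax.
have topd m l : m \in msupp a -> m l != 0%N -> (fdeg l <= d)%N.
  by move=> hm ml; apply: jmax; apply/hasP; exists m.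
have topm m l : m \in msupp a -> m l != 0%N -> fdeg l = d -> m = U_(l)%MM.
  move=> hm ml dl; apply: (top_monomial perf fE uuE enl wa Ta _ hm) => //.
    by move=> m' hm' l' ml'; rewrite dl; apply: topd ml'.
  exact: bad.
have aUj : a@_U_(j) != 0.
  have /hasP[m hm mj] := Pj; rewrite -mcoeff_msupp.
  by rewrite -(topm m j).
have [/andP[d0 _] _] := fdegP fE j.
pose co (i : 'I_n) : K := if fdeg i == d then a@_U_(i) else 0.
pose c (i : nat) : K := if insub i is Some o then co o else 0.
pose lin : {mpoly K[n]} := \sum_i co i *: 'X_i.
have linc m : lin@_m = \sum_i co i * (U_(i)%MM == m)%:R.
  by rewrite raddf_sum; apply: eq_bigr => i _; rewrite /= mcoeffZ mcoeffX.
have linU i : lin@_U_(i) = co i.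
  rewrite linc (bigD1 i) //= eqxx mulr1 big1 ?addr0 // => l /negPf nl.
  by rewrite eq_mnm1 nl mulr0.
have evZ (k : K) p : ev (gens E) (k *: p) = k *: ev (gens E) p.
  by rewrite -!mul_mpolyC rmorphM /= evC.
have evlin : ev (gens E) lin = lincomb c (gens E).
  rewrite raddf_sum; apply: eq_bigr => i _ /=.
  by rewrite evZ evX /c valK.
have lindeg : dfilter (fwt E) (pred1 d) lin = lin.
  apply: dfilter_id => m; rewrite mcoeff_msupp linc => nz /=; apply/negPn/negP => h.
  case/negP: nz; rewrite big1 // => i _; rewrite /co; case: eqP => [di|_]; last by rewrite mul0r.
  case: eqP => [em|_]; last by rewrite mulr0.
  by case/negP: h; rewrite -em /fwt /= wmeasU di.
pose b := dfilter (fwt E) (pred1 d) (a - lin).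
have wb : weak (size E) d (ev (gens E) (- b)).
  apply: (weak_decomposable fE d0).
    by move=> m; rewrite (perm_mem (msuppN _)) => /msupp_dfilter/andP[_ /eqP].
  move=> m; rewrite (perm_mem (msuppN _)) => /msupp_dfilter/andP[hm _] i mi.
  have hma : m \in msupp a.
    move: hm; rewrite !mcoeff_msupp mcoeffB; apply: contraNneq => am.
    rewrite am sub0r oppr_eq0 linc big1 // => l _; rewrite /co.
    case: eqP => [dl|_]; last by rewrite mul0r.
    by case: eqP => [em|_]; rewrite ?mulr0 // em am mul0r.
  rewrite ltn_neqAle (topd m) // andbT; apply/eqP => di.
  move: hm; rewrite (topm m i) // mcoeff_msupp mcoeffB linU /co di eqxx subrr.
  by rewrite eqxx.
pose G := dfilter mdeg (pred1 d) (ev (gens E) a).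
have eG : lincomb c (gens E) = G + ev (gens E) (- b).
  rewrite /G (ev_dfilter _ _ fE) rmorphN /= /b dfilterB lindeg rmorphB /= evlin.
  by rewrite subKr.
have wG : weak 1 d G.
  apply: weak_inT => //; first exact: dfilter_homog.
  by move=> m /msupp_dfilter/andP[/Ta].
have jE : (j < size E)%N by rewrite -(size_gens E).
have := st d c _ _ j jE; rewrite /c valK /co eqxx => h0.
case/eqP: aUj; apply: h0.
- move=> i iE; rewrite /c; case: insubP => [o _ eo|]; last by rewrite eqxx.
  by rewrite /co -eo; case: (fdeg o =P d) => [//|_]; rewrite eqxx.
- by rewrite -[lincomb _ _]/(lincomb c (gens E)) eG; apply: weakD.
Qed.

Lemma strong_diff_faithful D e s : exists kap, forall (K : fieldType), perfect_field K ->
  forall N (E : seq (nat * {mpoly K[N]})),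
  fam D E -> size E = s -> strong kap E -> diff_faithful E e.
Proof.
elim: e s => [|e IH] s.
  exists 0%N => K perf N E fE sE _ a wa _ m /wa; rewrite leqn0 => /eqP/(fwt_eq0 fE)->.
  by apply/forallP => i; rewrite mnm0E.
pose kf s := sval (constructive_indefinite_description _ (IH s)).
have kfP s' := svalP (constructive_indefinite_description _ (IH s')).
(* For a fixed direction, each of the [s] members has fewer than [D] intermediate Hasse derivatives.
   The final strength serves this refinement, [relation_trivial], and the induction hypothesis for
   [E] itself. *)
have [B hB] := refine_to_strong D s (s * D) kf.
exists (maxn (maxn B (1 + s)) (kf s)) => K perf N E fE sE st a wa Ta.
have uuE : diff_faithful E e.
  by apply: (kfP s K perf) => //; apply: strong_le st; rewrite leq_maxr.
have enl (x : 'I_N) : exists X, [/\ fam D (E ++ X), diff_faithful (E ++ X) e &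
    forall l : 'I_(size (gens E)), forall k, (0 < k < fdeg l)%N ->
      inalg (gens (E ++ X)) (hasse x k (gens E)`_l)].
  pose X0 := [seq ((p.1 - k)%N, hasse x k p.2) | p <- E, k <- iota 1 p.1.-1].
  have [||||X [fX sX aX stX]] := hB K N D E X0 fE.
  - move=> q /allpairsPdep[p [k [pE]]]; rewrite mem_iota => /andP[k0 kp] -> /=.
    have [/andP[p0 pD] hp] := fE p pE; split; last exact: hasse_homog.
    move: kp; rewrite add1n prednK // => kp.
    by rewrite subn_gt0 kp (leq_trans (leq_subr _ _) pD).
  - by rewrite sE.
  - rewrite size_allpairs_dep sumnE big_map.
    apply: (@leq_trans (\sum_(p <- E) D)%N); last by rewrite big_const_seq count_predT iter_addn_0 mulnC sE.
    rewrite !big_seq; apply: leq_sum => p pE; rewrite size_iota.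
    by have [/andP[_ pD] _] := fE p pE; apply: leq_trans (leq_pred _) pD.
  - by apply: strong_le st; rewrite -maxnA leq_maxl.
  have fEX : fam D (E ++ X) by apply/fam_cat.
  exists X; split=> //.
    exact: (kfP (size (E ++ X)) K perf N (E ++ X) fEX (erefl _) stX).
  move=> l k kl; have lE : (l < size E)%N by rewrite -(size_gens E).
  have -> : hasse x k (gens E)`_l = ((fdeg l - k)%N, hasse x k (gens E)`_l).2 by [].
  apply: aX; apply/allpairsPdep; exists (nth (0%N, 0) E l), k.
  have [/andP[p0 _] _] := fdegP fE l; case/andP: kl => k0 kl.
  split; first exact: mem_nth.
    by rewrite mem_iota k0 add1n (prednK p0).
  by rewrite /fdeg -nth_gens.
(* Monomials whose exponents are all zero in [K] have values with vanishing derivatives, so only the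
   remaining part of [a] is at stake. *)
pose a0 := mfilter (fun m => ~~ goodm K m) a.
have Ta0 : inT (a - a0).
  move=> m; rewrite mcoeff_msupp mcoeffB mcoeff_mfilter.
  by case: ifP => [_|/negbFE//]; rewrite subrr eqxx.
have a00 : a0 = 0.
  have sub m : m \in msupp a0 -> (m \in msupp a) && ~~ goodm K m.
    by rewrite !mcoeff_msupp mcoeff_mfilter; case: ifP; rewrite ?eqxx ?andbT.
  apply: (relation_trivial perf fE uuE enl).
  - by apply: strong_le st; rewrite sE !leq_max leqnn orbT.
  - by move=> m /sub/andP[/wa].
  - by move=> m /sub/andP[].
  - have -> : a0 = a - (a - a0) by rewrite subKr.
    by rewrite rmorphB; apply: inTB => //; apply: inT_ev.
by move: Ta0; rewrite a00 subr0.
Qed.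

Theorem strong_indep D e s : exists kap, forall (K : fieldType), perfect_field K ->
  forall N (E : seq (nat * {mpoly K[N]})), fam D E -> size E = s -> strong kap E ->
  forall a, (forall m, m \in msupp a -> (fwt E m <= e)%N) ->
  ev (gens E) a = 0 -> a = 0.
Proof.
have [kap hk] := strong_diff_faithful D e s; exists kap => K perf N E fE sE st.
by apply: (diff_faithful_indep perf fE); apply: hk.
Qed.

(** * Nonvanishing points *)

Definition infinite_field (K : fieldType) : Prop := exists f : nat -> K, injective f.

Lemma digits_inj d n (f g : nat -> nat) :
  (forall i, (f i < d)%N) -> (forall i, (g i < d)%N) ->
  (\sum_(i < n) f i * d ^ i = \sum_(i < n) g i * d ^ i)%N ->
  forall i, (i < n)%N -> f i = g i.
Proof.
elim: n f g => // n IH f g fd gd.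
have d0 : (0 < d)%N by apply: leq_trans (fd 0%N).
have expand (u : nat -> nat) : (\sum_(i < n.+1) u i * d ^ i =
    (\sum_(i < n) u i.+1 * d ^ i) * d + u 0)%N.
  rewrite big_ord_recl expn0 muln1 addnC big_distrl; congr (_ + _)%N.
  by apply: eq_bigr => i _; rewrite /= expnS mulnCA mulnC.
rewrite !expand => e.
have e0 : f 0%N = g 0%N.
  by have := congr1 (modn^~ d) e; rewrite !modnMDl !modn_small.
have es : (\sum_(i < n) f i.+1 * d ^ i = \sum_(i < n) g i.+1 * d ^ i)%N.
  by move/eqP: e; rewrite e0 eqn_add2r eqn_pmul2r // => /eqP.
by case=> [//|i] /(IH _ _ (fun i => fd i.+1) (fun i => gd i.+1) es).
Qed.

(** Kronecker substitution: [x_i = t ^ (d ^ i)] with [d] above all exponents separates monomials, so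
    [a] becomes a non-zero polynomial in [t], with finitely many roots. *)
Lemma exists_nonzero_point (K : fieldType) n (a : {mpoly K[n]}) :
  infinite_field K -> a != 0 -> exists c : 'I_n -> K, a.@[c] != 0.
Proof.
move=> [f injf] na; pose d := (msize a).+1.
pose code (m : 'X_{1..n}) := (\sum_(i < n) m i * d ^ i)%N.
have small m i : m \in msupp a -> (m i < d)%N.
  move=> /msize_mdeg_lt h; rewrite ltnS; apply: leq_trans (ltnW h).
  by rewrite mdegE (bigD1 i) //= leq_addr.
have code_inj m m' : m \in msupp a -> m' \in msupp a -> code m = code m' -> m = m'.
  move=> hm hm' e; apply/mnmP => i.
  pose ff (u : 'X_{1..n}) j := if insub j is Some o then u o else 0%N.
  have ffE (u : 'X_{1..n}) (o : 'I_n) : ff u o = u o by rewrite /ff valK.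
  have ffd u : u \in msupp a -> forall j, (ff u j < d)%N.
    by move=> hu j; rewrite /ff; case: insubP => // o _ _; apply: small.
  have := @digits_inj d n (ff m) (ff m') (ffd m hm) (ffd m' hm').
  rewrite (eq_bigr (fun i : 'I_n => m i * d ^ i)%N) => [|o _]; last by rewrite ffE.
  rewrite [X in _ = X](eq_bigr (fun i : 'I_n => m' i * d ^ i)%N) => [|o _]; last by rewrite ffE.
  by move/(_ e i (ltn_ord i)); rewrite !ffE.
pose phi := \sum_(m <- msupp a) a@_m *: 'X^(code m) : {poly K}.
have nphi : phi != 0.
  apply/eqP => /(congr1 (fun p : {poly K} => p`_(code (mlead a)))).
  have hl := mlead_supp na; rewrite coef0 coef_sum (bigD1_seq _ hl) ?msupp_uniq //=.
  rewrite coefZ coefXn eqxx mulr1 big1_seq ?addr0.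
    by move/eqP; rewrite mleadc_eq0 (negPf na).
  move=> m /andP[nm hm]; rewrite coefZ coefXn; case: eqP => [e|_]; last by rewrite mulr0.
  by rewrite (code_inj _ _ hl hm e) eqxx in nm.
pose rs := [seq f i | i <- iota 0 (size phi)].
have [x _ nx] : exists2 x, x \in rs & ~~ root phi x.
  apply/allPn; apply/negP => allr.
  have := max_poly_roots nphi allr; rewrite map_inj_uniq ?iota_uniq // => /(_ isT).
  by rewrite size_map size_iota ltnn.
exists (fun i => x ^+ (d ^ i)); apply: contra nx => /eqP e; apply/rootP.
rewrite -[RHS]e mevalE horner_sum; apply: eq_bigr => m _.
rewrite hornerZ hornerXn; congr (_ * _); rewrite /code.
elim/big_rec2: _ => [|i y1 y2 _ <-]; first by rewrite expr0.
by rewrite exprD mulnC exprM.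
Qed.

(** * Congruences and ideals of variables *)

Lemma mmap_congr (K : comNzRingType) n (R : comNzRingType) (g : {rmorphism K -> R})
    (u v : 'I_n -> R) (l : seq R) (a : {mpoly K[n]}) :
  (forall i, idl l (u i - v i)) -> idl l (mmap g u a - mmap g v a).
Proof.
move=> h; rewrite /mmap -sumrB; apply: idl_sum => m _; rewrite -mulrBr; apply: idlM.
rewrite /mmap1; elim/big_rec2: _ => [|i y1 y2 _ hy]; first by rewrite subrr; apply: idl0.
have hX k : idl l (u i ^+ k - v i ^+ k).
  by rewrite subrXX mulrC; apply: idlM.
have -> : u i ^+ m i * y2 - v i ^+ m i * y1 =
    u i ^+ m i * (y2 - y1) + y1 * (u i ^+ m i - v i ^+ m i) by ring.
by apply: idlD; apply: idlM.
Qed.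

Lemma idl_vars (K : fieldType) n (s : seq 'I_n) (v : {mpoly K[n]}) :
  idl [seq 'X_i | i <- s] v <->
  forall m, m \in msupp v -> exists2 i, i \in s & m i != 0%N.
Proof.
split.
  elim: s v => /= [v ->|i s IH v [c /IH hc] m hm]; first by move=> m; rewrite msupp0.
  have [h|h] := boolP (m \in msupp (v - c * 'X_i)).
    by have [l ls ml] := hc m h; exists l => //; rewrite inE ls orbT.
  have : m \in msupp (c * 'X_i).
    move: hm h; rewrite !mcoeff_msupp negbK mcoeffB => hm; rewrite subr_eq0.
    by move=> /eqP <-.
  rewrite (perm_mem (msuppMX _ _)) => /mapP[m' _ ->]; exists i.
    by rewrite inE eqxx.
  by rewrite mnmDE mnm1E eqxx.
move=> h; rewrite [v]mpolyE big_seq; apply: idl_sum => m /h[i is_ mi].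
rewrite -(submK (m := U_(i)%MM) (m' := m)) ?lep1mP // mpolyXD -mul_mpolyC mulrA.
by apply: idlM; apply: idl_mem; apply: map_f.
Qed.

Lemma reg_vars (K : fieldType) n (s : seq 'I_n) : uniq s ->
  reg [seq ('X_i : {mpoly K[n]}) | i <- s].
Proof.
elim: s => //= i s IH /andP[is_ us]; split; first exact: IH.
move=> v /idl_vars h; apply/idl_vars => m hm.
have [|l ls ml] := h (U_(i) + m)%MM.
  by rewrite mulrC (perm_mem (msuppMX _ _)) map_f.
exists l => //; move: ml; rewrite mnmDE mnm1E.
by have /negPf-> : i != l by apply: contraNneq is_ => ->.
Qed.

(** * Linear systems of parameters *)

Definition spn (K : fieldType) N (L : seq {mpoly K[N]}) (v : {mpoly K[N]}) : Prop :=
  exists c : nat -> K, v = lincomb c L.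

Section Span.
Variables (K : fieldType) (N : nat).
Local Notation S := {mpoly K[N]}.
Implicit Types (L : seq S) (u v : S).

Lemma spn0 L : spn L 0.
Proof. by exists (fun=> 0); rewrite lincomb0. Qed.

Lemma spnD L u v : spn L u -> spn L v -> spn L (u + v).
Proof.
move=> [c ->] [c' ->]; exists (fun i => c i + c' i); rewrite /lincomb -big_split.
by apply: eq_bigr => i _; rewrite scalerDl.
Qed.

Lemma spnZ L (a : K) v : spn L v -> spn L (a *: v).
Proof.
move=> [c ->]; exists (fun i => a * c i); rewrite /lincomb scaler_sumr.
by apply: eq_bigr => i _; rewrite scalerA.
Qed.

Lemma spn_mem L v : v \in L -> spn L v.
Proof.
move=> vL; have iL : (index v L < size L)%N by rewrite index_mem.
exists (fun i => (i == index v L)%:R); rewrite /lincomb (bigD1 (Ordinal iL)) //= eqxx.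
rewrite scale1r nth_index // big1 ?addr0 // => i; rewrite -val_eqE /= => /negPf->.
by rewrite scale0r.
Qed.

Lemma spn_sum L (I : Type) (r : seq I) (P : pred I) (F : I -> S) :
  (forall i, P i -> spn L (F i)) -> spn L (\sum_(i <- r | P i) F i).
Proof. by move=> h; apply: big_ind => //; [apply: spn0 | apply: spnD]. Qed.

Lemma spn_mul L L' v x : (forall u, u \in L -> spn L' (u * x)) -> spn L v -> spn L' (v * x).
Proof.
move=> h [c ->]; rewrite /lincomb mulr_suml; apply: spn_sum => i _.
by rewrite -scalerAl; apply/spnZ/h/mem_nth.
Qed.

End Span.

(* [ls] are linear forms completing [fs] to a homogeneous regular sequence of
   parameters, and [us] spans the finite-dimensional quotient. *)
Record sop (K : fieldType) N (fs ls us : seq {mpoly K[N]}) : Prop := Sop {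
  sop_fs : posforms fs;
  sop_ls : forall x, x \in ls -> x \is 1.-homog;
  sop_us : forall u, u \in us -> exists d, u \is d.-homog;
  sop_reg : reg (ls ++ fs);
  sop_span : forall v, exists2 s, spn us s & idl (ls ++ fs) (v - s) }.

Lemma sop_init (K : fieldType) N : sop [::] [seq ('X_i : {mpoly K[N]}) | i <- enum 'I_N] [:: 1].
Proof.
split=> //.
- by move=> x /mapP[i _ ->]; rewrite dhomogX /= mdeg1.
- by move=> u; rewrite inE => /eqP->; exists 0%N; apply: dhomog1.
- by rewrite cats0; apply: reg_vars; apply: enum_uniq.
- move=> v; exists (v@_0 *: 1); first by apply: spnZ; apply: spn_mem; rewrite inE eqxx.
  rewrite cats0; apply/idl_vars => m; rewrite mcoeff_msupp mcoeffB mcoeffZ mcoeff1.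
  have [->|m0 _] := eqVneq m 0%MM; first by rewrite mulr1 subrr eqxx.
  apply: NNPP => hn; case/eqP: m0; apply/mnmP => i; rewrite mnm0E.
  by apply/eqP/negPn/negP => mi; apply: hn; exists i; rewrite ?mem_enum.
Qed.

Section SopFacts.
Variables (K : fieldType) (N : nat) (fs ls us : seq {mpoly K[N]}).
Local Notation S := {mpoly K[N]}.
Hypothesis sp : sop fs ls us.

Lemma posform_lin (x : S) : x \is 1.-homog -> posform x.
Proof. by exists 1%N. Qed.

Lemma sop_posforms : posforms (ls ++ fs).
Proof.
move=> x; rewrite mem_cat => /orP[/(sop_ls sp)/posform_lin//|]; exact: (sop_fs sp).
Qed.

Lemma one_notin (l : seq S) : posforms l -> ~ idl l 1.
Proof.
move=> pl h; have [|c [e hc]] := idl_bounded (b := 0%N) pl h; first by rewrite msize1.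
have := oner_neq0 S; rewrite e big1 ?eqxx // => i _.
have /eqP : msize (c i) = 0%N by apply/eqP; rewrite -leqn0.
by rewrite msize_poly_eq0 => /eqP->; rewrite mul0r.
Qed.

Lemma ev_lin_dfilter P (a : {mpoly K[size ls]}) :
  dfilter mdeg P (ev ls a) = ev ls (dfilter mdeg P a).
Proof.
have lin := sop_ls sp.
rewrite [a in LHS]mpolyE raddf_sum dfilter_sum /dfilter /mfilter raddf_sum /=.
rewrite [RHS]big_mkcond /=; apply: eq_bigr => m _.
have evZ (c : K) p : ev ls (c *: p) = c *: ev ls p.
  by rewrite -!mul_mpolyC rmorphM /= evC.
rewrite !evZ -/(mfilter _ _) -/(dfilter _ _ _) dfilterZ.
have /dhomogP hm : ev ls 'X_[m] \is (mdeg m).-homog.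
  rewrite /ev mmapX /mmap1 mdegE.
  apply: (big_rec2 (fun p (d : nat) => (p : S) \is d.-homog)); first exact: dhomog1.
  move=> i p d _ hp; rewrite addnC [(d + _)%N]addnC; apply: dhomogM => //.
  by have := dhomogMn (m i) (lin _ (mem_nth 0 (ltn_ord i))); rewrite mul1n.
case: ifP => hP; first by rewrite dfilter_id // => m' /hm /= ->.
by rewrite dfilter_eq0 ?scaler0 // => m' /hm /= ->; rewrite hP.
Qed.

Lemma idl_cat (l l' : seq S) v : idl (l ++ l') v ->
  exists c : nat -> S, idl l' (v - \sum_(i < size l) c i * l`_i).
Proof.
elim: l v => /= [v h|x l IH v [c /IH[e he]]].
  by exists (fun=> 0); rewrite big_ord0 subr0.
exists (fun i => if i is j.+1 then e j else c).
by rewrite big_ord_recl /= opprD addrA.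
Qed.

Lemma dfilter_homog_eq d k (u : S) : u \is d.-homog ->
  dfilter mdeg (pred1 k) u = if d == k then u else 0.
Proof.
move=> /dhomogP hu; case: eqP => [<-|/eqP nk].
  by rewrite dfilter_id // => m /hu /= ->.
by rewrite dfilter_eq0 // => m /hu /= ->.
Qed.

Lemma spn_dfilter k v : spn us v -> spn us (dfilter mdeg (pred1 k) v).
Proof.
move=> [c ->]; rewrite /lincomb dfilter_sum; apply: spn_sum => i _; rewrite dfilterZ.
apply: spnZ; have ui : us`_i \in us by apply: mem_nth.
have [d hd] := sop_us sp ui; rewrite (dfilter_homog_eq k hd).
by case: eqP => _; [apply: spn_mem | apply: spn0].
Qed.

Definition gen_by (v : S) : Prop :=
  exists p : 'I_(size us) -> {mpoly K[size ls]}, idl fs (v - \sum_k ev ls (p k) * us`_k).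

Lemma gen_byD u v : gen_by u -> gen_by v -> gen_by (u + v).
Proof.
move=> [p hp] [q hq]; exists (fun k => p k + q k).
under eq_bigr => k _ do rewrite rmorphD /= mulrDl.
rewrite big_split /=; set A := \sum_k _; set B := \sum_k _.
have -> : u + v - (A + B) = (u - A) + (v - B) by ring.
exact: idlD.
Qed.

Lemma gen_by_mul v (a : {mpoly K[size ls]}) : gen_by v -> gen_by (ev ls a * v).
Proof.
move=> [p hp]; exists (fun k => a * p k).
under eq_bigr => k _ do rewrite rmorphM /= -mulrA.
by rewrite -mulr_sumr -mulrBr; apply: idlM.
Qed.

Lemma gen_by_idl v : idl fs v -> gen_by v.
Proof.
move=> h; exists (fun=> 0); rewrite big1 ?subr0 // => k _.
by rewrite rmorph0 mul0r.
Qed.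

Lemma gen_by_spn v : spn us v -> gen_by v.
Proof.
move=> [c ->]; exists (fun k => (c k)%:MP); rewrite (_ : \sum_k _ = lincomb c us).
  by rewrite subrr; apply: idl0.
by apply: eq_bigr => k _; rewrite evC mul_mpolyC.
Qed.

Lemma gen_by_sum (I : Type) (r : seq I) (P : pred I) (F : I -> S) :
  (forall i, P i -> gen_by (F i)) -> gen_by (\sum_(i <- r | P i) F i).
Proof.
move=> h; apply: big_ind => //; last exact: gen_byD.
by apply: gen_by_idl; apply: idl0.
Qed.

(* graded Nakayama *)
Lemma sop_gen v : gen_by v.
Proof.
rewrite (@sum_dfilter _ _ mdeg (msize v) v); last by move=> m; apply: msize_mdeg_lt.
apply: gen_by_sum => k _; move: (dfilter_homog mdeg k v).
elim/ltn_ind: (k : nat) (dfilter mdeg (pred1 (k : nat)) v) => {k} {}k IH {}v hv.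
have [s0 sps hs0] := sop_span sp v.
pose s := dfilter mdeg (pred1 k) s0.
have hs : idl (ls ++ fs) (v - s).
  have -> : v = dfilter mdeg (pred1 k) v by rewrite (dfilter_homog_eq k hv) eqxx.
  by rewrite -dfilterB; apply: idl_dfilter => //; apply: sop_posforms.
have [c hc] := idl_cat hs.
have hvs : dfilter mdeg (pred1 k) (v - s) = v - s.
  rewrite dfilterB (dfilter_homog_eq k hv) eqxx.
  by rewrite (dfilter_homog_eq k (dfilter_homog mdeg k s0)) eqxx.
pose c' i := dfilter mdeg (fun j => pred1 k (j + 1)%N) (c i).
have hc' : idl fs (v - s - \sum_(i < size ls) c' i * ls`_i).
  have := idl_dfilter (pred1 k) (sop_fs sp) hc.
  rewrite dfilterB hvs dfilter_sum; under eq_bigr => i _.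
    rewrite (dfilterM (pred1 k) (c i) (sop_ls sp (mem_nth 0 (ltn_ord i)))); over.
  by [].
have -> : v = s + (\sum_(i < size ls) c' i * ls`_i +
    (v - s - \sum_(i < size ls) c' i * ls`_i)) by rewrite [X in s + X]addrC subrK addrC subrK.
apply: gen_byD; first by apply: gen_by_spn; apply: spn_dfilter.
apply: gen_byD; last exact: gen_by_idl.
apply: gen_by_sum => i _; rewrite mulrC -(evX i); apply: gen_by_mul.
have [k0|k0] := posnP k.
  rewrite /c' dfilter_eq0; first by apply: gen_by_idl; apply: idl0.
  by move=> m _ /=; rewrite k0 addn1.
apply: (IH k.-1); first by rewrite prednK.
by rewrite -subn1; apply: dfilter_shift_homog.
Qed.

End SopFacts.

Lemma exists_min (P : nat -> Prop) : (exists k, P k) ->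
  exists k, P k /\ forall i, (i < k)%N -> ~ P i.
Proof.
move=> [k]; elim/ltn_ind: k => k IH Pk.
have [[i [ik Pi]]|hn] := classic (exists i, (i < k)%N /\ P i); first exact: IH Pi.
by exists k; split=> // i ik Pi; apply: hn; exists i.
Qed.

Section SopStep.
Variables (K : fieldType) (N : nat) (fs ls us : seq {mpoly K[N]}).
Local Notation S := {mpoly K[N]}.
Local Notation A := {mpoly K[size ls]}.
Hypothesis sp : sop fs ls us.
Variables (f : S) (d : nat).
Hypothesis d0 : (0 < d)%N.
Hypothesis hf : f \is d.-homog.

(* a homogeneous integral equation of degree [k] for [f] over [K[ls]] modulo [fs] *)
Definition intrel (k : nat) : Prop := exists a : nat -> A,
  [/\ forall i, a i \is (d * i).-homog, a 0%N = 1 &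
      idl fs (\sum_(i < k.+1) ev ls (a i) * f ^+ (k - i))].

(** Determinant trick: multiplication by [f] on the generators [us] has a matrix [M] over [K[ls]],
    and the adjugate shows that [det (f - M)] kills each generator, hence [1], modulo [fs]. Its
    component of degree [d * size us] is the homogeneous equation. *)
Lemma intrel_exists : intrel (size us).
Proof.
set t := size us.
have /fin_all_exists[M hM] := fun k : 'I_t => sop_gen sp (f * us`_k).
have [p1 hp1] := sop_gen sp 1.
pose MM : 'M[A]_t := \matrix_(k, l) M k l.
pose h : {poly A} -> S := horner_eval f \o map_poly (ev ls).
pose hR : {rmorphism {poly A} -> S} := h.
pose B : 'M[S]_t := map_mx hR (char_poly_mx MM).
have BE k l : B k l = f *+ (k == l) - ev ls (M k l).
  rewrite !mxE /= /h /= /horner_eval rmorphB rmorphMn /= map_polyX map_polyC /=.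
  by rewrite hornerD hornerN hornerC hornerMn hornerX.
pose u : 'cV[S]_t := \col_k us`_k.
have Bu k : idl fs ((B *m u) k 0).
  rewrite mxE (_ : \sum_l _ = f * us`_k - \sum_l ev ls (M k l) * us`_l); first exact: hM.
  under eq_bigr => l _ do rewrite BE mxE mulrBl.
  rewrite sumrB; congr (_ - _); rewrite (bigD1 k) //= eqxx big1 ?addr0 // => l nl.
  by rewrite eq_sym (negPf nl) mul0r.
have detu (k : 'I_t) : idl fs (\det B * us`_k).
  have -> : \det B * us`_k = (\adj B *m (B *m u)) k 0.
    by rewrite mulmxA mul_adj_mx mul_scalar_mx !mxE.
  by rewrite mxE; apply: idl_sum => l _; apply: idlM.
have detI : idl fs (\det B).
  rewrite -[\det B]mulr1 -[1](subrK (\sum_k ev ls (p1 k) * us`_k)) mulrDr.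
  apply: idlD; first exact: idlM.
  by rewrite mulr_sumr; apply: idl_sum => k _; rewrite mulrCA; apply: idlM.
pose q := char_poly MM.
have eq_ : \det B = \sum_(i < t.+1) ev ls q`_(t - i) * f ^+ (t - i).
  rewrite /B det_map_mx -/(char_poly MM) -/q /hR /= /h /= /horner_eval.
  rewrite (@horner_coef_wide _ t.+1) ?size_map_poly; last first.
    apply: leq_trans (size_poly _ _) _; by rewrite size_char_poly.
  rewrite (reindex_inj rev_ord_inj) /=; apply: eq_bigr => i _.
  by rewrite coef_map subSS.
pose a i : A := if (i <= t)%N then
  dfilter mdeg (fun j => pred1 (d * t)%N (j + d * (t - i))%N) q`_(t - i) else 0.
exists a; split.
- move=> i; rewrite /a; case: leqP => it; last exact: dhomog0.
  have := @dfilter_shift_homog _ _ mdeg (d * t) (d * (t - i)) q`_(t - i).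
  by rewrite -mulnBr subKn.
- rewrite /a leq0n subn0.
  have -> : q`_t = 1.
    by have := char_poly_monic MM; rewrite monicE lead_coefE size_char_poly => /eqP.
  rewrite dfilter_id // => m; rewrite msupp1 inE => /eqP-> /=.
  by rewrite mdeg0 add0n.
- have := idl_dfilter (pred1 (d * t)%N) (sop_fs sp) detI.
  rewrite eq_ dfilter_sum; congr (idl fs _); apply: eq_bigr => i _.
  rewrite (dfilterM (pred1 (d * t)%N) _ (dhomogMn (t - i) hf)) (ev_lin_dfilter sp).
  by rewrite /a -ltnS ltn_ord.
Qed.

Lemma size_us_gt0 : (0 < size us)%N.
Proof.
rewrite lt0n; apply/eqP => /size0nil e; have [s [c es] h] := sop_span sp 1.
apply: (one_notin (sop_posforms sp)); rewrite -[1]subr0.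
by move: h; rewrite es e /lincomb big_ord0.
Qed.

Lemma sop_dichotomy :
  (exists h k, [/\ (0 < k <= size us)%N, h \is (d * k.-1).-homog, ~ idl fs h & idl fs (f * h)])
  \/ exists k (a : A) g, [/\ (0 < k <= size us)%N, a \is (d * k).-homog, a != 0 &
                             idl fs (f * g + ev ls a)].
Proof.
have [k [[k0 rk] kmin]] : exists k, ((0 < k)%N /\ intrel k) /\
    forall i, (i < k)%N -> ~ ((0 < i)%N /\ intrel i).
  apply: exists_min; exists (size us); split; first exact: size_us_gt0.
  exact: intrel_exists.
have kt : (k <= size us)%N.
  rewrite leqNgt; apply/negP => h; apply: (kmin _ h); split; first exact: size_us_gt0.
  exact: intrel_exists.
have [a [ha a0 ra]] := rk.
pose g := \sum_(i < k) ev ls (a i) * f ^+ (k.-1 - i).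
have eg : \sum_(i < k.+1) ev ls (a i) * f ^+ (k - i) = f * g + ev ls (a k).
  rewrite big_ord_recr /= subnn expr0 mulr1; congr (_ + _); rewrite mulr_sumr.
  apply: eq_bigr => i _; rewrite mulrCA -exprS; congr (_ * _ ^+ _).
  by have := ltn_ord i; lia.
(* If the constant term vanishes, [g] is the witness. Were [g] in the ideal, it would be an equation
   of degree [k - 1], against minimality, or the constant [1] when [k = 1]. *)
rewrite eg in ra; have [ak|ak] := eqVneq (a k) 0; last first.
  by right; exists k, (a k), g; split; rewrite ?k0.
left; exists g, k; split; first by rewrite k0.
- rewrite /g; apply: rpred_sum => i _.
  have hev : ev ls (a i) \is (d * i).-homog.
    rewrite -[a i](@dfilter_id _ _ mdeg (pred1 (d * i)%N)) -?(ev_lin_dfilter sp).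
      exact: dfilter_homog.
    by move=> m /(dhomogP _ _ _ (ha i)) /= ->.
  have := dhomogM hev (dhomogMn (k.-1 - i) hf); rewrite -mulnDr subnKC //.
  by have := ltn_ord i; lia.
- move=> hg; have [k1|k1] := leqP k 1.
    have ek : k = 1%N by apply/eqP; rewrite eqn_leq k1.
    apply: (one_notin (sop_fs sp)); move: hg; rewrite /g ek big_ord1 a0 rmorph1.
    by rewrite expr0 mulr1.
  apply: (kmin k.-1); first by rewrite prednK.
  split; first by lia.
  by exists a; split=> //; rewrite prednK.
- by move: ra; rewrite ak rmorph0 addr0.
Qed.

Lemma reg_modify (L L' base : seq S) : size L = size L' ->
  (forall i, (i < size L)%N -> idl base (L`_i - L'`_i)) ->
  reg (L ++ base) -> reg (L' ++ base) /\ forall v, idl (L ++ base) v <-> idl (L' ++ base) v.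
Proof.
elim: L L' => [|x L IH] [|x' L'] //= [es] h [r nz].
have [|r' e] := IH L' es _ r; first by move=> i iL; apply: (h i.+1).
have hx : idl (L ++ base) (x - x').
  by apply: idl_sub (h 0%N _) => // z zb; rewrite mem_cat zb orbT.
split; first split=> //.
  move=> v /e hv; apply/e/nz; rewrite -[x](subrK x') mulrDl.
  by apply: idlD => //; rewrite mulrC; apply: idlM.
move=> v; split=> -[c hc]; exists c.
  apply/e; have -> : v - c * x' = v - c * x + c * (x - x') by ring.
  by apply: idlD => //; apply: idlM.
move/e: hc => hc; have -> : v - c * x = v - c * x' - c * (x - x') by ring.
by apply: idlB => //; apply: idlM.
Qed.

(** At a point [c] with [a(c)] and [c j] non-zero, subtracting multiples of [x = ls_j] from the
    other parameters turns [a] into [gam x^(d k)] modulo the new [ls'], with [gam] non-zero. There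
    [f g] is [-gam x^(d k)], so [f] is a nonzerodivisor because [x] is, and the products [u x^i]
    with [i < d k] span the new quotient, whence its size. *)
Lemma sop_extend k (a : A) g : infinite_field K ->
  (0 < k <= size us)%N -> a \is (d * k).-homog -> a != 0 -> idl fs (f * g + ev ls a) ->
  exists ls' us', sop (f :: fs) ls' us' /\ (size us' <= size us * (size us * d))%N.
Proof.
move=> inf /andP[k0 kt] ha na rg; have [c hc] := exists_nonzero_point inf na.
set D0 := (d * k)%N in ha; have D00 : (0 < D0)%N by rewrite muln_gt0 d0.
have [j cj] : exists j, c j != 0.
  apply: NNPP => hn; case/negP: hc; rewrite mevalE big1_seq // => m /andP[_ hm].
  have : mdeg m = D0 by apply: (dhomogP _ _ _ ha).
  have [->|m0 _] := eqVneq m 0%MM; first by rewrite mdeg0 => e; rewrite -e in D00.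
  have [i mi] : exists i, m i != 0%N.
    apply: NNPP => hi; case/eqP: m0; apply/mnmP => i; rewrite mnm0E.
    by apply/eqP/negPn/negP => mi; apply: hi; exists i.
  rewrite (bigD1 i) //= (_ : c i = 0) ?expr0n ?(negPf mi) ?mul0r ?mulr0 //.
  by apply/eqP/negPn/negP => ci; apply: hn; exists i.
pose x := ls`_j; have xl : x \in ls by apply: mem_nth.
pose e (i : nat) : K := if insub i is Some o then c o / c j else 0.
pose mk (y : S) i := y - (e i)%:MP * x.
pose l1 := take j ls; pose l2 := drop j.+1 ls.
have els : ls = l1 ++ x :: l2 by rewrite /l1 /l2 -drop_nth // cat_take_drop.
have sl1 : size l1 = j by rewrite size_takel // ltnW.
pose l1' := [seq mk ls`_i i | i <- iota 0 j].
pose l2' := [seq mk ls`_i i | i <- iota j.+1 (size ls - j.+1)].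
pose ls' := l1' ++ l2'.
have linx : x \is 1.-homog by apply: (sop_ls sp).
have lin1 i : (i < size ls)%N -> mk ls`_i i \is 1.-homog.
  move=> il; rewrite /mk mul_mpolyC; apply: rpredB; last exact: rpredZ.
  by apply: (sop_ls sp); apply: mem_nth.
have lls' y : y \in ls' -> y \is 1.-homog.
  rewrite mem_cat => /orP[] /mapP[i]; rewrite mem_iota => hi ->; apply: lin1.
    by apply: ltn_trans (ltn_ord j); case/andP: hi.
  by have := ltn_ord j; lia.
have memls' (i : 'I_(size ls)) : i != j -> mk ls`_i i \in ls'.
  move=> nij; rewrite mem_cat; apply/orP.
  have [ij|ij] := ltnP i j; [left|right]; apply: (map_f (fun i => mk ls`_i i)).
    by rewrite mem_iota.
  by rewrite mem_iota; have := ltn_ord i; have := ltn_ord j; rewrite -val_eqE /= in nij; lia.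
have pfs := sop_fs sp; have px : posform x := posform_lin linx.
have pf : posform f by exists d.
have pls' y : y \in ls' -> posform y by move=> /lls'/posform_lin.
have pls y : y \in ls -> posform y by move=> /(sop_ls sp)/posform_lin.
have pcat (L : seq S) z : posform z -> (forall y, y \in L -> posform y) -> posforms (z :: L ++ fs).
  by move=> hz hL y; rewrite inE mem_cat => /or3P[/eqP->|/hL|/pfs].
have sub12 y : y \in l1 ++ l2 -> y \in ls.
  by rewrite els !mem_cat inE => /orP[->|->]; rewrite ?orbT.
have r1 : reg ((l1 ++ l2) ++ x :: fs).
  have := sop_reg sp; rewrite els -catA cat_cons => /reg_move r.
  apply/reg_move; first by apply: pcat => // y /sub12/pls.
  by rewrite -catA; apply: r; rewrite catA; apply: pcat => // y /sub12/pls.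
have [r2 _] : reg (ls' ++ x :: fs) /\
    forall v, idl ((l1 ++ l2) ++ x :: fs) v <-> idl (ls' ++ x :: fs) v.
  apply: (reg_modify _ _ r1).
    by rewrite !size_cat !size_map !size_iota sl1 size_drop.
  move=> i; rewrite size_cat sl1 size_drop => il.
  suff [i' ->] : exists i', (l1 ++ l2)`_i - ls'`_i = (e i')%:MP * x.
    by apply/idlM/idl_mem; rewrite inE eqxx.
  rewrite !nth_cat sl1 size_map size_iota; case: ltnP => ij.
    exists i; rewrite (nth_map 0%N) ?size_iota // nth_iota // add0n nth_take //.
    by rewrite /mk subKr.
  exists (j.+1 + (i - j))%N; rewrite nth_drop (nth_map 0%N) ?size_iota; last by lia.
  by rewrite nth_iota ?/mk ?subKr //; lia.
have {r1 r2} [r3 nx] : reg (x :: ls' ++ fs) by apply/reg_move => //; apply: pcat.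
have nxn q v : idl (ls' ++ fs) (x ^+ q * v) -> idl (ls' ++ fs) v.
  by elim: q v => [|q IH] v; rewrite ?expr0 ?mul1r // exprS -mulrA => /nx/IH.
have evx : exists2 gam : K, gam != 0 & idl (ls' ++ fs) (ev ls a - gam *: x ^+ D0).
  exists (a.@[fun i => c i / c j]).
    have -> : a.@[fun i => c i / c j] = (c j)^-1 ^+ D0 * a.@[c].
      rewrite !mevalE mulr_sumr !big_seq; apply: eq_bigr => m hm.
      rewrite mulrCA; congr (_ * _); have <- : mdeg m = D0 by apply: (dhomogP _ _ _ ha).
      rewrite mdegE -prodrXr -big_split /=; apply: eq_bigr => i _.
      by rewrite mulrC exprMn.
    by rewrite mulf_neq0 // expf_neq0 // invr_eq0.
  have -> : a.@[fun i => c i / c j] *: x ^+ D0 =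
      mmap (@mpolyC N K) (fun i => (c i / c j)%:MP * x) a.
    rewrite mevalE scaler_suml /mmap !big_seq; apply: eq_bigr => m hm.
    rewrite -scalerA -mul_mpolyC; congr (_ * _).
    have <- : mdeg m = D0 by apply: (dhomogP _ _ _ ha).
    rewrite mdegE -prodrXr -mul_mpolyC rmorph_prod -big_split /=.
    by apply: eq_bigr => i _; rewrite [in RHS]exprMn -rmorphXn.
  apply: mmap_congr => i.
  have ei : (c i / c j) = e i by rewrite /e valK.
  have [->|nij] := eqVneq i j.
    by rewrite divff // mpolyC1 mul1r subrr; apply: idl0.
  by rewrite ei; apply: idl_mem; rewrite mem_cat memls'.
have [gam ngam hgam] := evx.
have nev v : idl (ls' ++ fs) (ev ls a * v) -> idl (ls' ++ fs) v.
  move=> h; apply: (nxn D0).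
  have -> : x ^+ D0 * v = gam^-1%:MP * (ev ls a * v - v * (ev ls a - gam *: x ^+ D0)).
    have -> : ev ls a * v - v * (ev ls a - gam *: x ^+ D0) = v * (gam *: x ^+ D0) by ring.
    by rewrite mul_mpolyC -scalerAr scalerA mulVf // scale1r mulrC.
  by apply: idlM; apply: idlB => //; apply: idlM.
have subfs v : idl fs v -> idl (ls' ++ fs) v.
  by apply: idl_sub => y yf; rewrite mem_cat yf orbT.
have nf v : idl (ls' ++ fs) (f * v) -> idl (ls' ++ fs) v.
  move=> h; apply: nev.
  have -> : ev ls a * v = v * (f * g + ev ls a) - g * (f * v) by ring.
  by apply: idlB; apply: idlM => //; apply: subfs.
have r4 : reg (ls' ++ f :: fs) by apply/reg_move => //; apply: pcat.
pose us' := [seq u * x ^+ i | u <- us, i <- iota 0 D0].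
have xD : idl (ls' ++ f :: fs) (x ^+ D0).
  have i1 v : idl (ls' ++ fs) v -> idl (ls' ++ f :: fs) v.
    by apply: idl_sub => y; rewrite !mem_cat inE => /orP[->|->]; rewrite ?orbT.
  have -> : x ^+ D0 = gam^-1%:MP * ((f * g + ev ls a) - g * f - (ev ls a - gam *: x ^+ D0)).
    have -> : (f * g + ev ls a) - g * f - (ev ls a - gam *: x ^+ D0) = gam *: x ^+ D0 by ring.
    by rewrite mul_mpolyC scalerA mulVf // scale1r.
  apply: idlM; apply: idlB; last exact: i1.
  apply: idlB; first by apply/i1/subfs.
  by apply: idlM; apply: idl_mem; rewrite mem_cat inE eqxx orbT.
exists ls', us'; split; last first.
  rewrite size_allpairs size_iota leq_mul2l; apply/orP; right.
  by rewrite /D0 mulnC leq_mul2r kt orbT.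
split=> //.
- by apply/posforms_cons; split.
- move=> u /allpairsP[[u0 i] /= [u0s _ ->]]; have [d' hd'] := sop_us sp u0s.
  by exists (d' + 1 * i)%N; apply: dhomogM => //; apply: dhomogMn.
move=> v.
suff [s [w [hs hw]]] : exists s w, spn us' s /\ idl (ls' ++ f :: fs) (v - s - x ^+ D0 * w).
  exists s => //; rewrite -[v - s](subrK (x ^+ D0 * w)); apply: idlD => //.
  by rewrite mulrC; apply: idlM.
have: forall r, (r <= D0)%N -> exists s w, spn us' s /\
    idl (ls' ++ f :: fs) (v - s - x ^+ r * w).
  elim=> [_|r IH rD].
    exists 0, v; split; first exact: spn0.
    by rewrite subr0 expr0 mul1r subrr; apply: idl0.
  have [s [w [hs hw]]] := IH (ltnW rD).
  have [s' hs' hw'] := sop_span sp w.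
  have [w' hw''] : idl (x :: ls' ++ f :: fs) (w - s').
    apply: idl_trans hw' => y; rewrite mem_cat => /orP[yl|yf]; last first.
      by apply: idl_mem; rewrite inE mem_cat inE yf !orbT.
    have il : (index y ls < size ls)%N by rewrite index_mem.
    have -> : y = ls`_(Ordinal il) by rewrite /= nth_index.
    have [->|nij] := eqVneq (Ordinal il) j; first by apply: idl_mem; rewrite inE eqxx.
    rewrite -[ls`_ _](subrK ((e (Ordinal il))%:MP * x)); apply: idlD.
      by apply: idl_mem; rewrite inE mem_cat (memls' _ nij) orbT.
    by apply/idlM/idl_mem; rewrite inE eqxx.
  exists (s + s' * x ^+ r), w'; split.
    apply: spnD => //; apply: spn_mul hs' => u us_; apply: spn_mem.
    by apply/allpairsP; exists (u, r); rewrite mem_iota.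
  have -> : v - (s + s' * x ^+ r) - x ^+ r.+1 * w' =
      (v - s - x ^+ r * w) + x ^+ r * (w - s' - w' * x) by rewrite exprS; ring.
  by apply: idlD => //; apply: idlM.
by apply.
Qed.

End SopStep.

(** * Strong families are regular sequences *)

Lemma idl_take (R : comNzRingType) (G : seq R) r v : (r <= size G)%N ->
  idl (rev (take r G)) v <-> exists c : nat -> R, v = \sum_(i < r) c i * G`_i.
Proof.
elim: r v => [|r IH] v rG.
  rewrite take0 /=; split=> [->|[c ->]]; last by rewrite big_ord0.
  by exists (fun=> 0); rewrite big_ord0.
rewrite (take_nth 0) // rev_rcons /=; split=> [[b /IH[|c hc]]|[c ->]].
- exact: ltnW.
- exists (fun i => if (i < r)%N then c i else b).
  rewrite big_ord_recr /= ltnn; under eq_bigr => i _ do rewrite ltn_ord.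
  by rewrite -hc subrK.
- exists (c r); rewrite big_ord_recr /= addrK; apply/IH; first exact: ltnW.
  by exists c.
Qed.

Section Witness.
Variables (K : fieldType) (N D e : nat) (E X : seq (nat * {mpoly K[N]})).
Local Notation E' := (E ++ X).
Local Notation G := (gens E).
Hypothesis fE' : fam D E'.
Hypothesis indep : forall a, (forall m, m \in msupp a -> (fwt E' m <= e)%N) ->
  ev (gens E') a = 0 -> a = 0.

Lemma homog_lift w v : v \is w.-homog -> inalg (gens E') v ->
  exists2 a, ev (gens E') a = v & forall m, m \in msupp a -> fwt E' m = w.
Proof.
move=> hv [a ea]; exists (dfilter (fwt E') (pred1 w) a).
  rewrite -(ev_dfilter _ _ fE') ea dfilter_id // => m /(dhomogP _ _ _ hv) /= ->.
  exact: eqxx.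
by move=> m /msupp_dfilter/andP[_ /eqP].
Qed.

(** Lifted to the variables of [E ++ X], the relation has weight at most [e], so it is an identity
    of polynomials. Every monomial of the lift of [h] then contains a variable of index below [r],
    which puts [h] in the ideal. *)
Lemma no_witness (r : 'I_(size G)) (w dh : nat) (h : {mpoly K[N]}) (c : nat -> {mpoly K[N]}) :
  w = (dh + fdeg r)%N -> (w <= e)%N -> h \is dh.-homog -> inalg (gens E') h ->
  (forall i : 'I_(size G), (i < r)%N -> [/\ c i \is (w - fdeg i).-homog,
     inalg (gens E') (c i) & (w < fdeg i)%N -> c i = 0]) ->
  G`_r * h = \sum_(i < r) c i * G`_i -> idl (rev (take r G)) h.
Proof.
move=> ew we hh ah hc eh; have rG : (r <= size G)%N by apply: ltnW.
pose emb (i : 'I_r) := femb X (widen_ord rG i).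
have [h1 eh1 wh1] := homog_lift hh ah.
have lift_c (i : 'I_r) : exists a, ev (gens E') a = c i /\
    forall m, m \in msupp a -> (fwt E' m + fdeg (emb i) <= w)%N.
  have [|hci aci c0] := hc (widen_ord rG i); first exact: (ltn_ord i).
  rewrite fdeg_femb; have [wi|iw] := ltnP w (fdeg (widen_ord rG i)).
    by exists 0; rewrite rmorph0 (c0 wi); split=> // m; rewrite msupp0.
  have [a ea wa] := homog_lift hci aci; exists a; split=> // m /wa->.
  by rewrite subnK.
have /fin_all_exists[c1 hc1] := lift_c.
pose P := h1 * 'X_(femb X r) - \sum_(i < r) c1 i * 'X_(emb i).
have P0 : P = 0.
  apply: indep.
    move=> m /msuppB_le; rewrite mem_cat => /orP[|].
      rewrite (perm_mem (msuppMX _ _)) => /mapP[m' /wh1 wm' ->].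
      by rewrite mfD wm' /fwt /= wmeasU fdeg_femb addnC -ew.
    move=> /msupp_sum_le/flattenP[s /mapP[i _ ->]].
    rewrite (perm_mem (msuppMX _ _)) => /mapP[m' hm' ->].
    apply: leq_trans we; rewrite mfD addnC; have := (hc1 i).2 m' hm'.
    by rewrite /fwt /= wmeasU.
  rewrite /P rmorphB rmorphM /= evX gens_femb eh1 mulrC eh rmorph_sum /=.
  apply/eqP; rewrite subr_eq0; apply/eqP; apply: eq_bigr => i _.
  by rewrite rmorphM /= evX gens_femb (hc1 i).1.
have div m : m \in msupp h1 -> exists i : 'I_r, m (emb i) != 0%N.
  move=> hm; have : (U_(femb X r) + m)%MM \in msupp (\sum_(i < r) c1 i * 'X_(emb i)).
    move/eqP: P0; rewrite subr_eq0 => /eqP <-.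
    by rewrite (perm_mem (msuppMX _ _)) map_f.
  move=> /msupp_sum_le/flattenP[s /mapP[i _ ->]].
  rewrite (perm_mem (msuppMX _ _)) => /mapP[m' hm' /mnmP/(_ (emb i))].
  rewrite !mnmDE !mnm1E eqxx femb_eq => em; exists i.
  have ri : (r == widen_ord rG i) = false.
    by apply/eqP => /(congr1 val) /= er; have := ltn_ord i; rewrite -er ltnn.
  by rewrite ri add0n in em; rewrite em.
rewrite -eh1 [h1]mpolyE raddf_sum big_seq; apply: idl_sum => m /div[i mi] /=.
rewrite -mul_mpolyC rmorphM; apply: idlM.
rewrite /= /ev mmapX /mmap1 (bigD1 (emb i)) //= mulrC; apply: idlM.
rewrite -(prednK (n := m (emb i))) ?lt0n // exprSr; apply: idlM; apply: idl_mem.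
rewrite mem_rev gens_cat nth_cat /= (leq_trans (ltn_ord i) rG) -(nth_take 0 (ltn_ord i)).
by apply: mem_nth; rewrite size_takel.
Qed.

End Witness.

(** Iterates the size estimate of [sop_extend]. *)
Fixpoint span_bound (d r : nat) : nat :=
  if r is r'.+1 then (span_bound d r' * (span_bound d r' * d))%N else 1%N.

Lemma sop_exists d s r : (r <= s)%N -> exists kap, forall (K : fieldType),
  perfect_field K -> infinite_field K -> forall N (E : seq (nat * {mpoly K[N]})),
  fam d E -> size E = s -> strong kap E ->
  exists ls us, sop (rev (take r (gens E))) ls us /\ (size us <= span_bound d r)%N.
Proof.
elim: r => [_|r IH rs].
  exists 0%N => K _ _ N E _ _ _; rewrite take0.
  by exists [seq 'X_i | i <- enum 'I_N], [:: 1]; split=> //; apply: sop_init.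
have [kr hkr] := IH (ltnW rs).
(* A witness enters a relation of degree [fdeg ro * k], where [k] is at most the number of spanning
   elements. The [r.+1] forms to be adjoined below are the witness and its [r] cofactors. *)
pose e := (d * span_bound d r)%N; pose D := maxn d e.
have ex s' := strong_indep D e s'.
pose kf s' := sval (constructive_indefinite_description _ (ex s')).
have kfP s' := svalP (constructive_indefinite_description _ (ex s')).
have [B hB] := refine_to_strong D s r.+1 kf.
exists (maxn kr B) => K perf inf N E fE sE st.
have [ls [us [sp sus]]] : exists ls us, sop (rev (take r (gens E))) ls us /\ (size us <= span_bound d r)%N.
  by apply: hkr => //; apply: strong_le st; apply: leq_maxl.
have rE : (r < size (gens E))%N by rewrite size_gens sE.
pose ro := Ordinal rE; set fs := rev (take r (gens E)) in sp *.
have [/andP[dr0 drd] hfr] := fdegP fE ro.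
have [[h [k [/andP[k0 kt] hh nh fh]]]|] := sop_dichotomy sp dr0 hfr; last first.
  move=> [k [a [g [kt ha na rel]]]].
  have [ls' [us' [sp' sus']]] := sop_extend sp dr0 hfr inf kt ha na rel.
  exists ls', us'; rewrite (take_nth 0) // rev_rcons; split=> //.
  apply: leq_trans sus' _ => /=; apply: leq_mul => //; apply: leq_mul => //.
case: nh; pose w := (fdeg ro * k)%N; pose dh := (fdeg ro * k.-1)%N.
have ew : w = (dh + fdeg ro)%N by rewrite /w /dh -{1}(prednK k0) mulnS addnC.
have we : (w <= e)%N by apply: leq_mul => //; apply: leq_trans sus.
have [c0 hc0] : exists c0 : nat -> {mpoly K[N]}, (gens E)`_r * h = \sum_(i < r) c0 i * (gens E)`_i.
  by apply/idl_take => //; apply: ltnW.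
pose dg i := (nth (0%N, 0) E i).1.
pose c i := dfilter mdeg (fun j => pred1 w (j + dg i)%N) (c0 i).
have hfh : (gens E)`_r * h \is w.-homog by rewrite ew addnC; apply: dhomogM.
have ec : (gens E)`_r * h = \sum_(i < r) c i * (gens E)`_i.
  have -> : (gens E)`_r * h = dfilter mdeg (pred1 w) ((gens E)`_r * h).
    by rewrite (dfilter_homog_eq w hfh) eqxx.
  rewrite hc0 dfilter_sum; apply: eq_bigr => i _.
  have iE : (i < size E)%N by rewrite sE (leq_trans (ltn_ord i)) // ltnW.
  have [_ hi] := fam_nth fE iE.
  by rewrite (dfilterM (pred1 w) (c0 i) hi).
(* Members of degree zero are discarded, since families have positive degrees; being constants, they
   lie in every subalgebra. *)
pose X0 := filter (fun p : nat * {mpoly K[N]} => (0 < p.1)%N)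
  ((dh, h) :: [seq ((w - dg i)%N, c i) | i <- iota 0 r]).
have fED : fam D E by apply: fam_le fE; apply: leq_maxl.
have homX p : p \in (dh, h) :: [seq ((w - dg i)%N, c i) | i <- iota 0 r] ->
    (p.1 <= D)%N /\ p.2 \is (p.1).-homog.
  have wD : (w <= D)%N by apply: leq_trans we _; apply: leq_maxr.
  rewrite inE => /orP[/eqP->|/mapP[i _ ->]] /=.
    by split=> //; apply: leq_trans wD; rewrite ew leq_addr.
  split; last exact: dfilter_shift_homog.
  by apply: leq_trans (leq_subr _ _) wD.
have [||||X [fX sX aX stX]] := hB K N D E X0 fED.
- by move=> p; rewrite mem_filter => /andP[p0 /homX[pD hp]]; rewrite p0.
- by rewrite sE.
- rewrite size_filter; apply: leq_trans (count_size _ _) _.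
  by rewrite /= size_map size_iota.
- by apply: strong_le st; apply: leq_maxr.
have fE' : fam D (E ++ X) by apply/fam_cat.
have indep := kfP _ K perf N (E ++ X) fE' (erefl _) stX.
have alg p : p \in (dh, h) :: [seq ((w - dg i)%N, c i) | i <- iota 0 r] ->
    inalg (gens (E ++ X)) p.2.
  move=> hp; have [_ hom] := homX p hp; have [p0|p0] := posnP p.1; last first.
    by apply: aX; rewrite mem_filter p0.
  rewrite p0 in hom; rewrite (@mpoly_const_supp _ _ p.2); first exact: inalgC.
  by move=> m /(dhomogP _ _ _ hom) /= /eqP; rewrite mdeg_eq0 => /eqP.
apply: (no_witness fE' indep (r := ro) ew we hh _ _ ec).
  by apply: (alg (dh, h)); rewrite inE eqxx.
move=> i ir; have hin : ((w - dg i)%N, c i) \in (dh, h) :: [seq ((w - dg i)%N, c i) | i <- iota 0 r].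
  by rewrite inE; apply/orP; right; apply: (map_f (fun i => ((w - dg i)%N, c i))); rewrite mem_iota.
split; first exact: (homX _ hin).2.
  exact: (alg _ hin).
move=> wi; rewrite /c dfilter_eq0 // => m _ /=; apply/eqP => e1.
by move: wi; rewrite -e1 /fdeg -/(dg i) ltnNge leq_addl.
Qed.

Theorem strong_regular d s : exists kap, forall (K : fieldType),
  perfect_field K -> infinite_field K -> forall N (E : seq (nat * {mpoly K[N]})),
  fam d E -> size E = s -> strong kap E -> reg (rev (gens E)).
Proof.
have [kap hk] := sop_exists d (leqnn s); exists kap => K perf inf N E fE sE st.
have [ls [us [sp _]]] := hk K perf inf N E fE sE st.
have := reg_drop (size ls) (sop_reg sp); rewrite drop_size_cat //.
by rewrite take_oversize // size_gens sE.
Qed.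

(** * Perfect closure *)

Section PerfectClosure.
Variables (F : fieldType) (p : nat).
Hypothesis ch : p \in [pchar F].
Implicit Types (a b : F) (u v w : nat * F).
Local Open Scope quotient_scope.

Let p_nat k : [pchar F].-nat (p ^ k)%N.
Proof.
rewrite pnatX pnatE ?ch ?orbT // ?(pcharf_prime ch) //.
Qed.

Lemma frobD a b k : (a + b) ^+ (p ^ k) = a ^+ (p ^ k) + b ^+ (p ^ k).
Proof. by rewrite exprDn_pchar. Qed.

Lemma frobN a k : (- a) ^+ (p ^ k) = - a ^+ (p ^ k).
Proof. by rewrite exprNn_pchar. Qed.

Lemma frob_inj k : injective (fun a => a ^+ (p ^ k)).
Proof.
move=> a b /= e; apply/eqP; rewrite -subr_eq0.
have : (a - b) ^+ (p ^ k) == 0 by rewrite frobD frobN e subrr.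
by rewrite expf_eq0 => /andP[_].
Qed.

(* [(n, a)] stands for the [p ^ n]-th root of [a] *)
Definition pc_equiv u v : bool := u.2 ^+ (p ^ v.1) == v.2 ^+ (p ^ u.1).

Lemma pc_refl : reflexive pc_equiv.
Proof. by move=> u; apply: eqxx. Qed.

Lemma pc_sym : ssrbool.symmetric pc_equiv.
Proof. by move=> u v; rewrite /pc_equiv eq_sym. Qed.

Lemma pc_trans : transitive pc_equiv.
Proof.
move=> v u w /eqP uv /eqP vw; apply/eqP; apply: (@frob_inj v.1) => /=.
rewrite -!exprM -!expnD addnC expnD exprM uv -exprM -expnD addnC expnD exprM vw.
by rewrite -exprM -expnD addnC.
Qed.

Canonical pc_equiv_rel := EquivRel pc_equiv pc_refl pc_sym pc_trans.

Definition perfc := {eq_quot pc_equiv}.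

HB.instance Definition _ : EqQuotient _ pc_equiv perfc := EqQuotient.on perfc.
HB.instance Definition _ := Choice.on perfc.

Definition rt (n : nat) a : perfc := \pi_perfc (n, a).

Lemma rt_eq n m a b : rt n a = rt m b <-> a ^+ (p ^ m) = b ^+ (p ^ n).
Proof. by split=> [/eqmodP/eqP|h] //; apply/eqmodP/eqP. Qed.

Lemma rtS n k a : rt n a = rt (n + k) (a ^+ (p ^ k)).
Proof. by apply/rt_eq; rewrite -exprM -expnD addnC. Qed.

Lemma rt_surj (x : perfc) : exists n a, x = rt n a.
Proof. by exists (repr x).1, (repr x).2; rewrite /rt -surjective_pairing reprK. Qed.

(** Bringing elements to a common level reduces the field axioms to those of [F]. *)
Lemma rt_common (x y : perfc) : exists n a b, x = rt n a /\ y = rt n b.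
Proof.
have [n [a ->]] := rt_surj x; have [m [b ->]] := rt_surj y.
exists (n + m)%N, (a ^+ (p ^ m)), (b ^+ (p ^ n)); split; first exact: rtS.
by rewrite addnC; apply: rtS.
Qed.

Lemma rt_common3 (x y z : perfc) :
  exists n a b c, [/\ x = rt n a, y = rt n b & z = rt n c].
Proof.
have [n [a [b [-> ->]]]] := rt_common x y; have [m [c ->]] := rt_surj z.
exists (n + m)%N, (a ^+ (p ^ m)), (b ^+ (p ^ m)), (c ^+ (p ^ n)); split.
- exact: rtS.
- exact: rtS.
- by rewrite addnC; apply: rtS.
Qed.

Definition pc_add (x y : perfc) : perfc :=
  rt ((repr x).1 + (repr y).1)
     ((repr x).2 ^+ (p ^ (repr y).1) + (repr y).2 ^+ (p ^ (repr x).1)).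
Definition pc_mul (x y : perfc) : perfc :=
  rt ((repr x).1 + (repr y).1)
     ((repr x).2 ^+ (p ^ (repr y).1) * (repr y).2 ^+ (p ^ (repr x).1)).
Definition pc_opp (x : perfc) : perfc := rt (repr x).1 (- (repr x).2).
Definition pc_inv (x : perfc) : perfc := rt (repr x).1 (repr x).2^-1.

Let reprE n a : (repr (rt n a)).2 ^+ (p ^ n) = a ^+ (p ^ (repr (rt n a)).1).
Proof. by apply/rt_eq; rewrite /rt -surjective_pairing reprK. Qed.

Lemma pc_addE n a b : pc_add (rt n a) (rt n b) = rt n (a + b).
Proof.
apply/rt_eq; have := reprE n a; have := reprE n b.
case: (repr (rt n a)) => n1 a1; case: (repr (rt n b)) => n2 b1 /= eb ea.
rewrite frobD frobD -!exprM -!expnD; congr (_ + _).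
  by rewrite addnC expnD exprM ea -exprM -expnD.
by rewrite addnC expnD exprM eb -exprM -expnD addnC.
Qed.

Lemma pc_mulE n a b : pc_mul (rt n a) (rt n b) = rt n (a * b).
Proof.
apply/rt_eq; have := reprE n a; have := reprE n b.
case: (repr (rt n a)) => n1 a1; case: (repr (rt n b)) => n2 b1 /= eb ea.
rewrite !exprMn -!exprM -!expnD; congr (_ * _).
  by rewrite addnC expnD exprM ea -exprM -expnD.
by rewrite addnC expnD exprM eb -exprM -expnD addnC.
Qed.

Lemma pc_oppE n a : pc_opp (rt n a) = rt n (- a).
Proof. by apply/rt_eq; rewrite !frobN reprE. Qed.

Lemma pc_invE n a : pc_inv (rt n a) = rt n a^-1.
Proof. by apply/rt_eq; rewrite !exprVn reprE. Qed.

Let rt0 n : rt n 0 = rt 0 0.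
Proof. by apply/rt_eq; rewrite !expr0n !expn_eq0 !eqn0Ngt (prime_gt0 (pcharf_prime ch)). Qed.

Let rt1 n : rt n 1 = rt 0 1.
Proof. by apply/rt_eq; rewrite !expr1n. Qed.

Lemma pc_addA : associative pc_add.
Proof.
move=> x y z; have [n [a [b [c [-> -> ->]]]]] := rt_common3 x y z.
by rewrite !pc_addE addrA.
Qed.

Lemma pc_addC : commutative pc_add.
Proof.
by move=> x y; have [n [a [b [-> ->]]]] := rt_common x y; rewrite !pc_addE addrC.
Qed.

Lemma pc_add0 : left_id (rt 0 0) pc_add.
Proof. by move=> x; have [n [a ->]] := rt_surj x; rewrite -(rt0 n) pc_addE add0r. Qed.

Lemma pc_addN : left_inverse (rt 0 0) pc_opp pc_add.
Proof.
by move=> x; have [n [a ->]] := rt_surj x; rewrite pc_oppE pc_addE addNr rt0.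
Qed.

HB.instance Definition _ := GRing.isZmodule.Build perfc pc_addA pc_addC pc_add0 pc_addN.

Lemma pc_mulA : associative pc_mul.
Proof.
move=> x y z; have [n [a [b [c [-> -> ->]]]]] := rt_common3 x y z.
by rewrite !pc_mulE mulrA.
Qed.

Lemma pc_mulC : commutative pc_mul.
Proof.
by move=> x y; have [n [a [b [-> ->]]]] := rt_common x y; rewrite !pc_mulE mulrC.
Qed.

Lemma pc_mul1 : left_id (rt 0 1) pc_mul.
Proof. by move=> x; have [n [a ->]] := rt_surj x; rewrite -(rt1 n) pc_mulE mul1r. Qed.

Lemma pc_mulDl : left_distributive pc_mul pc_add.
Proof.
move=> x y z; have [n [a [b [c [-> -> ->]]]]] := rt_common3 x y z.
by rewrite !(pc_mulE, pc_addE) mulrDl.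
Qed.

Lemma pc_oner_neq0 : rt 0 1 != rt 0 0.
Proof. by apply/eqP => /rt_eq /eqP; rewrite !expr1 oner_eq0. Qed.

HB.instance Definition _ := GRing.Zmodule_isComNzRing.Build perfc
  pc_mulA pc_mulC pc_mul1 pc_mulDl pc_oner_neq0.

Lemma pc_mulV (x : perfc) : x != rt 0 0 -> pc_mul (pc_inv x) x = rt 0 1.
Proof.
have [n [a ->]] := rt_surj x => h; rewrite pc_invE pc_mulE mulVf ?rt1 //.
by apply: contraNneq h => ->; rewrite rt0.
Qed.

Lemma pc_inv0 : pc_inv (rt 0 0) = rt 0 0.
Proof. by rewrite pc_invE invr0. Qed.

HB.instance Definition _ := GRing.ComNzRing_isField.Build perfc pc_mulV pc_inv0.

Definition pc_emb : F -> perfc := rt 0.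

Fact pc_emb_zmod : zmod_morphism pc_emb.
Proof.
move=> a b; apply/esym; rewrite -[RHS]/(rt 0 (a - b)) -pc_addE -pc_oppE //.
Qed.

Fact pc_emb_monoid : monoid_morphism pc_emb.
Proof. by split=> // a b; apply/esym/pc_mulE. Qed.

HB.instance Definition _ := GRing.isZmodMorphism.Build F perfc pc_emb pc_emb_zmod.
HB.instance Definition _ := GRing.isMonoidMorphism.Build F perfc pc_emb pc_emb_monoid.

Lemma rtX n a k : rt n a ^+ k = rt n (a ^+ k).
Proof.
elim: k => [|k IH]; first by rewrite !expr0 rt1.
by rewrite !exprS IH; apply: pc_mulE.
Qed.

Lemma pc_root (x : perfc) : exists y, y ^+ p = x.
Proof.
have [n [a ->]] := rt_surj x; exists (rt (n + 1) a).
by rewrite rtX (rtS n 1) expn1.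
Qed.

Lemma pc_pchar : p \in [pchar perfc].
Proof. exact: (rmorph_pchar pc_emb ch). Qed.

End PerfectClosure.

(** Dividing the exponents by [p] and taking [p]-th roots of the coefficients gives a root, since
    Frobenius is additive. *)
Lemma perfect_pchar (L : fieldType) p : p \in [pchar L] ->
  (forall x : L, exists y, y ^+ p = x) -> perfect_field L.
Proof.
move=> ch rts n q Tq; right.
pose root x := sval (constructive_indefinite_description _ (rts x)).
have rootP x : root x ^+ p = x by rewrite /root; case: constructive_indefinite_description.
have pp := pcharf_prime ch.
pose dv (m : 'X_{1..n}) : 'X_{1..n} := [multinom (m i %/ p)%N | i < n].
have dvK m : m \in msupp q -> (dv m *+ p)%MM = m.
  move=> hm; apply/mnmP => i; rewrite mulmnE mnmE divnK //.
  by rewrite (dvdn_pcharf ch) (goodmP i (Tq m hm)).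
pose r := \sum_(m <- msupp q) root q@_m *: 'X_[dv m].
have chS : p \in [pchar {mpoly L[n]}].
  by apply: (rmorph_pchar (@mpolyC n L)).
exists p, r; split.
- exact: prime_gt1.
- rewrite /r -(pFrobenius_autE chS) rmorph_sum /= [LHS]mpolyE !big_seq.
  apply: eq_bigr => m hm; rewrite pFrobenius_autE exprZn rootP mpolyXn dvK //.
- move=> m /msupp_sum_le/flattenP[s /mapP[m' ]]; rewrite filter_predT => hm' ->.
  by move=> /msuppZ_le; rewrite msuppX inE => /eqP->; rewrite dvK.
Qed.

Lemma perfect_pchar0 (L : fieldType) : [pchar L] =i pred0 -> perfect_field L.
Proof.
move=> /pcharf0P ch n q Tq; left; apply: mpoly_const_supp => m hm.
apply/mnmP => i; rewrite mnm0E; apply/eqP; rewrite -ch.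
by rewrite (goodmP i (Tq m hm)).
Qed.

Lemma infinite_ext (K L : fieldType) (iota : {rmorphism K -> L}) :
  infinite_field K -> infinite_field L.
Proof. by move=> [f hf]; exists (iota \o f) => i j /fmorph_inj/hf. Qed.

Lemma perfect_ext (K : fieldType) : exists (L : fieldType) (iota : {rmorphism K -> L}),
  perfect_field L /\ infinite_field L.
Proof.
pose F : fieldType := {fraction {poly K}}.
pose i1 : {rmorphism K -> F} := @FracField.tofrac {poly K} \o @polyC K.
have infF : infinite_field F.
  exists (fun i => FracField.tofrac ('X^i : {poly K})) => i j /eqP.
  rewrite tofrac_eq => /eqP/(congr1 (fun q : {poly K} => size q)).
  by rewrite !size_polyXn => -[].
have [[p ch]|nch] := classic (exists p, p \in [pchar F]).
  exists (perfc ch : fieldType), (pc_emb ch \o i1 : {rmorphism K -> perfc ch}); split.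
    by apply: (perfect_pchar (pc_pchar ch)); apply: pc_root.
  exact: (infinite_ext (pc_emb ch)).
exists F, i1; split=> //; apply: perfect_pchar0 => p; apply/negP => hp.
by apply: nch; exists p.
Qed.

(** * The bound *)

Lemma spl_bound q d : exists B, forall (K : fieldType), perfect_field K ->
  infinite_field K -> forall N m n (A : 'M[{mpoly K[N]}]_(m, n)),
  (m * n * d <= q)%N -> (forall i j, (msize (A i j) <= d.+1)%N) -> spl B A.
Proof.
pose kap s := sval (constructive_indefinite_description _ (strong_regular d s)).
have kapP s := svalP (constructive_indefinite_description _ (strong_regular d s)).
(* The fixed family is empty, hence strong; [q] bounds the number of components of positive degree,
   [d] per entry. *)
have [B hB] := refine_to_strong d 0 q kap.
exists B => K perf inf N m n A hq hA.
pose cmp k (ij : 'I_m * 'I_n) := dfilter mdeg (pred1 k) (A ij.1 ij.2).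
pose F := [seq (k, cmp k ij) | ij <- enum {: 'I_m * 'I_n}, k <- iota 1 d].
have [|||||X [fX sX aX stX]] := hB K N d [::] F.
- by [].
- move=> p /allpairsP[[ij k] /= [_]]; rewrite mem_iota add1n ltnS => /andP[k0 kd] ->.
  by split; [rewrite k0 | apply: dfilter_homog].
- by [].
- by rewrite size_allpairs size_iota -cardE card_prod !card_ord.
- by move=> k c _ _ i.
rewrite cat0s in aX stX; pose l := rev (gens X).
have rl : reg l by apply: (kapP (size X) K perf inf N X fX (erefl _) stX).
have pl : posforms l.
  by move=> x; rewrite mem_rev => /mapP[p /fX[/andP[p0 _] hp] ->]; exists p.1.
have alg i j : exists a, ev l a = A i j.
  rewrite (@sum_dfilter _ _ mdeg d.+1 (A i j)); last first.
    by move=> u /msize_mdeg_lt h; apply: leq_trans (hA i j).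
  apply: inalg_sum => k _; have [k0|k0] := posnP k.
    rewrite (@mpoly_const_supp _ _ (dfilter _ _ _)); first exact: inalgC.
    by move=> u /msupp_dfilter/andP[_ /eqP]; rewrite k0 => /eqP; rewrite mdeg_eq0 => /eqP.
  apply: (@inalg_sub _ _ (gens X)); first by move=> x; rewrite mem_rev.
  apply: (aX (k : nat, cmp k (i, j))); apply/allpairsP; exists ((i, j), (k : nat)).
  by rewrite mem_enum mem_iota k0 add1n ltn_ord.
have /fin_all_exists[a0 ha0] := fun ij : 'I_m * 'I_n => alg ij.1 ij.2.
pose A0 : 'M_(m, n) := \matrix_(i, j) a0 (i, j).
have -> : A = map_mx (ev l) A0 by apply/matrixP => i j; rewrite !mxE (ha0 (i, j)).
apply: (spl_le (@mpoly_coherent K N) (k := size l)).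
  by rewrite size_rev size_gens.
by apply: spl_flat; [apply: flat_ev | apply: hilbert_syzygy].
Qed.

Lemma nmax_mono (f f' : nat -> nat) b b' : (b <= b')%N ->
  (forall i, (f i <= f' i)%N) -> (nmax f b <= nmax f' b')%N.
Proof.
move=> bb' ff'; apply/bigmax_leqP => i _; apply: leq_trans (ff' i) _.
by apply: leq_nmax; apply: leq_trans bb'; rewrite -ltnS.
Qed.

Theorem theoremC :
  exists C : nat -> nat -> nat -> nat,
    ascending3 C /\
    (forall m n d, (0 < m)%N -> (0 < n)%N -> (0 < C m n d)%N) /\
    (forall (K : fieldType) (N m n d : nat) (A : 'M[{mpoly K[N]}]_(m, n)),
        (0 < m)%N -> (0 < n)%N ->
        (forall i j, (msize (A i j) <= d.+1)%N) ->
        pd_le A (C m n d)).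
Proof.
pose g q d := sval (constructive_indefinite_description _ (spl_bound q d)).
have gP q d := svalP (constructive_indefinite_description _ (spl_bound q d)).
(* The chosen [g] need not be monotone, so maxima over all smaller arguments make the bound
   ascending; the successor makes it positive. *)
exists (fun m n d => (nmax (fun q => nmax (g q) d) (m * n * d)).+1); split; last split=> //.
  move=> m m' n n' d d' _ _ mm nn dd; rewrite ltnS; apply: nmax_mono.
    by apply: leq_mul => //; apply: leq_mul.
  by move=> q; apply: nmax_mono.
move=> K N m n d A _ _ hA; apply: spl_pd_le.
have [L [iota [perf inf]]] := perfect_ext K.
apply: (@spl_descent _ _ iota); apply: (spl_le (@mpoly_coherent L N) (k := g (m * n * d)%N d)).
  apply: leqW; apply: (@leq_trans (nmax (g (m * n * d)%N) d)); first exact: leq_nmax.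
  exact: (@leq_nmax (fun q => nmax (g q) d)).
apply: (gP _ d L perf inf N m n _ (leqnn _)) => i j; rewrite mxE msizeE.
apply/bigmax_leqP_seq => u hu _; apply: leq_trans (hA i j); apply: msize_mdeg_lt.
move: hu; rewrite !mcoeff_msupp /= mcoeff_map_mpoly; apply: contraNneq => ->.
by apply/eqP; apply: (rmorph0 iota).
Qed.
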